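(* Let $\Gamma$ be a finitely generated group, $\mathfrak u$ a non-principal ultrafilter on $\mathbb N$, $(\lambda_k)\subset\mathbb R$ a sequence with $\lambda_k\to\infty$, $\mu_k=e^{\lambda_k}$, $\mu=(\mu_k)_k$, and let $(\phi_k)$ be a sequence of representations in $\mathcal M_\Gamma(\mathbb R)$ to which $\mu$ is adapted. Endow $T^{\mathfrak u}=\mathrm{Cone}^{\mathfrak u}(\mathbb H^2,(\lambda_k),(0))$ with the ultralimit orientation $or^{\mathfrak u}$ and $T\mathbb R^{\mathfrak u}_\mu=\mathbb H^2(\mathbb R^{\mathfrak u}_\mu)/\{\mathrm{dist}_{\mathbb H^2(\mathbb R^{\mathfrak u}_\mu)}=0\}$ with the orientation $or_{(\mathbb R^{\mathfrak u}_\mu)_{\mathcal O}}$ coming from the cyclic order on $\mathbb S^1((\mathbb R^{\mathfrak u}_\mu)_{\mathcal O})$. Then the $\Gamma$-equivariant isometry $\Psi\colon T^{\mathfrak u}\to T\mathbb R^{\mathfrak u}_\mu$ induced by $(x_k+iy_k)_k\mapsto(x_k)_k+i(y_k)_k$ is orientation preserving.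
   Context: **Fields.** $\mathbb R^{\mathfrak u}=\mathbb R^{\mathbb N}/\sim$ (equality $\mathfrak u$-almost surely), a real closed field in which $\mu$ is positive infinite. $\mathcal O_\mu=\{x\in\mathbb R^{\mathfrak u}:|x|<\mu^k\text{ for some }k\in\mathbb Z\}$, $\mathcal J_\mu=\{x:|x|<\mu^k\text{ for all }k\in\mathbb Z\}$; the Robinson field $\mathbb F:=\mathbb R^{\mathfrak u}_\mu=\mathcal O_\mu/\mathcal J_\mu$ is real closed, non-Archimedean, and every element is smaller than some power of $\mu$. For $h>0$ in $\mathbb F$, $\log_\mu(h)\in\mathbb R$ is given by the Dedekind cut $\{m/n:\mu^m\le h^n,\ m\in\mathbb Z,\ n\in\mathbb N_{>0}\}$. With $\mathcal O=\{h\in\mathbb F:h=0\text{ or }\log_\mu|h|\le0\}$ and $\mathcal J=\{h\in\mathbb F:h=0\text{ or }\log_\mu|h|<0\}$, $(\mathbb R^{\mathfrak u}_\mu)_{\mathcal O}=\mathbb F_{\mathcal O}=\mathcal O/\mathcal J$, an ordered real closed field. **Spaces.** For real closed $\mathbb K$, $\mathbb H^2(\mathbb K)=\{z=x+iy\in\mathbb K[i]:x^2+y^2<1\}$, $\mathbb H^2=\mathbb H^2(\mathbb R)$ is the Poincaré disc with its metric of curvature $-1$, $\|x+iy\|=\sqrt{x^2+y^2}$. On $\mathbb H^2(\mathbb F)$ the pseudo-distance is $\log_\mu\big(\|1-\bar zz'\|^2/((1-\|z\|^2)(1-\|z'\|^2))\big)$; $\pi\colon\mathbb H^2(\mathbb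 F)\to T\mathbb R^{\mathfrak u}_\mu$ is the quotient, an $\mathbb R$-tree. $T^{\mathfrak u}$ is the set of sequences $(z_k)$ in $\mathbb H^2$ with $\mathrm{dist}_{\mathbb H^2}(z_k,0)/\lambda_k$ $\mathfrak u$-bounded, with pseudo-distance $\lim_{\mathfrak u}\mathrm{dist}_{\mathbb H^2}(z_k,z'_k)/\lambda_k$, modulo pseudo-distance $0$; it is an $\mathbb R$-tree. $\Psi\colon T^{\mathfrak u}\to T\mathbb R^{\mathfrak u}_\mu$ sends the class of $(x_k+iy_k)_k$ to the class of the reduction modulo $\mathcal J_\mu$ of $(x_k)_k+i(y_k)_k$; it is a $\Gamma$-equivariant isometry for the actions below. **Actions.** $\mathrm{PSL}_2(\mathbb K)$ acts on $\mathbb H^2(\mathbb K)$ by Möbius transformations (via the Cayley transform). Let $S$ be a finite generating set of $\Gamma$. $\mathcal M_\Gamma(\mathbb R)$ is the set of representations $\phi\colon\Gamma\to\mathrm{PSL}_2(\mathbb R)$ with $\sum_{s\in S}[A_s,A_s^T]=0$, $A_s=\mathrm{Ad}(\phi(s))\in M_{4\times4}(\mathbb R)$ (conjugation on $M_{2\times2}(\mathbb R)$). $\mu$ is adapted to $(\phi_k)$ if $\sum_{s\in S}\mathrm{tr}(\phi_k(s)\phi_k(s)^T)\le c_2\mu_k$ for some $c_2>0$ and $\mathfrak u$-almost every $k$. $\Gamma$ acts on $T^{\mathfrak u}$ by $\phi^{\mathfrak u}(\gamma)[z_k]=[\phi_k(\gamma)z_k]$ and on $T\mathbb R^{\mathfrak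 u}_\mu$ via $\phi^{\mathfrak u}_\mu\colon\Gamma\to\mathrm{PSL}_2(\mathbb R^{\mathfrak u}_\mu)$, whose entries are the classes of the sequences of entries of $\phi_k(\gamma)$. **Orientations.** A cyclic order on $\Omega$ is $o\colon\Omega^3\to\{-1,0,1\}$ with (1) $o(z_1,z_2,z_3)=0$ iff $\mathrm{Card}\{z_1,z_2,z_3\}\le2$; (2) $o(z_1,z_2,z_3)=o(z_2,z_3,z_1)=-o(z_1,z_3,z_2)$; (3) $o(z_1,z_2,z_3)=1=o(z_1,z_3,z_4)$ implies $o(z_1,z_2,z_4)=1$. $\mathcal G_X(P)$ is the set of germs at $P$ of nondegenerate oriented segments starting at $P$ (identified if they agree on some $[0,\varepsilon)$); a point $x\ne P$ represents the germ of the segment from $P$ to $x$. An orientation of an $\mathbb R$-tree is a cyclic order on germs at each point; an isometry is orientation preserving if the induced maps on germs preserve these. The standard orientation of $\mathbb H^2$ is given by the cyclic order $o_{\mathbb R}(z_1,z_2,z_3)=\mathrm{sgn}\det(z_2-z_1,z_3-z_2)$ on $\partial_\infty\mathbb H^2=\mathbb S^1$ through $\mathcal G_{\mathbb H^2}(P)\cong\partial_\infty\mathbb H^2$, giving cyclic orders $or(P)$. The ultralimit orientation of $T^{\mathfrak u}$ is: $or^{\mathfrak u}([P_k])([x_k],[y_k],[z_k])=0$ if two of the three germs at $[P_k]$ coincide, and $\lim_{\mathfrak u}or(P_k)(x_k,y_k,z_k)$ otherwise. On $T\mathbb R^{\mathfrak u}_\mu$: at $p_0=\pi(0)$, sending $u\in\mathbb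 S^1(\mathbb F)$ to the germ of $\pi(\{tu:0\le t<1\})$ induces a bijection $\mathbb S^1(\mathbb F_{\mathcal O})\cong\mathcal G(p_0)$; translating by elements of $\mathrm{PSL}_2(\mathbb F)$ gives bijections $\mathbb S^1(\mathbb F_{\mathcal O})\cong\mathcal G(p)$ for all $p$, and the cyclic order $\mathrm{sgn}\det(z_2-z_1,z_3-z_2)$ on $\mathbb S^1(\mathbb F_{\mathcal O})$ induces a cyclic order on $\mathcal G(p)$ independent of choices; this is $or_{(\mathbb R^{\mathfrak u}_\mu)_{\mathcal O}}$. *)

(* Defs.v *)
From HB Require Import structures.
From mathcomp Require Import all_boot all_order all_algebra.
From mathcomp Require Import ring_quotient.
From mathcomp Require Import complex.
From mathcomp Require Import finmap.
From mathcomp Require Import all_classical all_reals all_analysis.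
From mathcomp Require Import ring lra zify.

Set Implicit Arguments.
Unset Strict Implicit.
Unset Printing Implicit Defensive.

Import Order.TTheory GRing.Theory Num.Theory.
Import numFieldNormedType.Exports.

Local Open Scope classical_set_scope.
Local Open Scope quotient_scope.
Local Open Scope complex_scope.
Local Open Scope ring_scope.

Record npultrafilter := NPUltrafilter {
  ult_sets :> set_system nat;
  ult_ultra : UltraFilter ult_sets;
  ult_nonprincipal : forall n : nat, ult_sets <> principal_filter n }.

Section UltrafilterFacts.
Variable u : npultrafilter.

#[global] Instance npultra_ultra : UltraFilter u := ult_ultra u.
#[global] Instance npultra_proper : ProperFilter u := @ultra_proper _ _ (ult_ultra u).
#[global] Instance npultra_filter : Filter u := @filter_filter _ _ npultra_proper.

Lemma npultra_cofinite (A : set nat) :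
  (\forall k \near \oo, A k) -> \forall k \near ult_sets u, A k.
Proof.
move=> [N _ NA].
have [//|uC] := in_ultra_setVsetC A (ult_ultra u).
have sub n : ult_sets u (~` [set n]).
  have [un|//] := in_ultra_setVsetC [set n] (ult_ultra u).
  exfalso; apply: (ult_nonprincipal (n := n)); symmetry.
  apply: (@max_filter _ _ (ult_ultra u)) => // => [|B uB].
    exact: principal_filter_proper.
  apply/principal_filterP.
  have /filter_ex[m [Bm <-]] : ult_sets u (B `&` [set n]) by exact: filterI.
  done.
have big n : ult_sets u (~` [set m | (m < n)%N]).
  elim: n => [|n IH]; first by apply: filterS filterT => m _ /=.
  apply: filterS (filterI IH (sub n)) => m [/= h1 h2]; rewrite ltnS leq_eqVlt.
  by case/orP => // /eqP.
have /filter_ex[m [/= h1 h2]] :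
  ult_sets u ((~` A) `&` (~` [set m | (m < N)%N])) by exact: filterI.
by exfalso; apply: h1; apply: NA; rewrite /= leqNgt; apply/negP.
Qed.

Lemma npultra_or (A B : set nat) :
  (\forall k \near ult_sets u, A k \/ B k) ->
  (\forall k \near ult_sets u, A k) \/ (\forall k \near ult_sets u, B k).
Proof.
move=> H; have [uA|uA] := in_ultra_setVsetC A (ult_ultra u); first by left.
by right; apply: filterS (filterI H uA) => k [[]].
Qed.

End UltrafilterFacts.

Section Ultrapower.
Variables (K : rcfType) (u : npultrafilter).
Implicit Types f g : nat -> K.

(* R^u is the quotient of the ring of all sequences by the ideal of those that
   vanish u-almost surely. *)
Definition null_seq : pred (nat -> K) :=
  fun f => `[< \forall k \near ult_sets u, f k = 0 >].

Fact null_seq_ideal : idealr_closed null_seq.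
Proof.
split.
- by apply/asboolP; apply: filterE.
- apply/negP => /asboolP H.
  by have /filter_ex[k /eqP] := H; rewrite oner_eq0.
- move=> a f g /asboolP uf /asboolP ug; apply/asboolP.
  apply: filterS (filterI uf ug) => k [fk gk].
  have -> : (a * f + g) k = a k * f k + g k by [].
  by rewrite fk gk mulr0 addr0.
Qed.

HB.instance Definition _ := isIdealr.Build (nat -> K) null_seq null_seq_ideal.

Definition null_ideal : idealr (nat -> K : comNzRingType) := null_seq.

Definition ultrapower := {ideal_quot null_ideal}.

HB.instance Definition _ := GRing.ComNzRing.on ultrapower.

Definition uclass f : ultrapower := \pi_{ideal_quot null_ideal} f.
Definition urepr (q : ultrapower) : nat -> K := repr q.

Lemma ureprK q : uclass (urepr q) = q. Proof. exact: reprK. Qed.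

Lemma uclass_eq f g : uclass f = uclass g <-> \forall k \near ult_sets u, f k = g k.
Proof.
rewrite /uclass; split.
- move/eqP; rewrite -Quotient.idealrBE => /asboolP; apply: filterS => k.
  by move=> /eqP; rewrite subr_eq0 => /eqP.
- move=> H; apply/eqP; rewrite -Quotient.idealrBE; apply/asboolP.
  by apply: filterS H => k fg; apply/eqP; rewrite subr_eq0 fg.
Qed.

Lemma urepr_class f : \forall k \near ult_sets u, urepr (uclass f) k = f k.
Proof. by apply/uclass_eq; rewrite ureprK. Qed.

Lemma uclassD f g : uclass f + uclass g = uclass (f + g).
Proof. by rewrite /uclass piE. Qed.
Lemma uclassM f g : uclass f * uclass g = uclass (f * g).
Proof. by rewrite /uclass piE. Qed.
Lemma uclassN f : - uclass f = uclass (- f).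
Proof. by rewrite /uclass piE. Qed.
Lemma uclass0 : 0 = uclass 0 :> ultrapower.
Proof. by rewrite /uclass piE. Qed.
Lemma uclass1 : 1 = uclass 1 :> ultrapower.
Proof. by rewrite /uclass piE. Qed.

Definition uinv (q : ultrapower) : ultrapower :=
  uclass (fun k => (urepr q k)^-1).

Fact umulVf : forall q : ultrapower, q != 0 -> uinv q * q = 1.
Proof.
move=> q q0; rewrite -{2}[q]ureprK /uinv uclassM uclass1; apply/uclass_eq.
have : \forall k \near ult_sets u, (urepr q k = 0) \/ (urepr q k != 0).
  by apply: filterE => k; case: eqVneq => [->|]; [left|right].
case/npultra_or => [H|]; last first.
  by apply: filterS => k k0; rewrite -[LHS]/(_ * _) mulVf.
exfalso; move/eqP: q0; apply; rewrite -[q]ureprK uclass0; exact/uclass_eq.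
Qed.

Fact uinv0 : uinv 0 = 0.
Proof.
rewrite /uinv {2}uclass0; apply/uclass_eq.
have := urepr_class 0; rewrite -uclass0; apply: filterS => k ->.
by rewrite invr0.
Qed.

HB.instance Definition _ := GRing.ComNzRing_isField.Build ultrapower umulVf uinv0.

Definition ule (p q : ultrapower) := `[< \forall k \near ult_sets u, urepr p k <= urepr q k >].
Definition unorm (q : ultrapower) := if ule 0 q then q else - q.

Lemma ule_class f g :
  reflect (\forall k \near ult_sets u, f k <= g k) (ule (uclass f) (uclass g)).
Proof.
apply: (iffP (asboolP _)) => H.
- by apply: filterS (filterI H (filterI (urepr_class f) (urepr_class g)))
    => k [h [<- <-]].
- by apply: filterS (filterI H (filterI (urepr_class f) (urepr_class g)))
    => k [h [-> ->]].
Qed.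

Fact ule0_add x y : ule 0 x -> ule 0 y -> ule 0 (x + y).
Proof.
rewrite -[x]ureprK -[y]ureprK uclass0 uclassD.
move=> /ule_class hx /ule_class hy; apply/ule_class.
by apply: filterS (filterI hx hy) => k [a b]; apply: addr_ge0.
Qed.

Fact ule0_mul x y : ule 0 x -> ule 0 y -> ule 0 (x * y).
Proof.
rewrite -[x]ureprK -[y]ureprK uclass0 uclassM.
move=> /ule_class hx /ule_class hy; apply/ule_class.
by apply: filterS (filterI hx hy) => k [a b]; apply: mulr_ge0.
Qed.

Fact ule0_anti x : ule 0 x -> ule x 0 -> x = 0.
Proof.
rewrite -[x]ureprK uclass0 => /ule_class hx /ule_class hy; apply/uclass_eq.
by apply: filterS (filterI hx hy) => k [a b]; apply/eqP; rewrite eq_le b.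
Qed.

Fact usub_ge0 x y : ule 0 (y - x) = ule x y.
Proof.
rewrite -[x]ureprK -[y]ureprK uclass0 uclassN uclassD.
apply/ule_class/ule_class; apply: filterS => k.
  by move=> h; rewrite -subr_ge0.
by move=> h; rewrite -[leRHS]/(_ - _) subr_ge0.
Qed.

Fact ule0_total x : ule 0 x || ule x 0.
Proof.
rewrite -[x]ureprK uclass0; apply/orP.
have : \forall k \near ult_sets u, (0 <= urepr x k) \/ (urepr x k <= 0).
  by apply: filterE => k; apply/orP; apply: le_total.
by case/npultra_or => H; [left|right]; apply/ule_class.
Qed.

Fact unormN x : unorm (- x) = unorm x.
Proof.
have Nle : ule 0 (- x) = ule x 0 by rewrite -[RHS]usub_ge0 sub0r.
rewrite /unorm Nle opprK.
case: ifP => h; case: ifP => h' //.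
  by rewrite (ule0_anti h' h) oppr0.
by have := ule0_total x; rewrite h h'.
Qed.

Fact uge0_norm x : ule 0 x -> unorm x = x.
Proof. by rewrite /unorm => ->. Qed.

HB.instance Definition _ := Num.IntegralDomain_isLeReal.Build ultrapower
  ule0_add ule0_mul ule0_anti usub_ge0 ule0_total unormN uge0_norm
  (fun _ _ => erefl).

Lemma le_uclass f g :
  (uclass f <= uclass g) <-> \forall k \near ult_sets u, f k <= g k.
Proof. by split => /ule_class. Qed.

Fact uhorner (p : {poly ultrapower}) f :
  p.[uclass f] = uclass (fun k => (\poly_(i < size p) urepr p`_i k).[f k]).
Proof.
rewrite horner_coef.
have -> : (fun k => (\poly_(i < size p) urepr p`_i k).[f k]) =
  \sum_(i < size p) (urepr p`_i * f ^+ i).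
  apply/funext => k; rewrite horner_poly.
  apply: (big_rec2 (fun (y : K) (z : nat -> K) => y = z k)) => // i y z _ ->.
  rewrite -[RHS]/((urepr p`_i * f ^+ i) k + z k); congr (_ + _).
  rewrite -[RHS]/(urepr p`_i k * (f ^+ i) k); congr (_ * _).
  elim: (i : nat) => // n IH; rewrite !exprS IH; exact: erefl.
apply: (big_rec2 (fun (y : ultrapower) z => y = uclass z)) => [|i y z _ ->].
  exact: uclass0.
rewrite -uclassD; congr (_ + _).
rewrite -uclassM ureprK; congr (_ * _).
elim: (i : nat) => [|n IH]; first by rewrite !expr0 uclass1.
by rewrite !exprS -uclassM IH.
Qed.

Fact ultrapower_rcf : Num.real_closed_axiom ultrapower.
Proof.
move=> p a b; rewrite -[a]ureprK -[b]ureprK; set f := urepr a; set g := urepr b.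
move=> /le_uclass ab; rewrite !uhorner => /andP[pa pb].
move: pa pb; rewrite [X in _ <= X]uclass0 => /le_uclass pa.
rewrite [X in X <= _]uclass0 => /le_uclass pb.
pose P k : {poly K} := \poly_(i < size p) urepr p`_i k.
pose x k := xget 0 [set t | f k <= t <= g k /\ root (P k) t].
have H : \forall k \near ult_sets u, f k <= x k <= g k /\ root (P k) (x k).
  apply: filterS (filterI ab (filterI pa pb)) => k [h [h1 h2]].
  have [|t t1 t2] := @poly_ivt K (P k) _ _ h; first by apply/andP; split.
  by rewrite /x; case: xgetP => [t' _ //|/(_ t)] /(_ (conj t1 t2)).
exists (uclass x).
  apply/andP; split; apply/le_uclass; apply: filterS H => k [/andP[] //].
rewrite rootE uhorner; apply/eqP; rewrite [RHS]uclass0; apply/uclass_eq.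
by apply: filterS H => k [_ /eqP].
Qed.

HB.instance Definition _ := Num.RealField_isClosed.Build ultrapower ultrapower_rcf.

End Ultrapower.

(* A convex subring of an ordered field together with its maximal ideal (the
   non-units).  The quotient of the former by the latter is again real closed;
   it is used twice below, for O_mu / J_mu and for O / J. *)
Record convex_subring (K : rcfType) := ConvexSubring {
  cs_ring : pred K;
  cs_ideal : pred K;
  cs1 : cs_ring 1;
  csB : forall x y, cs_ring x -> cs_ring y -> cs_ring (x - y);
  csM : forall x y, cs_ring x -> cs_ring y -> cs_ring (x * y);
  cs_convex : forall x y, `|x| <= `|y| -> cs_ring y -> cs_ring x;
  cs_idealE : forall x, cs_ideal x = (x == 0) || ~~ cs_ring x^-1 }.

Section ResidueField.
Variables (K : rcfType) (V : convex_subring K).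
Local Notation O := (cs_ring V).
Local Notation J := (cs_ideal V).
Implicit Types x y : K.

Let O0 : O 0.
Proof. by apply: (cs_convex (y := 1)); rewrite ?cs1 // normr0. Qed.
Let ON x : O x -> O (- x).
Proof. by apply: cs_convex; rewrite normrN. Qed.
Let OD x y : O x -> O y -> O (x + y).
Proof. by move=> hx hy; rewrite -[y]opprK; apply: csB => //; apply: ON. Qed.
Let OVN x : O x^-1 -> O (- x)^-1.
Proof. by rewrite invrN; apply: ON. Qed.

Let J0 : J 0. Proof. by rewrite cs_idealE eqxx. Qed.
Let J1 : ~~ J 1.
Proof. by rewrite cs_idealE oner_eq0 invr1 cs1. Qed.

Let J_convex x y : `|x| <= `|y| -> J y -> J x.
Proof.
rewrite !cs_idealE => xy.
have [//|x0 /=] := eqVneq x 0.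
have [y0|y0 /=] := eqVneq y 0.
  by move: xy; rewrite y0 normr0 normr_le0 (negPf x0).
apply: contra; apply: cs_convex; rewrite !normfV lef_pV2 // posrE normr_gt0 //.
Qed.

Let JO x : J x -> O x.
Proof.
have [h|h] := leP `|x| 1.
  by move=> _; apply: cs_convex (cs1 V); rewrite normr1.
rewrite cs_idealE => /orP[/eqP->|]; first exact: O0.
move=> /negP[]; apply: cs_convex (cs1 V).
by rewrite normfV normr1 invf_le1 ?ltW // (lt_trans _ h).
Qed.

Let JN x : J x -> J (- x).
Proof. by apply: J_convex; rewrite normrN. Qed.

Let J_double x : J x -> J (x *+ 2).
Proof.
rewrite !cs_idealE mulrn_eq0 /=; have [//|x0 /=] := eqVneq x 0.
apply: contra => h.
have -> : x^-1 = (x *+ 2)^-1 + (x *+ 2)^-1 by field; rewrite x0.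
exact: OD.
Qed.

Let JD x y : J x -> J y -> J (x + y).
Proof.
wlog xy : x y / `|x| <= `|y|.
  move=> W hx hy; case: (leP `|x| `|y|) => [|/ltW] h; first exact: W.
  by rewrite addrC; apply: W.
move=> _ /J_double; apply: J_convex.
by rewrite (le_trans (ler_normD _ _)) // normrMn mulr2n lerD2r.
Qed.

Let JM x y : O x -> J y -> J (x * y).
Proof.
rewrite !cs_idealE mulf_eq0 => Ox.
have [//|x0 /=] := eqVneq x 0.
have [//|y0 /=] := eqVneq y 0.
apply: contra => h.
have -> : y^-1 = x * (x * y)^-1 by field; rewrite x0 y0.
exact: csM.
Qed.

Fact cs_subring : GRing.subring_closed O.
Proof. by split; [exact: cs1|move=> x y; exact: csB|move=> x y; exact: csM]. Qed.

Record cs_type := CsType { cs_val : K; _ : O cs_val }.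
HB.instance Definition _ := [isSub for cs_val].
HB.instance Definition _ := [Choice of cs_type by <:].
HB.instance Definition _ :=
  GRing.SubChoice_isSubComNzRing.Build K O cs_type cs_subring.

Definition cs_max : pred cs_type := fun z => J (cs_val z).

Fact cs_max_ideal : idealr_closed cs_max.
Proof.
split; [exact: J0|exact: J1|].
move=> a x y hx hy; rewrite /cs_max.
change (is_true (J (cs_val a * cs_val x + cs_val y))).
by apply: JD => //; apply: JM => //; exact: (valP a).
Qed.

HB.instance Definition _ := isIdealr.Build cs_type cs_max cs_max_ideal.

Definition cs_maxideal : idealr cs_type := cs_max.

Definition residue := {ideal_quot cs_maxideal}.
HB.instance Definition _ := GRing.ComNzRing.on residue.

Definition rclass (x : cs_type) : residue := \pi_{ideal_quot cs_maxideal} x.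
Definition rrepr (q : residue) : cs_type := repr q.

Lemma rreprK q : rclass (rrepr q) = q. Proof. exact: reprK. Qed.

Lemma rclass_eq (x y : cs_type) : rclass x = rclass y <-> J (cs_val x - cs_val y).
Proof.
rewrite /rclass; split.
- by move/eqP; rewrite -Quotient.idealrBE.
- by move=> H; apply/eqP; rewrite -Quotient.idealrBE.
Qed.

Fact rclass_zmod : zmod_morphism rclass.
Proof. by move=> x y; rewrite /rclass piE. Qed.
Fact rclass_monoid : monoid_morphism rclass.
Proof. by split=> [|x y]; rewrite /rclass piE. Qed.

HB.instance Definition _ := GRing.isZmodMorphism.Build cs_type residue rclass rclass_zmod.
HB.instance Definition _ := GRing.isMonoidMorphism.Build cs_type residue rclass rclass_monoid.

Definition rinv (q : residue) : residue :=
  if q == 0 then 0 else rclass (insubd 0 (cs_val (rrepr q))^-1).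

Fact rmulVf : forall q : residue, q != 0 -> rinv q * q = 1.
Proof.
move=> q q0; rewrite /rinv (negPf q0) -{2}[q]rreprK -rmorphM.
have nJ : ~~ J (cs_val (rrepr q)).
  apply: contra q0 => h; apply/eqP; rewrite -[q]rreprK -(rmorph0 rclass).
  by apply/rclass_eq; rewrite subr0.
move: nJ; rewrite cs_idealE negb_or negbK => /andP[x0 Ox].
rewrite -(rmorph1 rclass); congr rclass; apply: val_inj.
by rewrite /= -[cs_val]/val insubdK // mulVf.
Qed.

Fact rinv0 : rinv 0 = 0. Proof. by rewrite /rinv eqxx. Qed.

HB.instance Definition _ := GRing.ComNzRing_isField.Build residue rmulVf rinv0.

Definition rle (p q : residue) :=
  `[< exists2 j, J j & cs_val (rrepr p) <= cs_val (rrepr q) + j >].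
Definition rnorm (q : residue) := if rle 0 q then q else - q.

Lemma rrepr_class (x : cs_type) : J (cs_val (rrepr (rclass x)) - cs_val x).
Proof. by apply/rclass_eq; rewrite rreprK. Qed.

Lemma rle_class (x y : cs_type) :
  reflect (exists2 j, J j & cs_val x <= cs_val y + j) (rle (rclass x) (rclass y)).
Proof.
have hx := rrepr_class x; have hy := rrepr_class y.
apply: (iffP (asboolP _)) => -[j Jj]; move: hx hy;
  set x' := cs_val (rrepr _); set y' := cs_val (rrepr _) => hx hy h.
- exists (j + (y' - cs_val y) - (x' - cs_val x)); last by lra.
  by apply: JD; [exact: JD|exact: JN].
- exists (j + (x' - cs_val x) - (y' - cs_val y)); last by lra.
  by apply: JD; [exact: JD|exact: JN].
Qed.

Let rle0_class (x : cs_type) :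
  reflect (exists2 j, J j & 0 <= cs_val x + j) (rle 0 (rclass x)).
Proof. by have := rle_class 0 x; rewrite rmorph0. Qed.

Fact rle0_add p q : rle 0 p -> rle 0 q -> rle 0 (p + q).
Proof.
rewrite -[p]rreprK -[q]rreprK -rmorphD.
move=> /rle0_class[j Jj hj] /rle0_class[k Jk hk]; apply/rle0_class.
by exists (j + k); [exact: JD|rewrite /=; lra].
Qed.

Fact rle0_mul p q : rle 0 p -> rle 0 q -> rle 0 (p * q).
Proof.
rewrite -[p]rreprK -[q]rreprK -rmorphM.
set x := rrepr p; set y := rrepr q.
move=> /rle0_class[j Jj hj] /rle0_class[k Jk hk]; apply/rle0_class.
exists (cs_val y * j + cs_val x * k + j * k).
  apply: JD; last by apply: JM => //; exact: JO.
  by apply: JD; apply: JM => //; apply: valP.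
by move: (mulr_ge0 hj hk) => /=; congr (_ <= _); ring.
Qed.

Fact rle0_anti p : rle 0 p -> rle p 0 -> p = 0.
Proof.
rewrite -[p]rreprK -(rmorph0 rclass); set x := rrepr p.
move=> /rle_class[j Jj hj] /rle_class[k Jk hk]; apply/rclass_eq.
move: hj hk; rewrite /= => hj hk.
have : J (`|j| + `|k|).
  by apply: JD; [move: Jj|move: Jk]; apply: J_convex; rewrite normr_id.
apply: J_convex; rewrite subr0 (ger0_norm (addr_ge0 _ _)) //.
rewrite ler_norml; have := ler_norm j; have := ler_norm k.
by have := normr_ge0 j; have := normr_ge0 k; lra.
Qed.

Fact rsub_ge0 p q : rle 0 (q - p) = rle p q.
Proof.
rewrite -[p]rreprK -[q]rreprK -rmorphB.
by apply/rle0_class/rle_class => -[j Jj h]; exists j => //; move: h => /=; lra.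
Qed.

Fact rle0_total p : rle 0 p || rle p 0.
Proof.
rewrite -[p]rreprK -(rmorph0 rclass); apply/orP.
case: (leP 0 (cs_val (rrepr p))) => [|/ltW] h; [left|right]; apply/rle_class;
  by exists 0 => //=; rewrite addr0.
Qed.

Fact rnormN p : rnorm (- p) = rnorm p.
Proof.
have Nle : rle 0 (- p) = rle p 0 by rewrite -[RHS]rsub_ge0 sub0r.
rewrite /rnorm Nle opprK.
case: ifP => h; case: ifP => h' //.
  by rewrite (rle0_anti h' h) oppr0.
by have := rle0_total p; rewrite h h'.
Qed.

Fact rge0_norm p : rle 0 p -> rnorm p = p.
Proof. by rewrite /rnorm => ->. Qed.

HB.instance Definition _ := Num.IntegralDomain_isLeReal.Build residue
  rle0_add rle0_mul rle0_anti rsub_ge0 rle0_total rnormN rge0_norm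
  (fun _ _ => erefl).

Lemma le_rclass (x y : cs_type) : cs_val x <= cs_val y -> rclass x <= rclass y.
Proof. by move=> h; apply/rle_class; exists 0 => //; rewrite addr0. Qed.

Lemma lt_rclass (x y : cs_type) : rclass x < rclass y -> cs_val x < cs_val y.
Proof. by apply: contraTT; rewrite -!leNgt; exact: le_rclass. Qed.

Let lt_rclass0 (x : cs_type) : rclass x < 0 -> cs_val x < 0.
Proof. by have := @lt_rclass x 0; rewrite rmorph0. Qed.

Let gt_rclass0 (x : cs_type) : 0 < rclass x -> 0 < cs_val x.
Proof. by have := @lt_rclass 0 x; rewrite rmorph0. Qed.

Fact residue_rcf : Num.real_closed_axiom residue.
Proof.
move=> p a b ab /andP[pa pb].
have [pa0|pa0] := eqVneq p.[a] 0; first by exists a; rewrite ?lexx ?rootE ?pa0.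
have [pb0|pb0] := eqVneq p.[b] 0; first by exists b; rewrite ?lexx ?andbT ?rootE ?pb0.
have {pa0}pa : p.[a] < 0 by rewrite lt_def eq_sym pa0.
have {pb0}pb : 0 < p.[b] by rewrite lt_def pb0.
have {}ab : a < b.
  by rewrite lt_neqAle ab andbT; apply/eqP => E; move: pa pb; rewrite E => /lt_trans h /h; rewrite ltxx.
pose P : {poly cs_type} := \poly_(i < size p) rrepr p`_i.
have Pp : map_poly rclass P = p.
  apply/polyP => i; rewrite coef_map coef_poly.
  case: ltnP => [_|h]; first exact: rreprK.
  by rewrite nth_default // -[LHS]/(rclass 0) rmorph0.
have ev (x : cs_type) : p.[rclass x] = rclass P.[x] by rewrite -Pp horner_map.
have evK (x : cs_type) : (map_poly cs_val P).[cs_val x] = cs_val P.[x].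
  by rewrite -[cs_val]/val horner_map.
move: ab pa pb; rewrite -[a]rreprK -[b]rreprK !ev.
move=> /lt_rclass/ltW ab /lt_rclass0/ltW pa /gt_rclass0/ltW pb.
have [|t /andP[t1 t2] rt] := @poly_ivt K (map_poly cs_val P) _ _ ab.
  by rewrite !evK; apply/andP; split.
have Ot : O t.
  have [t0|t0] := leP 0 t.
    apply: cs_convex (valP (rrepr b)); rewrite ger0_norm //.
    by apply: le_trans t2 _; exact: ler_norm.
  apply: cs_convex (valP (rrepr a)); rewrite ltr0_norm //.
  by rewrite -normrN (le_trans _ (ler_norm _)) // lerN2.
exists (rclass (CsType Ot)).
  by apply/andP; split; apply: le_rclass.
rewrite rootE ev; apply/eqP; rewrite -[RHS](rmorph0 rclass); congr rclass; apply: val_inj.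
by rewrite -[val]/cs_val -evK /=; exact/eqP.
Qed.

HB.instance Definition _ := Num.RealField_isClosed.Build residue residue_rcf.

(* Total version of the projection from the subring to the residue field; it is
   only meaningful on elements of the subring (elsewhere its value is 0). *)
Definition reduce (x : K) : residue := rclass (insubd 0 x).

End ResidueField.

Definition infinite_elt (K : rcfType) (mu : K) := forall n : nat, n%:R < mu.

Section Robinson.
Variables (K : rcfType) (mu : K) (hmu : infinite_elt mu).
Implicit Types x y : K.

Definition mu_bounded : pred K := fun x => `[< exists k : int, `|x| < mu ^ k >].
Definition mu_negligible : pred K := fun x => `[< forall k : int, `|x| < mu ^ k >].

Let mu_gt0 : 0 < mu := hmu 0.
Let mu_gt1 : 1 < mu := hmu 1.

Let expmu_gt0 k : 0 < mu ^ k. Proof. exact: exprz_gt0. Qed.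
Let expmu_le (k l : int) : k <= l -> mu ^ k <= mu ^ l.
Proof. by move=> h; apply: ler_weXz2l => //; apply: ltW. Qed.
Let expmuS (k : int) : mu ^ (k + 1) = mu ^ k * mu.
Proof. by rewrite expfzDr ?expr1z // gt_eqF. Qed.

Fact mu_bounded1 : mu_bounded 1.
Proof. by apply/asboolP; exists 1; rewrite normr1 expr1z. Qed.

Fact mu_boundedB x y : mu_bounded x -> mu_bounded y -> mu_bounded (x - y).
Proof.
move=> /asboolP[k hk] /asboolP[l hl]; apply/asboolP.
exists (Num.max k l + 1); rewrite expmuS.
have h1 : `|x| < mu ^ Num.max k l by apply: lt_le_trans hk (expmu_le _); rewrite le_max lexx.
have h2 : `|y| < mu ^ Num.max k l by apply: lt_le_trans hl (expmu_le _); rewrite le_max lexx orbT.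
apply: le_lt_trans (ler_normB _ _) _; apply: lt_trans (ltrD h1 h2) _.
by rewrite -[X in X + X]mulr1 -mulrDr ltr_pM2l //; exact: (hmu 2).
Qed.

Fact mu_boundedM x y : mu_bounded x -> mu_bounded y -> mu_bounded (x * y).
Proof.
move=> /asboolP[k hk] /asboolP[l hl]; apply/asboolP; exists (k + l).
by rewrite normrM expfzDr ?gt_eqF // ltr_pM.
Qed.

Fact mu_bounded_convex x y : `|x| <= `|y| -> mu_bounded y -> mu_bounded x.
Proof. by move=> h /asboolP[k hk]; apply/asboolP; exists k; apply: le_lt_trans hk. Qed.

Fact mu_negligibleE x : mu_negligible x = (x == 0) || ~~ mu_bounded x^-1.
Proof.
have [->|x0] := eqVneq x 0.
  by apply/asboolP => k; rewrite normr0.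
have nx0 : 0 < `|x| by rewrite normr_gt0.
apply/asboolP/asboolPn => /= [H [k]|H k].
  apply/negP; rewrite -leNgt normfV.
  have := H (- k); rewrite -invr_expz => /ltW.
  by move=> h; rewrite -[leLHS]invrK lef_pV2 // posrE ?invr_gt0.
rewrite ltNge; apply/negP => h; apply: H; exists (- k + 1).
rewrite expmuS normfV -invr_expz; apply: (@le_lt_trans _ _ (mu ^ k)^-1).
  by rewrite lef_pV2 // posrE.
by rewrite ltr_pMr // invr_gt0.
Qed.

Definition robinson_ring : convex_subring K :=
  ConvexSubring mu_bounded1 mu_boundedB mu_boundedM mu_bounded_convex mu_negligibleE.

Fact robinson_mu_bounded : mu_bounded mu.
Proof.
apply/asboolP; exists 2; rewrite (ger0_norm (ltW mu_gt0)) -exprnP expr2.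
by rewrite ltr_pMr.
Qed.

Definition robinson : rcfType := residue robinson_ring.
Definition robinson_mu : robinson := reduce robinson_ring mu.

Let reduce_class (x : K) (hx : mu_bounded x) :
  reduce robinson_ring x = rclass (CsType (V := robinson_ring) hx).
Proof. by rewrite /reduce; congr rclass; apply: val_inj; rewrite insubdK. Qed.

Fact robinson_mu_infinite : infinite_elt robinson_mu.
Proof.
move=> n; rewrite /robinson_mu (reduce_class robinson_mu_bounded).
rewrite -(rmorph_nat (@rclass _ robinson_ring)).
rewrite ltNge; apply/negP => /rle_class[j Jj].
rewrite -[cs_val n%:R]/(val n%:R) rmorph_nat /=.
move/asboolP: Jj => /(_ 0); rewrite expr0z => /ltr_normlP[_ h1] h2.
have := hmu n.+1; rewrite -[n.+1%:R]natr1; lra.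
Qed.

Fact robinson_mu_cofinal (h : robinson) : exists k : nat, `|h| < robinson_mu ^+ k.
Proof.
rewrite -[h]rreprK; set x := rrepr h.
have /asboolP[k hk] : mu_bounded (cs_val x) := valP x.
exists `|k|.+1; rewrite /robinson_mu (reduce_class robinson_mu_bounded) -rmorphXn.
set M := CsType _.
have hM : `|cs_val x| * mu < mu ^+ `|k|.+1.
  rewrite exprSr ltr_pM2r //; apply: lt_le_trans hk _.
  by rewrite exprnP; apply: expmu_le; lia.
have hV : cs_val (M ^+ `|k|.+1) = mu ^+ `|k|.+1.
  by rewrite -[cs_val _]/(val _) rmorphXn.
have key (y : cs_type robinson_ring) : `|cs_val y| * mu < mu ^+ `|k|.+1 ->
   rclass y < rclass (M ^+ `|k|.+1).
  move=> hy; rewrite ltNge; apply/negP => /rle_class[j Jj].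
  rewrite hV; move/asboolP: Jj => /(_ 0); rewrite expr0z => /ltr_normlP[_ h1] h2.
  have h3 := ler_norm (cs_val y).
  have h4 : 1 <= mu ^+ `|k| by rewrite exprn_ege1 // ltW.
  have h5 : mu * 1 <= mu * mu ^+ `|k| by rewrite ler_pM2l.
  have h6 := hmu 2.
  have h7 : `|cs_val y| * 2 <= `|cs_val y| * mu by rewrite ler_wpM2l // ltW.
  move: hy h2; rewrite exprS; lra.
rewrite ltr_norml ltrNl -rmorphN; apply/andP; split; apply: key => //.
by rewrite -[cs_val _]/(val _) rmorphN normrN.
Qed.

End Robinson.

Section Logarithm.
Variables (R : realType) (K : rcfType) (mu : K).

(* Only meaningful for h > 0. *)
Definition log_cut (h : K) : set R :=
  [set q | exists (m : int) (n : nat),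
     [/\ (0 < n)%N, mu ^ m <= h ^+ n & q = m%:~R / n%:R]].

Definition logmu (h : K) : R := sup (log_cut h).

Definition log_bounded : pred K := fun h => (h == 0) || (logmu `|h| <= 0).
Definition log_negligible : pred K := fun h => (h == 0) || (logmu `|h| < 0).

Hypothesis mu_inf : infinite_elt mu.
Hypothesis mu_cof : forall h : K, exists k : nat, `|h| < mu ^+ k.
Implicit Types h x y : K.

Let mu_gt0 : 0 < mu := mu_inf 0.
Let mu_gt1 : 1 < mu := mu_inf 1.

Let expmu_le (k l : int) : (mu ^ k <= mu ^ l) = (k <= l).
Proof. by rewrite ler_eXz2l. Qed.

Let cut_ub h k m n : 0 < h -> h < mu ^+ k -> (0 < n)%N -> mu ^ m <= h ^+ n ->
  m <= (k * n)%:Z.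
Proof.
move=> h0 hk n0 hm; rewrite -expmu_le; apply: le_trans hm _.
by rewrite -exprnP exprM lerXn2r // ?nnegrE ?ltW // exprn_gt0.
Qed.

Let cut_sup h : 0 < h -> has_sup (log_cut h).
Proof.
move=> h0; split.
  have [k] := mu_cof h^-1.
  rewrite gtr0_norm ?invr_gt0 // => hk.
  exists ((- k%:Z)%:~R / 1%:R), (- k%:Z), 1%N; split=> //.
  rewrite expr1 -invr_expz -exprnP.
  by rewrite -[leRHS]invrK lef_pV2 ?posrE ?invr_gt0 ?exprn_gt0 // ltW.
have [k] := mu_cof h; rewrite gtr0_norm // => hk.
exists k%:R => _ [m [n [n0 hm ->]]].
rewrite ler_pdivrMr ?ltr0n // -natrM -[(k * n)%:R]/((k * n)%:Z%:~R).
by rewrite ler_int; apply: cut_ub hk n0 hm.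
Qed.

Let in_cut h m n : 0 < h -> (0 < n)%N -> mu ^ m <= h ^+ n ->
  m%:~R / n%:R <= logmu h.
Proof.
move=> h0 n0 hm; apply: sup_upper_bound; first exact: cut_sup.
by exists m, n.
Qed.

Let log_le0 h : 0 < h ->
  logmu h <= 0 <-> forall n, (0 < n)%N -> h ^+ n < mu.
Proof.
move=> h0; split=> [hl n n0|H].
  rewrite ltNge; apply/negP => hm.
  have := in_cut h0 n0 (m := 1); rewrite expr1z => /(_ hm) => h1.
  have : 0 < 1%:~R / n%:R :> R by rewrite divr_gt0 // ltr0n.
  by move=> h2; move: (lt_le_trans h2 (le_trans h1 hl)); rewrite ltxx.
apply: ge_sup; first by have [] := cut_sup h0.
move=> _ [m [n [n0 hm ->]]].
rewrite ler_pdivrMr ?ltr0n // mul0r lerz0 leNgt; apply/negP => m0.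
have := le_lt_trans hm (H n n0).
by rewrite -[X in _ < X]expr1z ltNge expmu_le -gtz0_ge1 m0.
Qed.

Let log_lt0 h : 0 < h ->
  logmu h < 0 <-> exists2 n, (0 < n)%N & h ^+ n < mu^-1.
Proof.
move=> h0; split=> [hl|[n n0 hn]].
  pose n := (Num.truncn (- (logmu h))^-1).+1.
  exists n => //; rewrite ltNge; apply/negP => hm.
  have := in_cut h0 (n := n) isT (m := -1); rewrite exprN1 => /(_ hm) => h1.
  have l0 : 0 < - logmu h by rewrite oppr_gt0.
  have h2 : (- logmu h)^-1 < n%:R by exact: truncnS_gt.
  have n0 : 0 < n%:R :> R by rewrite ltr0n.
  have : (n%:R)^-1 < - logmu h.
    by rewrite -[ltRHS]invrK ltf_pV2 // posrE ?invr_gt0.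
  move: h1; rewrite mulrN1z mulNr mul1r; lra.
apply: (@le_lt_trans _ _ (- (n%:R)^-1)); last first.
  by rewrite oppr_lt0 invr_gt0 ltr0n.
apply: ge_sup; first by have [] := cut_sup h0.
move=> _ [m [p [p0 hm ->]]].
rewrite ler_pdivrMr ?ltr0n // mulNr lerNr ler_pdivrMl ?ltr0n //.
rewrite -mulrN1z -mulrzA -[n%:R]/((n%:Z)%:~R) -[p%:R]/((p%:Z)%:~R) -intrM ler_int.
suff : (m * n%:Z < - p%:Z)%R by lia.
have lt1 : mu ^ (m * n%:Z) < mu ^ (- p%:Z).
  rewrite -exprz_exp -exprnP; apply: (@le_lt_trans _ _ ((h ^+ p) ^+ n)).
    by rewrite lerXn2r // nnegrE ltW // ?exprz_gt0 ?exprn_gt0.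
  rewrite -exprM mulnC exprM -invr_expz -exprnP -exprVn.
  by rewrite ltr_pXn2r // nnegrE ltW ?invr_gt0 ?exprn_gt0.
by rewrite ltNge -expmu_le -ltNge.
Qed.

Let log_boundedP h :
  reflect (forall n, (0 < n)%N -> `|h| ^+ n < mu) (log_bounded h).
Proof.
rewrite /log_bounded; have [->|h0] := eqVneq h 0.
  by left=> -[//|n] _; rewrite normr0 expr0n.
have nh : 0 < `|h| by rewrite normr_gt0.
by apply: (iffP idP) => /log_le0; apply.
Qed.

Let log_negligibleP h :
  reflect (exists2 n, (0 < n)%N & `|h| ^+ n < mu^-1) (log_negligible h).
Proof.
rewrite /log_negligible; have [->|h0] := eqVneq h 0.
  by left; exists 1%N => //; rewrite normr0 expr0n invr_gt0.
have nh : 0 < `|h| by rewrite normr_gt0.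
by apply: (iffP idP) => /log_lt0; apply.
Qed.

Fact log_bounded1 : log_bounded 1.
Proof. by apply/log_boundedP => n _; rewrite normr1 expr1n. Qed.

Fact log_boundedM x y : log_bounded x -> log_bounded y -> log_bounded (x * y).
Proof.
move=> /log_boundedP hx /log_boundedP hy; apply/log_boundedP => n n0.
have -> : (`|x * y| ^+ n < mu) = ((`|x * y| ^+ n) ^+ 2 < mu ^+ 2).
  by rewrite ltr_pXn2r // nnegrE ?exprn_ge0 // ltW.
rewrite normrM -exprM exprMn [mu ^+ 2]expr2.
by apply: ltr_pM; rewrite ?exprn_ge0 //; [apply: hx|apply: hy]; rewrite muln_gt0 n0.
Qed.

Fact log_bounded_convex x y : `|x| <= `|y| -> log_bounded y -> log_bounded x.
Proof.
move=> xy /log_boundedP hy; apply/log_boundedP => n n0.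
by apply: le_lt_trans (hy n n0); rewrite lerXn2r // nnegrE.
Qed.

Fact log_boundedB x y : log_bounded x -> log_bounded y -> log_bounded (x - y).
Proof.
wlog xy : x y / `|x| <= `|y|.
  move=> W hx hy; case: (leP `|x| `|y|) => [|/ltW] h; first exact: W.
  by apply: log_bounded_convex (W _ _ h hy hx); rewrite distrC.
move=> _ hy; have h2 : log_bounded 2.
  apply/log_boundedP => n _; rewrite ger0_norm // -natrX; exact: mu_inf.
apply: log_bounded_convex (log_boundedM h2 hy).
by rewrite (le_trans (ler_normB _ _)) // normrM ger0_norm // mulr_natl mulr2n lerD2r.
Qed.

Fact log_negligibleE x : log_negligible x = (x == 0) || ~~ log_bounded x^-1.
Proof.
have [->|x0] := eqVneq x 0; first by rewrite /log_negligible eqxx.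
have nx : 0 < `|x| by rewrite normr_gt0.
apply/log_negligibleP/idP => /= [[n n0 hn]|H].
  apply/negP => /log_boundedP/(_ n n0); rewrite normfV exprVn => h1.
  have := ltr_pM _ _ hn h1; rewrite ?exprn_ge0 ?invr_ge0 ?exprn_ge0 //.
  by rewrite mulfV ?mulVf ?ltxx ?gt_eqF // ?exprn_gt0 // => /(_ isT isT).
move: H; apply: contraNP => H; apply/log_boundedP => n n0.
rewrite ltNge; apply/negP; rewrite normfV exprVn => h1.
apply: H; exists (n * 2)%N; first by rewrite muln_gt0 n0.
have h2 : `|x| ^+ n <= mu^-1.
  by rewrite -[leLHS]invrK lef_pV2 // posrE invr_gt0 exprn_gt0.
rewrite exprM; apply: (@le_lt_trans _ _ (mu^-1 ^+ 2)).
  by rewrite lerXn2r // nnegrE ?exprn_ge0 // invr_ge0 ltW.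
by rewrite expr2 gtr_pMr ?invr_gt0 // invf_lt1.
Qed.

Definition log_ring : convex_subring K :=
  ConvexSubring log_bounded1 log_boundedB log_boundedM log_bounded_convex log_negligibleE.

End Logarithm.

Section ProjectiveLinearGroup.
Variable K : fieldType.

Record SL2 := MkSL2 { sl2_mx :> 'M[K]_2; _ : \det sl2_mx == 1 }.
HB.instance Definition _ := [isSub for sl2_mx].
HB.instance Definition _ := [Choice of SL2 by <:].
Implicit Types A B C : SL2.

Lemma sl2_det A : \det A = 1. Proof. by case: A => M /= /eqP. Qed.
Lemma sl2_unit A : sl2_mx A \in unitmx.
Proof. by rewrite unitmxE sl2_det unitr1. Qed.

Fact sl2_one_subproof : \det (1%:M : 'M[K]_2) == 1. Proof. by rewrite det1. Qed.
Definition sl2_one := MkSL2 sl2_one_subproof.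
Fact sl2_mul_subproof A B : \det (sl2_mx A *m sl2_mx B) == 1.
Proof. by rewrite det_mulmx !sl2_det mulr1. Qed.
Definition sl2_mul A B := MkSL2 (sl2_mul_subproof A B).
Fact sl2_inv_subproof A : \det (invmx (sl2_mx A)) == 1.
Proof. by rewrite det_inv sl2_det invr1. Qed.
Definition sl2_inv A := MkSL2 (sl2_inv_subproof A).

Fact sl2_mulA : associative sl2_mul.
Proof. by move=> A B C; apply: val_inj; rewrite /= mulmxA. Qed.
Fact sl2_mul1 : left_id sl2_one sl2_mul.
Proof. by move=> A; apply: val_inj; rewrite /= mul1mx. Qed.
Fact sl2_mulr1 : right_id sl2_one sl2_mul.
Proof. by move=> A; apply: val_inj; rewrite /= mulmx1. Qed.
Fact sl2_mulV : left_inverse sl2_one sl2_inv sl2_mul.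
Proof. by move=> A; apply: val_inj; rewrite /= mulVmx // sl2_unit. Qed.
Fact sl2_mulrV : right_inverse sl2_one sl2_inv sl2_mul.
Proof. by move=> A; apply: val_inj; rewrite /= mulmxV // sl2_unit. Qed.

HB.instance Definition _ :=
  isGroup.Build SL2 sl2_mulA sl2_mul1 sl2_mulr1 sl2_mulV sl2_mulrV.

Definition psl_eq : rel SL2 :=
  fun A B => (sl2_mx A == sl2_mx B) || (sl2_mx A == - sl2_mx B).

Lemma psl_eqP A B : reflect (exists b : bool, sl2_mx A = (-1) ^+ b *: sl2_mx B) (psl_eq A B).
Proof.
apply: (iffP orP) => [[/eqP->|/eqP->]|[[] ->]].
- by exists false; rewrite scale1r.
- by exists true; rewrite expr1 scaleN1r.
- by right; rewrite expr1 scaleN1r.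
- by left; rewrite scale1r.
Qed.

Fact psl_equiv : equiv_class_of psl_eq.
Proof.
split.
- by move=> A; apply/psl_eqP; exists false; rewrite scale1r.
- move=> A B; apply/psl_eqP/psl_eqP => -[b E]; exists b;
  by rewrite E scalerA -expr2 sqrr_sign scale1r.
- move=> B A C /psl_eqP[b E] /psl_eqP[c F]; apply/psl_eqP.
  by exists (b (+) c); rewrite E F scalerA signr_addb.
Qed.

Canonical psl_equiv_rel := EquivRelPack psl_equiv.

Definition PSL2 := {eq_quot psl_equiv_rel}.
HB.instance Definition _ := Choice.on PSL2.

Definition pslclass A : PSL2 := \pi_{eq_quot psl_equiv_rel} A.
Definition pslrepr (q : PSL2) : SL2 := repr q.

Lemma pslreprK q : pslclass (pslrepr q) = q. Proof. exact: reprK. Qed.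

Lemma pslclass_eq A B : pslclass A = pslclass B <-> psl_eq A B.
Proof. by split=> [/eqP|H]; [|apply/eqP]; rewrite eqmodE. Qed.

Definition psl_mul (p q : PSL2) := pslclass (pslrepr p * pslrepr q)%g.
Definition psl_inv (p : PSL2) := pslclass (pslrepr p)^-1%g.

Let repr_sign A : exists b : bool, sl2_mx (pslrepr (pslclass A)) = (-1) ^+ b *: sl2_mx A.
Proof. by apply/psl_eqP/pslclass_eq; rewrite pslreprK. Qed.

Lemma psl_mulE A B : psl_mul (pslclass A) (pslclass B) = pslclass (A * B)%g.
Proof.
apply/pslclass_eq/psl_eqP.
have [b hb] := repr_sign A; have [c hc] := repr_sign B.
exists (b (+) c); rewrite /= hb hc -scalemxAl -scalemxAr scalerA.
by rewrite signr_addb.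
Qed.

Lemma psl_invE A : psl_inv (pslclass A) = pslclass A^-1%g.
Proof.
apply/pslclass_eq/psl_eqP; have [b hb] := repr_sign A; exists b.
rewrite /= hb invmxZ ?invr_sign // unitmxZ ?sl2_unit //.
by rewrite unitrX // unitrN1.
Qed.

Fact psl_mulA : associative psl_mul.
Proof.
move=> p q r; rewrite -[p]pslreprK -[q]pslreprK -[r]pslreprK.
by rewrite !psl_mulE mulgA.
Qed.
Fact psl_mul1 : left_id (pslclass 1%g) psl_mul.
Proof. by move=> p; rewrite -[p]pslreprK psl_mulE mul1g. Qed.
Fact psl_mulr1 : right_id (pslclass 1%g) psl_mul.
Proof. by move=> p; rewrite -[p]pslreprK psl_mulE mulg1. Qed.
Fact psl_mulV : left_inverse (pslclass 1%g) psl_inv psl_mul.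
Proof. by move=> p; rewrite -[p]pslreprK psl_invE psl_mulE mulVg. Qed.
Fact psl_mulrV : right_inverse (pslclass 1%g) psl_inv psl_mul.
Proof. by move=> p; rewrite -[p]pslreprK psl_invE psl_mulE mulgV. Qed.

HB.instance Definition _ :=
  isGroup.Build PSL2 psl_mulA psl_mul1 psl_mulr1 psl_mulV psl_mulrV.

(* The two functions below do not change when the matrix is replaced by its
   opposite, hence do not depend on the representative. *)
Definition psl_Ad (p : PSL2) : 'M[K]_(2 * 2) :=
  lin_mx (fun X : 'M[K]_2 => pslrepr p *m X *m invmx (pslrepr p)).
Definition psl_normsq (p : PSL2) : K := \tr (pslrepr p *m (pslrepr p)^T).

End ProjectiveLinearGroup.

Section Disc.
Variable K : rcfType.
Implicit Types z w : K[i].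

Definition in_disc z := complex.Re z ^+ 2 + complex.Im z ^+ 2 < 1.

Record disc := Disc { disc_val :> K[i]; _ : in_disc disc_val }.
HB.instance Definition _ := [isSub for disc_val].
HB.instance Definition _ := [Choice of disc by <:].

Fact disc0_subproof : in_disc 0.
Proof. by rewrite /in_disc /= expr0n addr0 ltr01. Qed.
Definition disc0 := Disc disc0_subproof.

(* PSL_2 acts on the upper half-plane by homographies; w |-> (w - i)/(w + i)
   maps the half-plane onto the disc. *)
Definition cayley w : K[i] := (w - (0 +i* 1)) / (w + (0 +i* 1)).
Definition cayley_inv z : K[i] := (0 +i* 1) * (1 + z) / (1 - z).
Definition homography (A : 'M[K]_2) w : K[i] :=
  ((A 0 0)%:C * w + (A 0 1)%:C) / ((A 1 0)%:C * w + (A 1 1)%:C).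
Definition mobius (A : 'M[K]_2) z := cayley (homography A (cayley_inv z)).

Let nsq z := complex.Re z ^+ 2 + complex.Im z ^+ 2.

Let nsq_ge0 z : 0 <= nsq z. Proof. by rewrite addr_ge0 ?sqr_ge0. Qed.

Let nsq_eq0 z : (nsq z == 0) = (z == 0).
Proof.
by rewrite /nsq paddr_eq0 ?sqr_ge0 // !sqrf_eq0; case: z => a b; rewrite eq_complex.
Qed.

Let nsqM z w : nsq (z * w) = nsq z * nsq w.
Proof. by case: z => a b; case: w => c d; rewrite /nsq /=; ring. Qed.

Let nsqV z : nsq z^-1 = (nsq z)^-1.
Proof.
have [->|z0] := eqVneq z 0; first by rewrite invr0 /nsq /= expr0n addr0 invr0.
have n0 : nsq z != 0 by rewrite nsq_eq0.
apply: (mulfI n0); rewrite -nsqM !mulfV //.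
by rewrite /nsq /= expr1n expr0n addr0.
Qed.

Let ImV z w : complex.Im (z / w) =
  (complex.Im z * complex.Re w - complex.Re z * complex.Im w) / nsq w.
Proof.
case: z => a b; case: w => c d.
have -> : (c +i* d)^-1 = (c / (c ^+ 2 + d ^+ 2)) -i* (d / (c ^+ 2 + d ^+ 2)) by [].
by rewrite /nsq /=; ring.
Qed.

Let cayley_disc w : 0 < complex.Im w -> in_disc (cayley w).
Proof.
move=> hw; rewrite /in_disc -/(nsq _) /cayley nsqM nsqV.
have h : nsq (w - (0 +i* 1)) < nsq (w + (0 +i* 1)) by case: w hw => a b; rewrite /nsq /=; nra.
by rewrite ltr_pdivrMr ?mul1r // (le_lt_trans _ h).
Qed.

Let cayley_inv_Im z : in_disc z -> 0 < complex.Im (cayley_inv z).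
Proof.
move=> hz; rewrite /cayley_inv ImV divr_gt0 //.
  by case: z hz => a b; rewrite /in_disc /=; nra.
rewrite lt_def nsq_ge0 andbT nsq_eq0 subr_eq0 eq_sym; apply/eqP => E.
by move: hz; rewrite E /in_disc /= expr1n expr0n addr0 ltxx.
Qed.

Let det22 (A : 'M[K]_2) : \det A = A 0 0 * A 1 1 - A 0 1 * A 1 0.
Proof.
rewrite (expand_det_row _ 0) !big_ord_recl big_ord0 addr0 /cofactor.
rewrite !det_mx11 !mxE /= expr0 expr1 mul1r mulN1r mulrN.
set x := lift _ _; set y := lift _ _.
have -> : x = 1 by apply: val_inj.
have -> : y = 0 by apply: val_inj.
by [].
Qed.

Let homography_Im (A : 'M[K]_2) w : \det A = 1 -> 0 < complex.Im w ->
  0 < complex.Im (homography A w).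
Proof.
rewrite det22 => hA hw; rewrite /homography ImV divr_gt0 //.
  case: w hw => a b /= hb.
  have -> : (A 0 0 * b + 0 * a + 0) * (A 1 0 * a - 0 * b + A 1 1)
    - (A 0 0 * a - 0 * b + A 0 1) * (A 1 0 * b + 0 * a + 0)
    = (A 0 0 * A 1 1 - A 0 1 * A 1 0) * b by ring.
  by rewrite hA mul1r.
rewrite lt_def nsq_ge0 andbT nsq_eq0.
case: w hw => a b /= hb; rewrite eq_complex /=; apply/negP => /andP[/eqP h1 /eqP h2].
have c0 : A 1 0 = 0.
  have : A 1 0 * b = 0 by rewrite -h2; ring.
  by move/eqP; rewrite mulf_eq0 (gt_eqF hb) orbF => /eqP.
have d0 : A 1 1 = 0 by rewrite -h1 c0; ring.
by move: hA; rewrite c0 d0 !mulr0 subr0 => /esym/eqP; rewrite oner_eq0.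
Qed.

Lemma mobius_disc (A : SL2 K) (z : disc) : in_disc (mobius A z).
Proof.
apply: cayley_disc; apply: homography_Im; first exact: sl2_det.
by apply: cayley_inv_Im; case: z.
Qed.

Definition psl_act (p : PSL2 K) (z : disc) : disc := Disc (mobius_disc (pslrepr p) z).

Lemma psl_actE (A : SL2 K) (z : disc) : disc_val (psl_act (pslclass A) z) = mobius A z.
Proof.
have /pslclass_eq/psl_eqP[b E] := pslreprK (pslclass A).
rewrite /= /mobius /homography E !mxE.
case: b {E} => /=; last by rewrite expr0 !mul1r.
rewrite expr1 !mulN1r !rmorphN !mulNr -!opprD invrN mulrNN.
done.
Qed.

(* For K the real numbers this is cosh^2 (d(z, w) / 2), with d the hyperbolic
   distance. *)
Definition cosh2_half_dist z w : K :=
  Normc.normc (1 - conjc z * w) ^+ 2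
  / ((1 - Normc.normc z ^+ 2) * (1 - Normc.normc w ^+ 2)).

Definition cyclic_sign (z1 z2 z3 : K[i]) : int :=
  sgz (\det (\matrix_(i, j < 2)
    (let d := if i == 0 then z2 - z1 else z3 - z2 in
     if j == 0 then complex.Re d else complex.Im d))).
End Disc.

Section MetricIdentification.
Variables (R : realType) (X : Type) (d : X -> X -> R).

(* The quotient of a space by the relation "pseudo-distance 0"; its points are
   the classes {y | d x y = 0}. *)
Record mquot := MQuot {
  mq_class : set X;
  mq_classP : exists x, mq_class = [set y | d x y = 0] }.

Definition mclass (x : X) : mquot := MQuot (ex_intro _ x erefl).
Definition mrepr (q : mquot) : X := projT1 (cid (mq_classP q)).
Definition mdist (p q : mquot) : R := d (mrepr p) (mrepr q).

Lemma mreprK q : mclass (mrepr q) = q.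
Proof.
rewrite /mclass /mrepr; case: q => C hC /=; case: cid => x /= E; subst C.
by congr MQuot; exact: Prop_irrelevance.
Qed.

Hypothesis d_refl : forall x, d x x = 0.
Hypothesis d_sym : forall x y, d x y = d y x.
Hypothesis d_triangle : forall x y z, d x z <= d x y + d y z.

Lemma mclass_eq x y : mclass x = mclass y <-> d x y = 0.
Proof.
split=> [/(congr1 mq_class) /= E|dxy].
  by have : [set z | d y z = 0] y by []; rewrite -E.
rewrite /mclass; suff E : [set z | d x z = 0] = [set z | d y z = 0].
  by move: (ex_intro _ x _) (ex_intro _ y _); rewrite E => h h';
     congr MQuot; exact: Prop_irrelevance.
have d_ge0 u v : 0 <= d u v.
  by have := d_triangle u v u; rewrite d_refl (d_sym v u); lra.
apply/seteqP; split=> z /= h; apply/eqP; rewrite eq_le d_ge0 andbT.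
  by have := d_triangle y x z; rewrite (d_sym y x); lra.
by have := d_triangle x y z; lra.
Qed.

Lemma mdistE x y : mdist (mclass x) (mclass y) = d x y.
Proof.
have /mclass_eq h1 := mreprK (mclass x); have /mclass_eq h2 := mreprK (mclass y).
rewrite /mdist; move: h1 h2; move: (mrepr (mclass x)) (mrepr (mclass y)) => x' y' h1 h2.
have a1 := d_triangle x' x y'; have a2 := d_triangle x y y'.
have a3 := d_triangle x x' y; have a4 := d_triangle x' y' y.
move: a1 a2 a3 a4; rewrite (d_sym y y') (d_sym x x') h1 h2 => *.
by apply/eqP; rewrite eq_le; apply/andP; split; lra.
Qed.

End MetricIdentification.

Section Germs.
Variables (R : realType) (X : Type) (d : X -> X -> R) (P : X).

Record segment := Segment {
  seg_fun :> R -> X;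
  seg_len : R;
  seg_len_gt0 : 0 < seg_len;
  seg_start : seg_fun 0 = P;
  seg_isom : forall s t, 0 <= s <= seg_len -> 0 <= t <= seg_len ->
    d (seg_fun s) (seg_fun t) = `|s - t| }.

HB.instance Definition _ := gen_eqMixin segment.
HB.instance Definition _ := gen_choiceMixin segment.

Definition seg_end (c : segment) : X := c (seg_len c).

(* Outside [0, seg_len] the map is arbitrary; this is harmless, as [e] may
   always be decreased. *)
Definition germ_eq (c c' : segment) : bool :=
  `[< exists2 e : R, 0 < e & forall t, 0 <= t < e -> c t = c' t >].

Fact germ_eq_equiv : equiv_class_of germ_eq.
Proof.
split.
- by move=> c; apply/asboolP; exists 1.
- by move=> c c'; apply/asboolP/asboolP => -[e e0 h]; exists e => // t /h.
- move=> c2 c1 c3 /asboolP[e e0 h] /asboolP[f f0 k]; apply/asboolP.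
  exists (Num.min e f) => [|t]; first by rewrite lt_min e0.
  rewrite lt_min => /andP[t0 /andP[te tf]].
  by rewrite h ?t0 // k ?t0.
Qed.

Canonical germ_equiv := EquivRelPack germ_eq_equiv.

Definition germ := {eq_quot germ_equiv}.
HB.instance Definition _ := Choice.on germ.

Definition germ_of (c : segment) : germ := \pi_{eq_quot germ_equiv} c.
Definition germ_repr (g : germ) : segment := repr g.

Lemma germ_reprK g : germ_of (germ_repr g) = g. Proof. exact: reprK. Qed.

Lemma germ_of_eq c c' : germ_of c = germ_of c' <->
  exists2 e : R, 0 < e & forall t, 0 <= t < e -> c t = c' t.
Proof.
split=> [/eqP|H]; first by rewrite eqmodE => /asboolP.
by apply/eqP; rewrite eqmodE; apply/asboolP.
Qed.

End Germs.

Definition distance_preserving (R : realType) (X Y : Type)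
    (dX : X -> X -> R) (dY : Y -> Y -> R) (f : X -> Y) :=
  forall x y, dY (f x) (f y) = dX x y.

Section InducedMap.
Variables (R : realType) (X Y : Type) (dX : X -> X -> R) (dY : Y -> Y -> R).
Variables (f : X -> Y) (hf : distance_preserving dX dY f) (P : X).

Fact seg_map_start (c : segment dX P) : f (c 0) = f P.
Proof. by rewrite seg_start. Qed.
Fact seg_map_isom (c : segment dX P) s t :
  0 <= s <= seg_len c -> 0 <= t <= seg_len c -> dY (f (c s)) (f (c t)) = `|s - t|.
Proof. by move=> hs ht; rewrite hf seg_isom. Qed.

Definition seg_map (c : segment dX P) : segment dY (f P) :=
  Segment (seg_len_gt0 c) (seg_map_start c) (@seg_map_isom c).

Definition germ_map (g : germ dX P) : germ dY (f P) := germ_of (seg_map (germ_repr g)).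

Lemma germ_mapE c : germ_map (germ_of c) = germ_of (seg_map c).
Proof.
apply/germ_of_eq; have /germ_of_eq[e e0 h] := germ_reprK (germ_of c).
by exists e => // t te; rewrite /= h.
Qed.
End InducedMap.

Definition germ_orientation (R : realType) (X : Type) (d : X -> X -> R) :=
  forall P : X, germ d P -> germ d P -> germ d P -> int.

Definition orientation_preserving (R : realType) (X Y : Type)
    (dX : X -> X -> R) (dY : Y -> Y -> R) (f : X -> Y)
    (hf : distance_preserving dX dY f)
    (oX : germ_orientation dX) (oY : germ_orientation dY) :=
  forall (P : X) (g1 g2 g3 : germ dX P),
    oY (f P) (germ_map hf g1) (germ_map hf g2) (germ_map hf g3) = oX P g1 g2 g3.

Section HyperbolicPlane.
Variable R : realType.
Implicit Types z w P x y : disc R.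

Definition arcosh (t : R) : R := ln (t + Num.sqrt (t ^+ 2 - 1)).

(* The distance of curvature -1 on the Poincare disc. *)
Definition hdist z w : R :=
  arcosh (1 + 2 * Normc.normc (disc_val z - disc_val w) ^+ 2
    / ((1 - Normc.normc z ^+ 2) * (1 - Normc.normc w ^+ 2))).

Lemma hdistxx z : hdist z z = 0.
Proof.
rewrite /hdist subrr Normc.normc0 expr0n mulr0 mul0r addr0 /arcosh.
by rewrite expr1n subrr sqrtr0 addr0 ln1.
Qed.

(* xi is the point at infinity, in the unit circle, of the geodesic ray from P
   through x, i.e. the point corresponding to the germ at P of the segment from
   P to x. *)
Definition is_ray_end P x (xi : R[i]) :=
  exists c : R -> disc R,
    [/\ c 0 = P, c (hdist P x) = x,
        forall s t, 0 <= s -> 0 <= t -> hdist (c s) (c t) = `|s - t|,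
        (complex.Re (disc_val (c t)) @[t --> +oo] --> complex.Re xi) &
        (complex.Im (disc_val (c t)) @[t --> +oo] --> complex.Im xi)].

Definition ray_end P x : R[i] := xget 0 [set xi | is_ray_end P x xi].

Definition or_disc P x y z : int :=
  cyclic_sign (ray_end P x) (ray_end P y) (ray_end P z).
End HyperbolicPlane.

Section Representations.
Variables (R : realType) (Gam : groupType).

Definition generating (S : {fset Gam}) :=
  forall H : set Gam, H 1%g -> (forall x y, H x -> H y -> H (x * y)%g) ->
    (forall x, H x -> H x^-1%g) -> (forall s, s \in S -> H s) -> forall x, H x.

(* psl_Ad is written for row vectors, so it is the transpose of the matrix acting
   on columns; this only changes the sign of the sum below. *)
Definition in_MGamma (S : {fset Gam}) (phi : {multiplicative Gam -> PSL2 R}) :=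
  \sum_(s <- S) (psl_Ad (phi s) *m (psl_Ad (phi s))^T
                 - (psl_Ad (phi s))^T *m psl_Ad (phi s)) = 0.

Definition adapted (u : npultrafilter) (S : {fset Gam}) (mu : nat -> R)
    (phi : nat -> {multiplicative Gam -> PSL2 R}) :=
  exists2 c2 : R, 0 < c2 &
    \forall k \near ult_sets u, \sum_(s <- S) psl_normsq (phi k s) <= c2 * mu k.
End Representations.

Section Cone.
Variables (R : realType) (u : npultrafilter) (lam : nat -> R).

Definition cone_bounded : pred (nat -> disc R) := fun z =>
  `[< exists C : R, \forall k \near ult_sets u, `|hdist (z k) (disc0 R) / lam k| <= C >].

Record cone_seq := ConeSeq { cseq :> nat -> disc R; _ : cone_bounded cseq }.
HB.instance Definition _ := [isSub for cseq].

Fact cone_bounded0 : cone_bounded (fun=> disc0 R).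
Proof.
by apply/asboolP; exists 0; apply: filterE => k; rewrite hdistxx mul0r normr0.
Qed.
Definition cone_seq0 := ConeSeq cone_bounded0.

Definition cone_dist (z w : cone_seq) : R :=
  lim ((fun k => hdist (z k) (w k) / lam k) @ ult_sets u).

Definition cone := mquot cone_dist.
Definition cone_mdist : cone -> cone -> R := mdist (d := cone_dist).

(* The default value of [insubd] is never used when mu is adapted to phi: then
   the displaced sequence is again bounded. *)
Definition cone_act (Gam : groupType) (phi : nat -> {multiplicative Gam -> PSL2 R})
    (g : Gam) (p : cone) : cone :=
  mclass cone_dist (insubd cone_seq0 (fun k => psl_act (phi k g) (mrepr p k))).

(* Limit along u of a sequence taking finitely many values. *)
Definition ulim_int (f : nat -> int) : int :=
  xget 0 [set a | \forall k \near ult_sets u, f k = a].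

(* A germ at p is represented by the endpoint of a segment of this germ, and the
   points of the cone by sequences; the result does not depend on the choices. *)
Definition or_ultralimit : germ_orientation cone_mdist := fun p g1 g2 g3 =>
  if [|| g1 == g2, g2 == g3 | g1 == g3] then 0 else
  let pt (g : germ cone_mdist p) := mrepr (seg_end (germ_repr g)) in
  ulim_int (fun k => or_disc (mrepr p k) (pt g1 k) (pt g2 k) (pt g3 k)).
End Cone.

Section RobinsonTree.
Variables (R : realType) (u : npultrafilter) (lam : nat -> R).
Hypothesis hlam : lam @ \oo --> +oo.

Definition mu_seq (k : nat) : R := expR (lam k).
Definition mu_u : ultrapower R u := uclass u mu_seq.

Fact mu_u_infinite : infinite_elt mu_u.
Proof.
have uclass_nat n : n%:R = uclass u (fun=> n%:R : R).
  elim: n => [|n IH]; first exact: uclass0.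
  rewrite -natr1 IH uclass1 uclassD; congr (uclass u _).
  by apply/funext => k; rewrite -natr1.
move=> n; apply: (@lt_le_trans _ _ n.+1%:R); first by rewrite ltr_nat.
rewrite uclass_nat; apply/le_uclass; apply: npultra_cofinite.
move/cvgryPge: hlam => /(_ n.+1%:R); apply: filterS => k hk.
by apply: le_trans hk _; apply: le_trans (expR_ge1Dx _); rewrite lerDr.
Qed.

Definition RobF : rcfType := robinson mu_u_infinite.
Definition RobF_mu : RobF := robinson_mu mu_u_infinite.
Definition RobF_val : convex_subring RobF :=
  log_ring R (robinson_mu_infinite mu_u_infinite) (@robinson_mu_cofinal _ _ mu_u_infinite).
Definition RobF_O : rcfType := residue RobF_val.

Definition rob_class (x : nat -> R) : RobF :=
  reduce (robinson_ring mu_u_infinite) (uclass u x).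
Definition rob_class_C (z : nat -> R[i]) : RobF[i] :=
  rob_class (fun k => complex.Re (z k)) +i* rob_class (fun k => complex.Im (z k)).

Definition reduce_C (v : RobF[i]) : RobF_O[i] :=
  reduce RobF_val (complex.Re v) +i* reduce RobF_val (complex.Im v).

Definition rob_dist (z w : disc RobF) : R := logmu R RobF_mu (cosh2_half_dist z w).

Definition robtree := mquot rob_dist.
Definition robtree_mdist : robtree -> robtree -> R := mdist (d := rob_dist).

Definition robtree_act (A : PSL2 RobF) (p : robtree) : robtree :=
  mclass rob_dist (psl_act A (mrepr p)).

(* The matrix of classes of entries has determinant 1 as soon as mu is adapted
   to phi, so that the default value of [insubd] is then never used.  Changing
   representatives in PSL_2 changes the matrix by a global sign, since a sequence
   of signs is u-almost surely constant. *)
Definition rob_rep (Gam : groupType) (phi : nat -> {multiplicative Gam -> PSL2 R})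
    (g : Gam) : PSL2 RobF :=
  pslclass (insubd (1%g : SL2 RobF)
    (\matrix_(i, j < 2) rob_class (fun k => sl2_mx (pslrepr (phi k g)) i j))).

(* g is the germ at p of the image by A of the ray {pi(t v) : 0 <= t < 1}. *)
Definition is_radial_germ (A : PSL2 RobF) (v : RobF[i]) (p : robtree)
    (g : germ robtree_mdist p) :=
  exists2 c : segment robtree_mdist p, germ_of c = g &
    forall s, 0 <= s <= seg_len c ->
      exists (t : RobF) (z : disc RobF),
        [/\ 0 <= t < 1, disc_val z = t%:C * v & c s = mclass rob_dist (psl_act A z)].

(* The point of the unit circle over the residue field corresponding to the germ
   g, where A maps the base point pi(0) to p. *)
Definition germ_coord (A : PSL2 RobF) (p : robtree) (g : germ robtree_mdist p) :
    RobF_O[i] :=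
  xget 0 [set zeta | exists v : RobF[i],
    [/\ Normc.normc v = 1, is_radial_germ A v g & zeta = reduce_C v]].

(* The result does not depend on the choice of A. *)
Definition or_residue : germ_orientation robtree_mdist := fun p g1 g2 g3 =>
  let A := xget 1%g [set A | mclass rob_dist (psl_act A (disc0 RobF)) = p] in
  cyclic_sign (germ_coord A g1) (germ_coord A g2) (germ_coord A g3).

(* Psi is given on classes by (x_k + i y_k)_k |-> (x_k)_k + i (y_k)_k; this
   includes that the right-hand side lies in the disc over the Robinson field
   and that its class only depends on the point of the cone. *)
Definition induced_by_classes (Psi : cone u lam -> robtree) :=
  forall z : cone_seq u lam, exists2 w : disc RobF,
    disc_val w = rob_class_C (fun k => disc_val (z k)) &
    Psi (mclass (@cone_dist R u lam) z) = mclass rob_dist w.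

End RobinsonTree.

(* Main.v *)
(* Idea.  Along the ultrafilter, log_mu of a positive element of the Robinson
   field F is the limit of ln x_k / lambda_k.  Since ln cosh^2(d/2) and d differ by
   at most ln 4, this makes Psi an isometry, and it turns log_mu into an
   ultrametric valuation on F.

   Let A in PSL_2(F) map the centre to a lift of p.  Write a segment germ at p in
   this frame.  Ultrametric estimates show that the segment from the centre to a
   point a is the image of the radius through v = a/|a|, that v = a mod J for any
   v whose radius starts the segment, and that two radii with the same reduction
   have the same germ.

   On the side of the cone, let xi_k be the end of the geodesic ray from P_k
   through x_k.  Busemann functions decrease along the ray, so x_k lies deeper than
   P_k in the horoballs at xi_k:
     |1 - conj(x) xi|^2 (1 - |P|^2) <= |1 - conj(P) xi|^2 (1 - |x|^2).
   This inequality passes to F and is Moebius invariant; in the frame A, where P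
   has depth 0 and x is a, it gives eta = a mod J for the transported end eta.
   So eta and v have the same reduction.  As Moebius maps preserve cyclic orders
   on the circle and signs of nonzero elements survive both the ultralimit and the
   reduction, the two orientations agree. *)

Require Import Defs.
From HB Require Import structures.
From mathcomp Require Import all_boot all_order all_algebra.
From mathcomp Require Import complex finmap.
From mathcomp Require Import all_classical all_reals all_analysis.
From mathcomp Require Import ring lra.

Set Implicit Arguments.
Unset Strict Implicit.
Unset Printing Implicit Defensive.

Import Order.TTheory GRing.Theory Num.Theory.
Import numFieldNormedType.Exports.

Local Open Scope classical_set_scope.
Local Open Scope complex_scope.
Local Open Scope ring_scope.

(** * Moebius transformations of the disc and of its boundary circle *)

Section DiscAlgebra.
Variable K : rcfType.
Implicit Types z w al be : K[i].

(** The squared modulus as an element of [K]: being polynomial in the coordinates, it passes to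
    representing sequences and to residues. *)
Definition nsq z : K := complex.Re z ^+ 2 + complex.Im z ^+ 2.

Lemma nsq_ge0 z : 0 <= nsq z. Proof. by rewrite addr_ge0 ?sqr_ge0. Qed.
Lemma nsq_eq0 z : (nsq z == 0) = (z == 0).
Proof.
by rewrite /nsq paddr_eq0 ?sqr_ge0 // !sqrf_eq0; case: z => a b; rewrite eq_complex.
Qed.
Lemma nsq_gt0 z : (0 < nsq z) = (z != 0).
Proof. by rewrite lt_def nsq_ge0 andbT nsq_eq0. Qed.
Lemma nsqM z w : nsq (z * w) = nsq z * nsq w.
Proof. by case: z => a b; case: w => c d; rewrite /nsq /=; ring. Qed.
Lemma nsqJ z : nsq (conjc z) = nsq z.
Proof. by case: z => a b; rewrite /nsq /= sqrrN. Qed.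
Lemma nsqN z : nsq (- z) = nsq z.
Proof. by case: z => a b; rewrite /nsq /= !sqrrN. Qed.
Lemma nsqC (x : K) : nsq x%:C = x ^+ 2.
Proof. by rewrite /nsq /= expr0n addr0. Qed.
Lemma nsq0 : nsq 0 = 0. Proof. by rewrite nsqC expr0n. Qed.
Lemma nsq1 : nsq 1 = 1. Proof. by rewrite nsqC expr1n. Qed.
Lemma nsqV z : nsq z^-1 = (nsq z)^-1.
Proof.
have [->|z0] := eqVneq z 0; first by rewrite invr0 nsq0 invr0.
have n0 : nsq z != 0 by rewrite nsq_eq0.
by apply: (mulfI n0); rewrite -nsqM !mulfV // nsq1.
Qed.
Lemma nsq_normc z : Normc.normc z ^+ 2 = nsq z.
Proof. by case: z => a b; rewrite /= sqr_sqrtr // addr_ge0 ?sqr_ge0. Qed.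
Lemma mulJc z : conjc z * z = (nsq z)%:C.
Proof. by case: z => a b; apply/eqP; rewrite eq_complex /nsq /=; apply/andP; split; apply/eqP; ring. Qed.
Lemma nsqD_le z w : nsq (z + w) <= 2 * (nsq z + nsq w).
Proof.
case: z => a b; case: w => c d; rewrite /nsq /=.
have := sqr_ge0 (a - c); have := sqr_ge0 (b - d); lra.
Qed.

Variables (al be : K[i]).
(** [mob al be] is the action of the matrix with rows ([al], [be]) and ([conjc be], [conjc al]), of
    determinant [nsq al - nsq be]. *)
Definition mobN z := al * z + be.
Definition mobD z := conjc be * z + conjc al.
Definition mob z := mobN z / mobD z.

(** The matrix multiplies the Hermitian form of signature (1,1) by its determinant; this is that
    fact at the vectors (z, 1) and (w, 1). *)
Lemma mob_formD z w : conjc (mobD z) * mobD w - conjc (mobN z) * mobN w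
  = (nsq al - nsq be)%:C * (1 - conjc z * w).
Proof.
rewrite rmorphB /= -!mulJc /mobD /mobN !rmorphD !rmorphM /= !conjcK. ring.
Qed.
Lemma mob_diffE z w : mobN z * mobD w - mobN w * mobD z = (nsq al - nsq be)%:C * (z - w).
Proof.
rewrite rmorphB /= -!mulJc /mobD /mobN. ring.
Qed.
Hypothesis albe : nsq be < nsq al.

(** At a zero of the denominator the form identity equates minus the squared modulus of the
    numerator with a nonnegative number, while numerator and denominator never vanish together. *)
Lemma mobD_neq0 z : nsq z <= 1 -> mobD z != 0.
Proof.
move=> z1; apply/eqP => D0; have := mob_formD z z; rewrite D0 mulr0 sub0r !mulJc => /eqP.
have d0 : 0 < nsq al - nsq be by rewrite subr_gt0.
have N0 : mobN z != 0.
  apply/eqP => N0; have := mob_diffE z 0; rewrite D0 N0 mul0r mulr0 subr0 subr0 => /esym/eqP.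
  rewrite mulf_eq0 -nsq_eq0 nsqC sqrf_eq0 (gt_eqF d0) /= => /eqP z0.
  move: D0 albe; rewrite z0 /mobD mulr0 add0r => /eqP; rewrite -nsq_eq0 nsqJ => /eqP->.
  by rewrite ltNge nsq_ge0.
rewrite -subr_eq0 -[1]/(1%:C) -!rmorphB -!rmorphN -!rmorphM -rmorphB -nsq_eq0 nsqC sqrf_eq0.
have := nsq_gt0 (mobN z); rewrite N0; nra.
Qed.

Lemma mob_form z w : nsq z <= 1 -> nsq w <= 1 ->
  1 - conjc (mob z) * mob w =
  (nsq al - nsq be)%:C * (1 - conjc z * w) / (conjc (mobD z) * mobD w).
Proof.
move=> /mobD_neq0 z0 /mobD_neq0 w0; rewrite -mob_formD /mob rmorphM /= fmorphV /=.
have c0 : conjc (mobD z) != 0 by rewrite -nsq_eq0 nsqJ nsq_eq0.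
by field; rewrite c0 w0.
Qed.

Lemma mob_diff z w : nsq z <= 1 -> nsq w <= 1 ->
  mob z - mob w = (nsq al - nsq be)%:C * (z - w) / (mobD z * mobD w).
Proof.
move=> /mobD_neq0 z0 /mobD_neq0 w0; rewrite -mob_diffE /mob.
by field; rewrite z0 w0.
Qed.

Lemma mob_nsq_form z w : nsq z <= 1 -> nsq w <= 1 ->
  nsq (1 - conjc (mob z) * mob w) =
  (nsq al - nsq be) ^+ 2 * nsq (1 - conjc z * w) / (nsq (mobD z) * nsq (mobD w)).
Proof. by move=> z1 w1; rewrite mob_form // !nsqM nsqV nsqM nsqJ nsqC. Qed.

Lemma mob_nsq z : nsq z <= 1 ->
  1 - nsq (mob z) = (nsq al - nsq be) * (1 - nsq z) / nsq (mobD z).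
Proof.
move=> z1; have := mob_form z1 z1; rewrite !mulJc -[1]/(1%:C) -!rmorphB -!rmorphM -fmorphV -rmorphM.
by case.
Qed.

End DiscAlgebra.

(** * The cyclic order on the circle and the action of [PSL2] *)

Section UnitCircle.
Variable K : rcfType.
Implicit Types z w al be : K[i].

Definition cyc z1 z2 z3 : K :=
  complex.Re (z2 - z1) * complex.Im (z3 - z2) - complex.Im (z2 - z1) * complex.Re (z3 - z2).

Lemma det_mx22 (T : comNzRingType) (A : 'M[T]_2) : \det A = A 0 0 * A 1 1 - A 0 1 * A 1 0.
Proof.
rewrite (expand_det_row _ 0) !big_ord_recl big_ord0 addr0 /cofactor.
rewrite !det_mx11 !mxE /= expr0 expr1 mul1r mulN1r mulrN.
set x := lift _ _; set y := lift _ _.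
have -> : x = 1 by apply: val_inj.
by have -> : y = 0 by apply: val_inj.
Qed.

Lemma cyclic_signE z1 z2 z3 : cyclic_sign z1 z2 z3 = sgz (cyc z1 z2 z3).
Proof. by rewrite /cyclic_sign det_mx22 !mxE. Qed.

Lemma unitJ z : nsq z = 1 -> conjc z = z^-1.
Proof.
move=> z1; have z0 : z != 0 by rewrite -nsq_eq0 z1 oner_neq0.
by apply: (mulIf z0); rewrite mulVf // mulJc z1.
Qed.

(* On the circle conjugation is inversion, so the sign of the triple becomes that
   of an alternating product, which transforms under Moebius maps by factors that
   combine to a positive number. *)
Lemma cyc_unit z1 z2 z3 : nsq z1 = 1 -> nsq z2 = 1 -> nsq z3 = 1 ->
  (cyc z1 z2 z3)%:C * (0 +i* 2) * (z1 * z2 * z3) = (z1 - z2) * (z3 - z2) * (z3 - z1).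
Proof.
move=> u1 u2 u3.
have n0 z : nsq z = 1 -> z != 0 by move=> h; rewrite -nsq_eq0 h oner_neq0.
have -> : (cyc z1 z2 z3)%:C * (0 +i* 2) =
   conjc (z2 - z1) * (z3 - z2) - (z2 - z1) * conjc (z3 - z2).
  rewrite /cyc; case: (z2 - z1) => a b; case: (z3 - z2) => c d.
  by apply/eqP; rewrite eq_complex /=; apply/andP; split; apply/eqP; ring.
rewrite !rmorphB /= !unitJ //; field.
by rewrite !n0.
Qed.

Lemma cyc_unit_eq0 z1 z2 z3 : nsq z1 = 1 -> nsq z2 = 1 -> nsq z3 = 1 ->
  cyc z1 z2 z3 = 0 -> [|| z1 == z2, z2 == z3 | z1 == z3].
Proof.
move=> u1 u2 u3 h; have := cyc_unit u1 u2 u3; rewrite h !mul0r => /esym/eqP.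
by rewrite !mulf_eq0 !subr_eq0 (eq_sym z3 z2) (eq_sym z3 z1) -orbA.
Qed.

Section MobiusUnit.
Variables (al be : K[i]).
Hypothesis albe : nsq be < nsq al.

Lemma mob_unit z : nsq z = 1 -> nsq (mob al be z) = 1.
Proof.
move=> h; apply/eqP; rewrite eq_sym -subr_eq0 mob_nsq // ?h ?lexx //.
by rewrite subrr mulr0 mul0r.
Qed.

Lemma mob_unitE z : nsq z = 1 ->
  mob al be z = z * conjc (mobD al be z) / mobD al be z.
Proof.
move=> h; rewrite /mob; congr (_ / _); rewrite /mobN /mobD rmorphD rmorphM /= !conjcK.
have z0 : z != 0 by rewrite -nsq_eq0 h oner_neq0.
by rewrite unitJ //; field.
Qed.

Lemma cyc_mob z1 z2 z3 : nsq z1 = 1 -> nsq z2 = 1 -> nsq z3 = 1 ->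
  cyc (mob al be z1) (mob al be z2) (mob al be z3) =
  cyc z1 z2 z3 * ((nsq al - nsq be) ^+ 3
    / (nsq (mobD al be z1) * nsq (mobD al be z2) * nsq (mobD al be z3))).
Proof.
move=> u1 u2 u3.
have n0 z : nsq z = 1 -> z != 0 by move=> h; rewrite -nsq_eq0 h oner_neq0.
have D0 z : nsq z = 1 -> mobD al be z != 0 by move=> h; rewrite mobD_neq0 ?h.
have J0 z : nsq z = 1 -> conjc (mobD al be z) != 0.
  by move=> h; rewrite -nsq_eq0 nsqJ nsq_eq0 D0.
have i0 : (0 +i* 2 : K[i]) != 0 by rewrite eq_complex /= pnatr_eq0 andbF.
apply: (@complexI K).
have e1 := cyc_unit (mob_unit u1) (mob_unit u2) (mob_unit u3).
have e2 := cyc_unit u1 u2 u3.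
move: e1; rewrite !mob_diff ?u1 ?u2 ?u3 ?lexx // !mob_unitE // => e1.
(* Each squared modulus is split into [D] times its conjugate; with the two as independent unknowns
   the claim is a rational identity. *)
rewrite rmorphM rmorphM fmorphV rmorphXn !rmorphM /= -!mulJc.
move: e1 e2 (D0 _ u1) (D0 _ u2) (D0 _ u3) (J0 _ u1) (J0 _ u2) (J0 _ u3) (n0 _ u1) (n0 _ u2) (n0 _ u3).
set d := (nsq al - nsq be)%:C.
set c := (cyc z1 z2 z3)%:C; set c' := (cyc (_ / _) _ _)%:C.
move: (mobD al be z1) (mobD al be z2) (mobD al be z3) => D1 D2 D3.
move: (conjc D1) (conjc D2) (conjc D3) => J1 J2 J3.
move: i0; set i2 := (0 +i* 2) => i0 e1 e2 d1 d2 d3 j1 j2 j3 z10 z20 z30.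
have [m0] : i2 * (z1 * z2 * z3) * (J1 * J2 * J3) / (D1 * D2 * D3) != 0.
  by rewrite !mulf_neq0 ?invr_neq0 ?mulf_neq0.
apply: (mulIf m0).
have -> : c' * (i2 * (z1 * z2 * z3) * (J1 * J2 * J3) / (D1 * D2 * D3)) =
   c' * i2 * (z1 * J1 / D1 * (z2 * J2 / D2) * (z3 * J3 / D3)).
  by field; rewrite d1 d2 d3.
rewrite e1.
have -> : d * (z1 - z2) / (D1 * D2) * (d * (z3 - z2) / (D3 * D2)) * (d * (z3 - z1) / (D3 * D1))
  = d ^+ 3 * ((z1 - z2) * (z3 - z2) * (z3 - z1)) / (D1 * D2 * D3) ^+ 2.
  by field; rewrite d1 d2 d3.
rewrite -e2; field.
by rewrite d1 d2 d3 j1 j2 j3.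
Qed.

Lemma cyclic_sign_mob z1 z2 z3 : nsq z1 = 1 -> nsq z2 = 1 -> nsq z3 = 1 ->
  cyclic_sign (mob al be z1) (mob al be z2) (mob al be z3) = cyclic_sign z1 z2 z3.
Proof.
move=> u1 u2 u3; rewrite !cyclic_signE cyc_mob // sgzM [X in _ * X]gtr0_sgz ?mulr1 //.
have D0 z : nsq z = 1 -> 0 < nsq (mobD al be z).
  by move=> h; rewrite nsq_gt0 mobD_neq0 ?h.
apply: divr_gt0; first by rewrite exprn_gt0 // subr_gt0.
by rewrite !mulr_gt0 ?D0.
Qed.

End MobiusUnit.

(** [conjc al] and [- be] describe the adjugate matrix, which is the inverse up to the scalar
    [nsq al - nsq be]. *)
Lemma mobK al be z : nsq be < nsq al -> nsq z <= 1 ->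
  mob al be (mob (conjc al) (- be) z) = z.
Proof.
move=> h z1; have D0 : mobD (conjc al) (- be) z != 0 by rewrite mobD_neq0 // nsqN nsqJ.
have d0 : (nsq al - nsq be)%:C != 0.
  by rewrite -nsq_eq0 nsqC sqrf_eq0 gt_eqF // subr_gt0.
rewrite {1}/mob.
have -> : mobN al be (mob (conjc al) (- be) z) = (nsq al - nsq be)%:C * z / mobD (conjc al) (- be) z.
  rewrite /mob rmorphB /= -!mulJc /mobN; move: D0; rewrite /mobD !rmorphN /= conjcK => D0.
  by field.
have -> : mobD al be (mob (conjc al) (- be) z) = (nsq al - nsq be)%:C / mobD (conjc al) (- be) z.
  rewrite /mob rmorphB /= -!mulJc /mobN; move: D0; rewrite /mobD !rmorphN /= conjcK => D0.
  by field.
by move: (_ %:C) d0 (mobD _ _ z) D0 => d d0 D D0; field; rewrite d0 D0.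
Qed.

Lemma mobVK al be z : nsq be < nsq al -> nsq z <= 1 ->
  mob (conjc al) (- be) (mob al be z) = z.
Proof.
move=> h z1; have := @mobK (conjc al) (- be) z.
by rewrite conjcK opprK nsqN nsqJ => ->.
Qed.

(* Conjugating a real 2x2 matrix by the Cayley transform gives the element of
   SU(1,1), up to the factor 2, with first row [mal A, mbe A]. *)
Definition mal (A : 'M[K]_2) : K[i] := (A 0 0 + A 1 1) +i* (A 0 1 - A 1 0).
Definition mbe (A : 'M[K]_2) : K[i] := (A 0 0 - A 1 1) +i* - (A 0 1 + A 1 0).

Lemma mal_mbe (A : 'M[K]_2) : nsq (mal A) - nsq (mbe A) = 4 * \det A.
Proof. by rewrite det_mx22 /nsq /=; ring. Qed.

Lemma mal_gt_mbe (A : SL2 K) : nsq (mbe A) < nsq (mal A).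
Proof. by rewrite -subr_gt0 mal_mbe sl2_det mulr1 ltr0n. Qed.

Lemma mobiusE (A : SL2 K) z : nsq z < 1 -> mobius A z = mob (mal A) (mbe A) z.
Proof.
move=> z1; have ab := mal_gt_mbe A.
have zn1 : 1 - z != 0.
  by rewrite subr_eq0; apply/eqP => h; move: z1; rewrite -h nsq1 ltxx.
have D0 := mobD_neq0 ab (ltW z1).
pose ii : K[i] := 0 +i* 1.
have i0 : ii != 0 by rewrite eq_complex /= oner_eq0 andbF.
have ii2 : ii * ii = -1 by apply/eqP; rewrite eq_complex /=; apply/andP; split; apply/eqP; ring.
pose a := (A 0 0)%:C; pose b := (A 0 1)%:C; pose c := (A 1 0)%:C; pose d := (A 1 1)%:C.
(* [P] and [Q] are numerator and denominator of the homography at [cayley_inv z], cleared of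
   [1 - z]. *)
pose P := a * ii * (1 + z) + b * (1 - z); pose Q := c * ii * (1 + z) + d * (1 - z).
have cx (x y : K) : x +i* y = x%:C + y%:C * ii.
  by apply/eqP; rewrite eq_complex /=; apply/andP; split; apply/eqP; ring.
have ED : P + ii * Q = ii * mobD (mal A) (mbe A) z.
  rewrite /mobD /mal /mbe /= !cx !rmorphN !rmorphD /= -/a -/b -/c -/d /P /Q.
  by rewrite !rmorphN /= -/b -/c; ring: ii2.
have EN : P - ii * Q = ii * mobN (mal A) (mbe A) z.
  rewrite /mobN /mal /mbe /= !cx !rmorphN !rmorphD /= -/a -/b -/c -/d /P /Q.
  by rewrite !rmorphN /= -/b -/c; ring: ii2.
(* If [Q] vanished, [mobN] and [mobD] would agree at [z], against the form identity for
   [nsq z < 1]. *)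
have Q0 : Q != 0.
  apply/eqP => Q0; have := mob_formD (mal A) (mbe A) z z.
  have /(mulfI i0) -> : ii * mobN (mal A) (mbe A) z = ii * mobD (mal A) (mbe A) z.
    by rewrite -EN -ED Q0 mulr0 addr0 subr0.
  rewrite subrr mulJc -[1]/(1%:C) -rmorphB -rmorphM => /esym/eqP.
  by rewrite -nsq_eq0 nsqC sqrf_eq0 mulf_eq0 !gt_eqF ?subr_gt0.
have PQ0 : P + ii * Q != 0 by rewrite ED mulf_neq0.
have -> : mobius A z = (P / Q - ii) / (P / Q + ii).
  rewrite /mobius /cayley /homography /cayley_inv -/ii -/a -/b -/c -/d.
  suff -> : (a * (ii * (1 + z) / (1 - z)) + b) / (c * (ii * (1 + z) / (1 - z)) + d) = P / Q by [].
  rewrite /P /Q; field; rewrite zn1 /=.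
  by rewrite andbT.
have -> : (P / Q - ii) / (P / Q + ii) = (P - ii * Q) / (P + ii * Q).
  move: (P) (Q) (ii) Q0 => p q i q0.
  have -> : p / q - i = (p - i * q) / q by field.
  have -> : p / q + i = (p + i * q) / q by field.
  by rewrite invf_div mulrA mulfVK.
by rewrite ED EN /mob; field; rewrite i0 D0.
Qed.

Lemma disc_nsq (z : disc K) : nsq z < 1. Proof. by case: z. Qed.

Lemma psl_act_mob (p : PSL2 K) (z : disc K) :
  disc_val (psl_act p z) = mob (mal (pslrepr p)) (mbe (pslrepr p)) z.
Proof. exact/mobiusE/disc_nsq. Qed.

Lemma cosh2E (z w : K[i]) : cosh2_half_dist z w = nsq (1 - conjc z * w) / ((1 - nsq z) * (1 - nsq w)).
Proof. by rewrite /cosh2_half_dist !nsq_normc. Qed.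

Lemma cosh2_sym (z w : K[i]) : cosh2_half_dist z w = cosh2_half_dist w z.
Proof.
rewrite !cosh2E [X in _ / X]mulrC; congr (_ / _).
by case: z w => a b [c d]; rewrite /nsq /=; ring.
Qed.

Lemma mob_disc al be z : nsq be < nsq al -> nsq z < 1 -> nsq (mob al be z) < 1.
Proof.
move=> h z1; rewrite -subr_gt0 mob_nsq ?ltW //.
by rewrite divr_gt0 ?mulr_gt0 ?subr_gt0 ?nsq_gt0 ?mobD_neq0 ?ltW.
Qed.

Lemma cosh2_mob al be z w : nsq be < nsq al -> nsq z < 1 -> nsq w < 1 ->
  cosh2_half_dist (mob al be z) (mob al be w) = cosh2_half_dist z w.
Proof.
move=> h z1 w1; rewrite !cosh2E mob_nsq_form ?ltW // !mob_nsq ?ltW //.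
have d0 : nsq al - nsq be != 0 by rewrite gt_eqF ?subr_gt0.
have := mobD_neq0 h (ltW z1); have := mobD_neq0 h (ltW w1); rewrite -!nsq_eq0.
have : 1 - nsq z != 0 by rewrite gt_eqF ?subr_gt0.
have : 1 - nsq w != 0 by rewrite gt_eqF ?subr_gt0.
by move=> *; field; apply/and5P; split.
Qed.

Lemma cosh2_psl (p : PSL2 K) (z w : disc K) :
  cosh2_half_dist (psl_act p z) (psl_act p w) = cosh2_half_dist z w.
Proof. by rewrite !psl_act_mob cosh2_mob ?disc_nsq ?mal_gt_mbe. Qed.

Lemma psl_act_preim (p : PSL2 K) (x : disc K) :
  exists2 a : disc K, psl_act p a = x &
    disc_val a = mob (conjc (mal (pslrepr p))) (- mbe (pslrepr p)) x.
Proof.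
have ab := mal_gt_mbe (pslrepr p).
have h : in_disc (mob (conjc (mal (pslrepr p))) (- mbe (pslrepr p)) x).
  by apply: mob_disc (disc_nsq x); rewrite nsqN nsqJ.
exists (Disc h) => //; apply: val_inj => /=.
by rewrite -[LHS]/(disc_val (psl_act p (Disc h))) psl_act_mob /= mobK // ltW ?disc_nsq.
Qed.

Lemma psl_act_trans (x : disc K) : exists p : PSL2 K, psl_act p (disc0 K) = x.
Proof.
have x1 : 0 < 1 - nsq x by rewrite subr_gt0 disc_nsq.
pose s : K := (Num.sqrt (1 - nsq x))^-1.
have ss : s ^+ 2 * (1 - nsq x) = 1.
  by rewrite exprVn sqr_sqrtr ?ltW // mulVf // gt_eqF.
have s0 : s != 0 by apply/eqP => h; move: ss; rewrite h expr0n mul0r => /esym/eqP; rewrite oner_eq0.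
pose re := complex.Re x; pose im := complex.Im x.
(* Chosen so that [mal M] is [2 * s] and [mbe M] is [2 * s] times [x]: the centre goes to their
   quotient [x]. The factor [s] normalises the determinant. *)
pose M : 'M[K]_2 := \matrix_(i, j)
  (if i == 0 then if j == 0 then s * (1 + re) else - (s * im)
   else if j == 0 then - (s * im) else s * (1 - re)).
have dM : \det M == 1.
  by apply/eqP; rewrite det_mx22 !mxE /= -[RHS]ss /nsq -/re -/im; ring.
exists (pslclass (MkSL2 dM)); apply: val_inj.
rewrite -[LHS]/(disc_val _) psl_actE mobiusE ?nsq0 //.
rewrite /mob /mobN /mobD !mulr0 !add0r /mal /mbe /= !mxE /=.
have -> : s * (1 + re) + s * (1 - re) = 2 * s by ring.
have -> : s * (1 + re) - s * (1 - re) = (2 * s) * re by ring.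
have -> : - (- (s * im) - s * im) = (2 * s) * im by ring.
have -> : - (- (s * im) - - (s * im)) = 0 by ring.
have -> : (2 * s * re +i* (2 * s * im)) = (2 * s)%:C * disc_val x.
  rewrite /re /im; move: (2 * s) => r; case: (disc_val x) => a b /=.
  by apply/eqP; rewrite eq_complex /=; apply/andP; split; apply/eqP; ring.
by rewrite mulrAC mulfV ?mul1r // -nsq_eq0 nsqC sqrf_eq0 mulf_neq0 // pnatr_eq0.
Qed.
End UnitCircle.

(** * Valuation rings and the Robinson field *)

Section Reduction.
Variables (K : rcfType) (V : convex_subring K).
Implicit Types (x y : K) (r s : residue V).

(** A relational form of [reduce]: it includes membership in the ring, so the default value never
    enters. *)
Definition red x r := exists2 y : cs_type V, cs_val y = x & rclass y = r.

Lemma red_reduce x r : red x r -> reduce V x = r.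
Proof.
by move=> [y <- <-]; rewrite /reduce; congr rclass; rewrite -[cs_val y]/(val y) valKd.
Qed.
Lemma red_ring x (h : cs_ring V x) : red x (reduce V x).
Proof.
have E : red x (rclass (CsType h)) by exists (CsType h).
by rewrite (red_reduce E).
Qed.
Lemma red_in x r : red x r -> cs_ring V x.
Proof. by move=> [y <- _]; exact: (valP y). Qed.
Lemma red_exists r : exists x, red x r.
Proof. by exists (cs_val (rrepr r)); exists (rrepr r); rewrite ?rreprK. Qed.
Lemma redD x y r s : red x r -> red y s -> red (x + y) (r + s).
Proof. by move=> [a <- <-] [b <- <-]; exists (a + b); rewrite ?rmorphD. Qed.
Lemma redN x r : red x r -> red (- x) (- r).
Proof. by move=> [a <- <-]; exists (- a); rewrite ?rmorphN. Qed.
Lemma redM x y r s : red x r -> red y s -> red (x * y) (r * s).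
Proof. by move=> [a <- <-] [b <- <-]; exists (a * b); rewrite ?rmorphM. Qed.
Lemma red0 : red 0 0.
Proof. by exists 0; rewrite ?rmorph0. Qed.
Lemma red1 : red 1 1.
Proof. by exists 1; rewrite ?rmorph1. Qed.
Lemma redJ x y r s : red x r -> red y s -> r = s <-> cs_ideal V (x - y).
Proof. by move=> [a <- <-] [b <- <-]; exact: rclass_eq. Qed.
Lemma red_le x y r s : red x r -> red y s -> x <= y -> r <= s.
Proof. by move=> [a <- <-] [b <- <-]; exact: le_rclass. Qed.
Lemma red_lt x y r s : red x r -> red y s -> r < s -> x < y.
Proof. by move=> [a <- <-] [b <- <-]; exact: lt_rclass. Qed.
Lemma redV x r : red x r -> r != 0 -> red x^-1 r^-1.
Proof.
move=> xr r0.
have /negP : ~ cs_ideal V x.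
  by move=> J; move/eqP: r0; apply; apply/(redJ xr red0); rewrite subr0.
rewrite cs_idealE negb_or negbK => /andP[x0 Ox].
suff <- : reduce V x^-1 = r^-1 by exact: red_ring.
apply: (mulIf r0); rewrite mulVf //.
have := redM (red_ring Ox) xr; rewrite mulVf // => /red_reduce <-.
exact: (red_reduce red1).
Qed.
Lemma redX x r n : red x r -> red (x ^+ n) (r ^+ n).
Proof.
by move=> h; elim: n => [|n IH]; rewrite ?exprS; [exact: red1|exact: redM].
Qed.
End Reduction.

Section Ultra.
Variables (K : rcfType) (u : npultrafilter).
Implicit Types f g : nat -> K.

Lemma uclassV f : (uclass u f)^-1 = uclass u (fun k => (f k)^-1).
Proof.
rewrite -[LHS]/(uclass u _); apply/uclass_eq.
by apply: filterS (urepr_class u f) => k ->.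
Qed.

Lemma lt_uclass f g : uclass u f < uclass u g -> \forall k \near ult_sets u, f k < g k.
Proof.
rewrite ltNge => /negP h.
have : \forall k \near ult_sets u, g k <= f k \/ f k < g k.
  by apply: filterE => k; case: leP; [left|right].
by case/npultra_or => // /le_uclass.
Qed.

End Ultra.

(* The proofs below only see the Robinson field through this interface: the
   quotient construction behind it is too heavy for conversion. *)
Record seq_field (R : realType) (u : npultrafilter) (lam : nat -> R) := SeqField {
  sf :> rcfType;
  sf_mu : sf;
  rep : (nat -> R) -> sf -> Prop;
  rep_exists : forall h, exists x, rep x h;
  rep_fun : forall x h g, rep x h -> rep x g -> h = g;
  rep_ext : forall x y h, (\forall k \near ult_sets u, x k = y k) -> rep x h -> rep y h;
  repD : forall x y h g, rep x h -> rep y g -> rep (fun k => x k + y k) (h + g);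
  repM : forall x y h g, rep x h -> rep y g -> rep (fun k => x k * y k) (h * g);
  repN : forall x h, rep x h -> rep (fun k => - x k) (- h);
  rep0 : rep (fun=> 0) 0;
  rep1 : rep (fun=> 1) 1;
  repV : forall x h, rep x h -> h != 0 -> rep (fun k => (x k)^-1) h^-1;
  rep_le : forall x y h g, rep x h -> rep y g ->
    (\forall k \near ult_sets u, x k <= y k) -> h <= g;
  rep_lt : forall x y h g, rep x h -> rep y g -> h < g ->
    \forall k \near ult_sets u, x k < y k;
  rep_bounded : forall x y g, rep y g -> (\forall k \near ult_sets u, `|x k| <= y k) ->
    exists h, rep x h;
  rep_mu : rep (mu_seq lam) sf_mu;
  mu_inf : infinite_elt sf_mu;
  mu_cofinal : forall h, exists k : nat, h < sf_mu ^+ k }.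
Arguments rep {R u lam} s.

Section RobinsonModel.
Variables (R : realType) (u : npultrafilter) (lam : nat -> R).
Hypothesis hlam : lam @ \oo --> +oo.
Implicit Types (x y : nat -> R) (h g : RobF u hlam).

Let V := robinson_ring (mu_u_infinite u hlam).
Definition rob_rep_of x h := red (V := V) (uclass u x) h.

Lemma rob_rep_class x h : rob_rep_of x h -> rob_class u hlam x = h.
Proof. exact: red_reduce. Qed.

Fact rob_rep_exists h : exists x, rob_rep_of x h.
Proof. by have [a ah] := red_exists h; exists (urepr a); rewrite /rob_rep_of ureprK. Qed.
Fact rob_rep_fun x h g : rob_rep_of x h -> rob_rep_of x g -> h = g.
Proof. by move=> /rob_rep_class <- /rob_rep_class. Qed.
Fact rob_rep_ext x y h : (\forall k \near ult_sets u, x k = y k) ->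
  rob_rep_of x h -> rob_rep_of y h.
Proof. by rewrite /rob_rep_of => /uclass_eq ->. Qed.
Fact rob_repD x y h g : rob_rep_of x h -> rob_rep_of y g ->
  rob_rep_of (fun k => x k + y k) (h + g).
Proof. by move=> a b; have := redD a b; rewrite uclassD. Qed.
Fact rob_repM x y h g : rob_rep_of x h -> rob_rep_of y g ->
  rob_rep_of (fun k => x k * y k) (h * g).
Proof. by move=> a b; have := redM a b; rewrite uclassM. Qed.
Fact rob_repN x h : rob_rep_of x h -> rob_rep_of (fun k => - x k) (- h).
Proof. by move=> a; have := redN a; rewrite uclassN. Qed.
Fact rob_rep0 : rob_rep_of (fun=> 0) 0.
Proof. by have := red0 V; rewrite uclass0. Qed.
Fact rob_rep1 : rob_rep_of (fun=> 1) 1.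
Proof. by have := red1 V; rewrite uclass1. Qed.
Fact rob_repV x h : rob_rep_of x h -> h != 0 -> rob_rep_of (fun k => (x k)^-1) h^-1.
Proof. by move=> a b; have := redV a b; rewrite uclassV. Qed.
Fact rob_rep_mu : rob_rep_of (mu_seq lam) (RobF_mu u hlam).
Proof. by apply: red_ring; exact: (robinson_mu_bounded (mu_u_infinite u hlam)). Qed.
Fact rob_rep_le x y h g : rob_rep_of x h -> rob_rep_of y g ->
  (\forall k \near ult_sets u, x k <= y k) -> h <= g.
Proof. by move=> a b /le_uclass; exact: red_le. Qed.
Fact rob_rep_lt x y h g : rob_rep_of x h -> rob_rep_of y g -> h < g ->
  \forall k \near ult_sets u, x k < y k.
Proof. by move=> a b /(red_lt a b)/lt_uclass. Qed.
Fact rob_rep_bounded x y g : rob_rep_of y g ->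
  (\forall k \near ult_sets u, `|x k| <= y k) -> exists h, rob_rep_of x h.
Proof.
move=> b xy; exists (rob_class u hlam x); apply: red_ring; apply: cs_convex (red_in b).
have yy : uclass u y <= `|uclass u y| by exact: ler_norm.
apply: le_trans yy; rewrite ler_norml uclassN; apply/andP; split; apply/le_uclass.
  by apply: filterS xy => k /ler_normlP[h _]; rewrite -[leLHS]/(- y k) lerNl.
by apply: filterS xy => k /ler_normlP[_ h].
Qed.

Fact rob_mu_cofinal h : exists k : nat, h < RobF_mu u hlam ^+ k.
Proof.
have [k hk] := @robinson_mu_cofinal _ _ (mu_u_infinite u hlam) h.
by exists k; exact: le_lt_trans (ler_norm h) hk.
Qed.

Definition rob_field : seq_field u lam := SeqField
  rob_rep_exists rob_rep_fun rob_rep_ext rob_repD rob_repM rob_repN rob_rep0 rob_rep1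
  rob_repV rob_rep_le rob_rep_lt rob_rep_bounded rob_rep_mu
  (robinson_mu_infinite (mu_u_infinite u hlam))
  rob_mu_cofinal.

End RobinsonModel.

(** * The logarithm as a limit along the ultrafilter *)

Section SeqField.
Variables (R : realType) (u : npultrafilter) (lam : nat -> R) (F : seq_field u lam).
Hypothesis hlam : lam @ \oo --> +oo.
Local Notation mu := (sf_mu F).
Implicit Types (x y : nat -> R) (h g : F).

Lemma mu_gt1 : 1 < mu. Proof. exact: (mu_inf F 1). Qed.
Lemma mu_gt0 : 0 < mu. Proof. exact: lt_trans mu_gt1. Qed.

Lemma repB x y h g : rep F x h -> rep F y g -> rep F (fun k => x k - y k) (h - g).
Proof. by move=> a b; apply: repD => //; apply: repN. Qed.
Lemma repX x h n : rep F x h -> rep F (fun k => x k ^+ n) (h ^+ n).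
Proof.
move=> a; elim: n => [|n IH]; first exact: rep1.
by rewrite exprS; apply: rep_ext (repM a IH); apply: filterE => k; rewrite exprS.
Qed.
Lemma rep_nat n : rep F (fun=> n%:R) n%:R.
Proof.
elim: n => [|n IH]; first exact: rep0.
by rewrite -!natr1; exact: repD IH (rep1 F).
Qed.
Lemma rep_muz (m : int) : rep F (fun k => mu_seq lam k ^ m) (mu ^ m).
Proof.
case: m => n; first exact/repX/rep_mu.
apply: repV; first exact/repX/rep_mu.
by rewrite expf_neq0 // gt_eqF // mu_gt0.
Qed.

Lemma mu_seqz (m : int) k : mu_seq lam k ^ m = expR (m%:~R * lam k).
Proof.
case: m => n; rewrite /mu_seq; first by rewrite -exprnP -expRM_natl.
by rewrite NegzE -invr_expz -exprnP -expRM_natl -expRN mulrNz mulNr.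
Qed.

Lemma near_lam_gt (C : R) : \forall k \near ult_sets u, C < lam k.
Proof.
apply: npultra_cofinite; move/cvgryPge: hlam => /(_ (C + 1)).
by apply: filterS => k h; apply: lt_le_trans h; rewrite ltrDl.
Qed.

Local Notation L := (logmu R mu).


(** Raising both comparisons to the common exponent [n * n1] reduces the claim to the order of
    integer exponents of [mu]. *)
Lemma cut_lt h (m m1 : int) (n n1 : nat) : 0 < h -> (0 < n)%N -> (0 < n1)%N ->
  mu ^ m1 <= h ^+ n1 -> m%:~R / n%:R < m1%:~R / n1%:R :> R -> mu ^ m < h ^+ n.
Proof.
move=> h0 n0 n10 h1; rewrite ltr_pdivrMr ?ltr0n // mulrAC ltr_pdivlMr ?ltr0n //.
rewrite -[n%:R]/((n%:Z)%:~R) -[n1%:R]/((n1%:Z)%:~R) -!intrM ltr_int => lt.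
rewrite ltNge; apply/negP => h2.
have h3 : h ^+ (n * n1) <= mu ^ (m * n1%:Z).
  rewrite exprM -exprz_exp -exprnP lerXn2r // nnegrE ?exprn_ge0 ?ltW //.
  exact/exprz_gt0/mu_gt0.
have h4 : mu ^ (m1 * n%:Z) <= h ^+ (n * n1).
  rewrite mulnC exprM -exprz_exp -exprnP lerXn2r // nnegrE ?exprn_ge0 ?ltW //.
  exact/exprz_gt0/mu_gt0.
have := le_trans h4 h3; rewrite ler_eXz2l ?mu_gt1 //.
by rewrite leNgt lt.
Qed.

Lemma log_cut_has_sup h : 0 < h -> has_sup (@log_cut R F mu h).
Proof.
move=> h0; split.
  have [k hk] := mu_cofinal (s := F) h^-1.
  exists ((- k%:Z)%:~R / 1%:R), (- k%:Z), 1%N; split=> //.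
  rewrite expr1 -invr_expz -exprnP -[leRHS]invrK lef_pV2 ?posrE ?invr_gt0 ?exprn_gt0 ?mu_gt0 //.
  exact: ltW.
have [k hk] := mu_cofinal (s := F) h.
exists k%:R => _ [m [n [n0 hm ->]]]; rewrite leNgt; apply/negP => lt.
have := @cut_lt h k%:Z m 1%N n h0 isT n0 hm; rewrite divr1 => /(_ lt).
by rewrite expr1 ltNge ltW.
Qed.

Lemma ratrE (q : rat) : exists (m : int) (n : nat), (0 < n)%N /\ ratr q = m%:~R / n%:R :> R.
Proof.
exists (numq q), `|denq q|%N; split; first by rewrite absz_gt0 denq_neq0.
rewrite /ratr; congr (_ / _); rewrite -[RHS]/((Posz `|denq q|%N)%:~R).
by rewrite gtz0_abs ?denq_gt0.
Qed.

(* All the properties of [logmu] are read off this limit. *)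
Lemma logmu_cvg x h : rep F x h -> 0 < h ->
  (fun k => ln (x k) / lam k) @ ult_sets u --> L h.
Proof.
move=> xh h0; apply/cvgrPdist_lt => e e0.
have xpos := rep_lt (rep0 F) xh h0.
have lpos := near_lam_gt 0.
have hs := log_cut_has_sup h0.
(* A rational just above [L h] is outside the cut, which gives a strict inequality between powers of
   [h] and [mu], hence one for almost every index. *)
have [q1] := @rat_in_itvoo R (L h) (L h + e) (ltac:(by rewrite ltrDl)).
have [m1 [n1 [n10 E1]]] := ratrE q1; rewrite in_itv /= E1 => /andP[lo1 hi1].
have up : h ^+ n1 < mu ^ m1.
  rewrite ltNge; apply/negP => h1; move: lo1; rewrite ltNge => /negP; apply.
  by apply: sup_upper_bound => //; exists m1, n1.
have nup := rep_lt (repX n1 xh) (rep_muz m1) up.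
(* From below, an element of the cut beyond [L h - e] comes first; the rational [q2] under it makes
   the inequality strict, as [rep_lt] requires. *)
have [_ [m3 [n3 [n30 hm3 ->]]] lt3] := sup_adherent e0 hs.
have [q2] := @rat_in_itvoo R (L h - e) (m3%:~R / n3%:R) lt3.
have [m2 [n2 [n20 E2]]] := ratrE q2; rewrite in_itv /= E2 => /andP[lo2 hi2].
have dn := cut_lt h0 n20 n30 hm3 hi2.
have ndn := rep_lt (rep_muz m2) (repX n2 xh) dn.
near=> k.
have x0 : 0 < x k by near: k.
have l0 : 0 < lam k by near: k.
have : x k ^+ n1 < mu_seq lam k ^ m1 by near: k.
have : mu_seq lam k ^ m2 < x k ^+ n2 by near: k.
rewrite !mu_seqz -[X in _ < X -> _]lnK ?posrE ?exprn_gt0 // lnXn //.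
rewrite -[X in _ -> X < _ -> _]lnK ?posrE ?exprn_gt0 // lnXn // !ltr_expR.
rewrite -[ln (x k) *+ n1]mulr_natl -[ln (x k) *+ n2]mulr_natl => a2 a1.
have b1 : ln (x k) / lam k < m1%:~R / n1%:R.
  by rewrite ltr_pdivrMr // mulrAC ltr_pdivlMr ?ltr0n // mulrC.
have b2 : m2%:~R / n2%:R < ln (x k) / lam k.
  by rewrite ltr_pdivlMr // mulrAC ltr_pdivrMr ?ltr0n // [ltRHS]mulrC.
by rewrite ltr_norml; apply/andP; split; lra.
Unshelve. all: by end_near.
Qed.

Lemma cvg_near_eq x y (l : R) : (\forall k \near ult_sets u, x k = y k) ->
  x @ ult_sets u --> l -> y @ ult_sets u --> l.
Proof.
move=> xy /cvgrPdist_lt xl; apply/cvgrPdist_lt => e /xl h.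
by apply: filterS2 xy h => k <-.
Qed.

Lemma logmu_lim x h l : rep F x h -> 0 < h ->
  (fun k => ln (x k) / lam k) @ ult_sets u --> l -> l = L h.
Proof. by move=> a b c; apply: cvg_unique c (logmu_cvg a b). Qed.

Lemma logmuM h g : 0 < h -> 0 < g -> L (h * g) = L h + L g.
Proof.
move=> h0 g0; have [x xh] := rep_exists h; have [y yg] := rep_exists g.
apply/esym/(logmu_lim (repM xh yg)); first exact: mulr_gt0.
apply: cvg_near_eq (cvgD (logmu_cvg xh h0) (logmu_cvg yg g0)).
apply: filterS2 (rep_lt (rep0 F) xh h0) (rep_lt (rep0 F) yg g0) => k a b /=.
by rewrite lnM // mulrDl.
Qed.

Lemma logmu1 : L 1 = 0.
Proof. by have := logmuM ltr01 ltr01; rewrite mulr1; lra. Qed.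

Lemma logmuV h : 0 < h -> L h^-1 = - L h.
Proof.
move=> h0; apply: (addrI (L h)); rewrite subrr -logmuM ?invr_gt0 //.
by rewrite mulfV ?gt_eqF // logmu1.
Qed.

Lemma logmu_le h g : 0 < h -> h <= g -> L h <= L g.
Proof.
rewrite [h <= g]le_eqVlt => h0 /orP[/eqP->//|hg].
have g0 := lt_trans h0 hg.
have [x xh] := rep_exists h; have [y yg] := rep_exists g.
apply: ler_cvg_to (logmu_cvg xh h0) (logmu_cvg yg g0) _.
near=> k.
have x0 : 0 < x k by near: k; exact: rep_lt (rep0 F) xh h0.
have l0 : 0 < lam k by near: k; exact: near_lam_gt.
have xy : x k < y k by near: k; exact: rep_lt xh yg hg.
by rewrite ler_pM2r ?invr_gt0 // ler_ln ?posrE ?ltW // (lt_trans x0).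
Unshelve. all: by end_near.
Qed.

(** Additive constants disappear at the scale [lam]: positive integers get logarithm 0, and the
    [ln 4] in the comparison of distances is lost. *)
Lemma cvg_divlam (C : R) : (fun k => C / lam k) @ ult_sets u --> (0 : R).
Proof.
apply/cvgrPdist_lt => e e0.
apply: filterS (near_lam_gt (`|C| / e)) => k h.
have l0 : 0 < lam k by apply: le_lt_trans h; rewrite divr_ge0 // ltW.
by rewrite sub0r normrN normrM normfV (gtr0_norm l0) ltr_pdivrMr // mulrC -ltr_pdivrMr.
Qed.

Lemma logmu_nat n : L n.+1%:R = 0.
Proof.
apply/esym; apply: logmu_lim (rep_nat n.+1) _ _; first by rewrite ltr0n.
exact: cvg_divlam.
Qed.

End SeqField.

(** * The Hermitian form and horoballs *)

Section DiscForms.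
Variable K : rcfType.
Implicit Types (z w : K[i]).

Lemma nsq_form z w : nsq (1 - conjc z * w) = nsq (z - w) + (1 - nsq z) * (1 - nsq w).
Proof. by case: z w => a b [c d]; rewrite /nsq /=; ring. Qed.

Lemma form_gt0 z w : nsq z < 1 -> nsq w < 1 -> 0 < nsq (1 - conjc z * w).
Proof.
move=> z1 w1; rewrite nsq_form ltr_wpDl ?nsq_ge0 // mulr_gt0 ?subr_gt0 //.
Qed.

Lemma form_le4 z w : nsq z <= 1 -> nsq w <= 1 -> nsq (1 - conjc z * w) <= 4.
Proof.
move=> z1 w1; have h := nsqD_le 1 (- (conjc z * w)).
move: h; rewrite nsq1 nsqN nsqM nsqJ => h; apply: le_trans h _.
have : nsq z * nsq w <= 1 by rewrite mulr_ile1 ?nsq_ge0.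
by move: (nsq z * nsq w) => t; lra.
Qed.

Lemma cosh2_ge1 z w : nsq z < 1 -> nsq w < 1 -> 1 <= cosh2_half_dist z w.
Proof.
move=> z1 w1; rewrite cosh2E nsq_form ler_pdivlMr ?mulr_gt0 ?subr_gt0 //.
by rewrite mul1r lerDr nsq_ge0.
Qed.

Lemma cosh2_refl z : nsq z < 1 -> cosh2_half_dist z z = 1.
Proof.
move=> z1; rewrite cosh2E nsq_form subrr nsq0 add0r mulfV //.
by rewrite mulf_neq0 // gt_eqF ?subr_gt0.
Qed.

(* The comparison of Busemann functions at the point [xi] of the circle, which
   says that [x] is at least as far inside the horoballs at [xi] as [P]. *)
Definition horo_le (x P xi : K[i]) :=
  nsq (1 - conjc x * xi) * (1 - nsq P) <= nsq (1 - conjc P * xi) * (1 - nsq x).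

(** The two sides for the images are the original ones times the same positive factor. *)
Lemma horo_le_mob al be x P xi : nsq be < nsq al ->
  nsq x <= 1 -> nsq P <= 1 -> nsq xi <= 1 ->
  horo_le (mob al be x) (mob al be P) (mob al be xi) -> horo_le x P xi.
Proof.
move=> ab x1 P1 xi1; rewrite /horo_le !mob_nsq_form // !mob_nsq //.
have d0 : 0 < nsq al - nsq be by rewrite subr_gt0.
have Dx : 0 < nsq (mobD al be x) by rewrite nsq_gt0 mobD_neq0.
have DP : 0 < nsq (mobD al be P) by rewrite nsq_gt0 mobD_neq0.
have Dxi : 0 < nsq (mobD al be xi) by rewrite nsq_gt0 mobD_neq0.
move: d0 Dx DP Dxi; set d := nsq al - _; set a := nsq (mobD _ _ x).
set b := nsq (mobD _ _ P); set c := nsq (mobD _ _ xi) => d0 a0 b0 c0.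
have f0 : 0 < d ^+ 3 / (a * b * c) by rewrite divr_gt0 ?exprn_gt0 ?mulr_gt0.
move: (nsq (1 - _)) (nsq (1 - _)) (1 - nsq x) (1 - nsq P) => X Y Z W.
move=> h; rewrite -(ler_pM2r f0); move: h.
by congr (is_true (_ <= _)); field; rewrite !gt_eqF.
Qed.

Lemma conj0 : conjc (0 : K[i]) = 0.
Proof. by apply/eqP; rewrite eq_complex /= oppr0 !eqxx. Qed.

Lemma conj1B z : conjc (1 - z) = 1 - conjc z.
Proof.
by case: z => a b; apply/eqP; rewrite eq_complex /=; apply/andP; split; apply/eqP; ring.
Qed.

Lemma conjMr (t : K) z : conjc (t%:C * z) = t%:C * conjc z.
Proof.
by case: z => a b; apply/eqP; rewrite eq_complex /=; apply/andP; split; apply/eqP; ring.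
Qed.

(** Factoring out [eta], whose inverse is its conjugate, turns the horoball quantity into a
    Euclidean distance. *)
Lemma nsq_sub_circle (a eta : K[i]) : nsq eta = 1 -> nsq (eta - a) = nsq (1 - conjc a * eta).
Proof.
move=> e1; have -> : eta - a = eta * conjc (1 - conjc a * eta).
  have e0 : eta != 0 by rewrite -nsq_eq0 e1 oner_neq0.
  rewrite conj1B rmorphM /= conjcK (unitJ e1).
  by field.
by rewrite nsqM e1 mul1r nsqJ.
Qed.

End DiscForms.

(** * Ultrametric estimates in the disc over the Robinson field *)

Section LogEstimates.
Variables (R : realType) (u : npultrafilter) (lam : nat -> R) (F : seq_field u lam).
Hypothesis hlam : lam @ \oo --> +oo.
Local Notation mu := (sf_mu F).
Local Notation L := (logmu R mu).
Implicit Types (x y : F) (z w v eta : F[i]) (r s : R) (a b p q : disc F).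

(** Since [logmu] is meaningless on nonpositive elements, these count as having logarithm minus
    infinity. *)
Definition lle x r := x <= 0 \/ L x <= r.

Lemma lle_le x y r : x <= y -> lle y r -> lle x r.
Proof.
move=> xy; case=> h; first by left; exact: le_trans h.
case: (leP x 0) => x0; [by left|right].
exact: le_trans (logmu_le hlam x0 xy) h.
Qed.
Lemma lle_weak x r s : r <= s -> lle x r -> lle x s.
Proof. by move=> rs [h|h]; [left|right; exact: le_trans rs]. Qed.
Lemma lle_nat n : lle n%:R 0.
Proof. by case: n => [|n]; [left|right; rewrite logmu_nat]. Qed.
Lemma lleM x y r s : 0 <= x -> 0 <= y -> lle x r -> lle y s -> lle (x * y) (r + s).
Proof.
move=> x0 y0 hx hy.
have [xy|xy] := leP (x * y) 0; first by left.
have {}x0 : 0 < x by rewrite lt_def x0 andbT; apply/eqP => E; move: xy; rewrite E mul0r ltxx.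
have {}y0 : 0 < y by rewrite lt_def y0 andbT; apply/eqP => E; move: xy; rewrite E mulr0 ltxx.
case: hx => [|hx]; first by rewrite leNgt x0.
case: hy => [|hy]; first by rewrite leNgt y0.
by right; rewrite logmuM // lerD.
Qed.
(** The ultrametric inequality: a sum is at most twice its larger term, and 2 has logarithm 0. *)
Lemma lleD x y r : lle x r -> lle y r -> lle (x + y) r.
Proof.
wlog xy : x y / x <= y.
  move=> W hx hy; case: (leP x y) => [|/ltW] h; first exact: W.
  by rewrite addrC; apply: W.
move=> hx hy; apply: (@lle_le _ (2 * y)); first by rewrite mulr_natl mulr2n lerD2r.
have [y0|y0] := leP y 0; first by left; rewrite mulr_natl mulrn_wle0.
by rewrite -[r]add0r; apply: lleM => //; [exact: ltW|exact: lle_nat].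
Qed.

(** The exponent bounds the logarithm of the squared modulus, which explains the doubled exponents
    such as [r + r] below. *)
Definition csmall z r := lle (nsq z) r.

Lemma csmall_weak z r s : r <= s -> csmall z r -> csmall z s.
Proof. exact: lle_weak. Qed.
Lemma csmallD z w r : csmall z r -> csmall w r -> csmall (z + w) r.
Proof.
move=> hz hw; apply: lle_le (nsqD_le z w) _; rewrite -[r]add0r.
by apply: lleM => //; [rewrite addr_ge0 ?nsq_ge0|exact: lle_nat|exact: lleD].
Qed.
Lemma csmallN z r : csmall z r -> csmall (- z) r.
Proof. by rewrite /csmall nsqN. Qed.
Lemma csmallM z w r s : csmall z r -> csmall w s -> csmall (z * w) (r + s).
Proof. by rewrite /csmall nsqM => ? ?; apply: lleM; rewrite ?nsq_ge0. Qed.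
Lemma csmall_le1 z : nsq z <= 1 -> csmall z 0.
Proof. by move=> h; apply: lle_le h (lle_nat 1). Qed.
Lemma csmallC x r : 0 <= x -> lle x r -> csmall x%:C (r + r).
Proof. by move=> x0 h; rewrite /csmall nsqC expr2; apply: lleM. Qed.
Lemma csmall_le1M z w r : nsq z <= 1 -> csmall w r -> csmall (z * w) r.
Proof. by move=> h hw; rewrite -[r]add0r; apply: csmallM => //; exact: csmall_le1. Qed.

Lemma logmu_sqr x : x != 0 -> L (x ^+ 2) = L `|x| + L `|x|.
Proof.
move=> x0; have h : 0 < `|x| by rewrite normr_gt0.
by rewrite -logmuM // -expr2 real_normK // num_real.
Qed.

Lemma lle_sqr_lt0 x r : r < 0 -> lle (x ^+ 2) r -> (x == 0) || (L `|x| < 0).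
Proof.
move=> r0 h; have [//|x0 /=] := eqVneq x 0.
case: h => [|h]; first by rewrite leNgt lt_def sqr_ge0 sqrf_eq0 x0.
move: h; rewrite logmu_sqr //; lra.
Qed.

Lemma lt0_lle_sqr x : (x == 0) || (L `|x| < 0) -> exists2 r, r < 0 & lle (x ^+ 2) r.
Proof.
have [->|x0 /= h] := eqVneq x 0.
  by exists (-1); [rewrite oppr_lt0|left; rewrite expr0n].
exists (L `|x| + L `|x|); first by lra.
by right; rewrite logmu_sqr.
Qed.

(** With [lt0_csmall], this identifies smallness at some negative exponent with both coordinates
    lying in the maximal ideal of the logarithm. *)
Lemma csmall_lt0 z r : r < 0 -> csmall z r ->
  ((complex.Re z == 0) || (L `|complex.Re z| < 0)) /\
  ((complex.Im z == 0) || (L `|complex.Im z| < 0)).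
Proof.
move=> r0 h; split; apply: (lle_sqr_lt0 r0); apply: lle_le h; rewrite /nsq.
  by rewrite lerDl sqr_ge0.
by rewrite lerDr sqr_ge0.
Qed.

Lemma lt0_csmall z : (complex.Re z == 0) || (L `|complex.Re z| < 0) ->
  (complex.Im z == 0) || (L `|complex.Im z| < 0) -> exists2 r, r < 0 & csmall z r.
Proof.
move=> /lt0_lle_sqr[r r0 hr] /lt0_lle_sqr[s s0 hs].
exists (Num.max r s); first by rewrite gt_max r0.
by apply: lleD; [apply: lle_weak hr|apply: lle_weak hs]; rewrite le_max lexx ?orbT.
Qed.

Definition gdist a b : R := L (cosh2_half_dist a b).
(** By [gdist0], the distance to the centre. *)
Definition depth a : R := - L (1 - nsq a).

Lemma one_sub_gt0 a : 0 < 1 - nsq a. Proof. by rewrite subr_gt0 disc_nsq. Qed.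

Lemma gdistE a b : gdist a b = L (nsq (1 - conjc a * b)) + depth a + depth b.
Proof.
rewrite /gdist cosh2E /depth -addrA -opprD -logmuM ?one_sub_gt0 //.
by rewrite -logmuV ?mulr_gt0 ?one_sub_gt0 // logmuM ?invr_gt0 ?mulr_gt0 ?one_sub_gt0 ?form_gt0 ?disc_nsq.
Qed.

Lemma gdist0 a : gdist (disc0 F) a = depth a.
Proof.
have E0 : disc_val (disc0 F) = 0 by [].
by rewrite gdistE /depth E0 conj0 mul0r subr0 nsq1 nsq0 subr0 logmu1 // oppr0 !add0r.
Qed.

Lemma gdistxx a : gdist a a = 0.
Proof. by rewrite /gdist cosh2_refl ?disc_nsq // logmu1. Qed.
Lemma gdist_sym a b : gdist a b = gdist b a.
Proof. by rewrite /gdist cosh2_sym. Qed.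
Lemma gdist_psl (A : PSL2 F) a b : gdist (psl_act A a) (psl_act A b) = gdist a b.
Proof. by rewrite /gdist cosh2_psl. Qed.
Lemma gdist_ge0 a b : 0 <= gdist a b.
Proof.
rewrite -(logmu1 F hlam); apply: logmu_le => //; apply: cosh2_ge1; exact: disc_nsq.
Qed.

(** With [csmall_form], this translates distances into sizes of [1 - conjc a * b], to which the
    ultrametric calculus applies. *)
Lemma form_csmall a b r : csmall (1 - conjc a * b) r -> gdist a b <= r + depth a + depth b.
Proof.
rewrite gdistE; case=> h; last by rewrite !lerD.
by move: h; rewrite leNgt form_gt0 ?disc_nsq.
Qed.
Lemma csmall_form a b : csmall (1 - conjc a * b) (gdist a b - depth a - depth b).
Proof. by right; rewrite gdistE; lra. Qed.

(* By transitivity the middle point may be taken to be the centre. *)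
Lemma gdist_triangle a b c : gdist a c <= gdist a b + gdist b c.
Proof.
have [A <-] := psl_act_trans b.
have [a' <- _] := psl_act_preim A a; have [c' <- _] := psl_act_preim A c.
rewrite !gdist_psl (gdist_sym a' (disc0 F)) !gdist0 -[depth a']add0r.
apply: form_csmall; rewrite /csmall; apply: lle_le (lle_nat 4).
by apply: form_le4; exact/ltW/disc_nsq.
Qed.

Lemma depth_lle a : lle (1 - nsq a) (- depth a).
Proof. by right; rewrite opprK. Qed.

Lemma radius_lle (t : F) (v : F[i]) q : nsq v = 1 -> 0 <= t < 1 -> disc_val q = t%:C * v ->
  lle (1 - t) (- depth q).
Proof.
move=> v1 /andP[t0 t1] qE; apply: lle_le (depth_lle q).
by rewrite qE nsqM nsqC v1; nra.
Qed.

(** Here [q] lies on the radius along [v] and, in the tree, between the centre and [a]. The distance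
    conditions give the form at [q] and [a] the exponent [- (s + s)], and [1 - t] is equally small;
    so [a] and [v] are close. *)
Lemma radial_close a q (t : F) (v : F[i]) s : nsq v = 1 -> 0 <= t < 1 -> disc_val q = t%:C * v ->
  gdist (disc0 F) q = s -> gdist q a = gdist (disc0 F) a - s ->
  csmall (disc_val a - v) (- (s + s)).
Proof.
rewrite !gdist0 => v1 t01 qE sE dE.
have h := csmall_form q a; have ht := csmallC _ (radius_lle v1 t01 qE).
have -> : disc_val a - v = - (v * ((1 - conjc q * disc_val a) - (1 - t)%:C * (conjc v * disc_val a))).
  have : conjc v * v = 1 by rewrite mulJc v1.
  by rewrite qE conjMr rmorphB /= => vv; ring: vv.
apply: csmallN; apply: csmall_le1M; first by rewrite v1.
apply: csmallD; first by apply: csmall_weak h; lra.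
apply: csmallN; rewrite mulrC; apply: csmall_le1M.
  by rewrite nsqM nsqJ v1 mul1r ltW ?disc_nsq.
move: t01 => /andP[t0 t1].
by apply: csmall_weak (ht _); [lra|rewrite subr_ge0 ltW].
Qed.

(** A point [b] between the centre and [a] has the same image in the tree as the point of the radius
    through [a] with the modulus of [b]. *)
Lemma radial_exists a b : 0 < depth a -> depth b <= depth a ->
  gdist b a = depth a - depth b ->
  let v := disc_val a * ((Normc.normc a)^-1)%:C in
  nsq v = 1 /\ exists (t : F) q,
    [/\ 0 <= t < 1, disc_val q = t%:C * v & gdist b q = 0].
Proof.
move=> a0 ba dE v.
pose ra := Normc.normc (disc_val a); pose t := Normc.normc (disc_val b).
have ra2 : ra ^+ 2 = nsq a by exact: nsq_normc.
have t2 : t ^+ 2 = nsq b by exact: nsq_normc.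
have ra_ge0 : 0 <= ra by rewrite /ra; case: (disc_val a) => ? ?; exact: sqrtr_ge0.
have t_ge0 : 0 <= t by rewrite /t; case: (disc_val b) => ? ?; exact: sqrtr_ge0.
have ra0 : ra != 0.
  apply/eqP => E; move: a0; rewrite /depth -ra2 E expr0n subr0 logmu1 //.
  by rewrite oppr0 ltxx.
have v1 : nsq v = 1 by rewrite nsqM nsqC exprVn ra2 mulfV // -ra2 expf_neq0.
have aE : disc_val a = ra%:C * v.
  by rewrite /v mulrCA -rmorphM /= mulfV // mulr1.
have t1 : t < 1 by have := disc_nsq b; rewrite -t2; nra.
have ra1 : ra < 1 by have := disc_nsq a; rewrite -ra2; nra.
have hq : in_disc (t%:C * v).
  by rewrite /in_disc -/(nsq _) nsqM nsqC v1 mulr1 t2 disc_nsq.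
split=> //; exists t, (Disc hq); rewrite t_ge0 t1; split=> //.
have dq : depth (Disc hq) = depth b by rewrite /depth /= nsqM nsqC v1 mulr1 t2.
apply/eqP; rewrite eq_le gdist_ge0 andbT.
suff : csmall (1 - conjc b * disc_val (Disc hq)) (- (depth b + depth b)).
  by move/form_csmall; rewrite dq; lra.
(* The detour through [a] leaves three terms, each of exponent at most [- (depth b + depth b)]. *)
have -> /= : 1 - conjc b * (t%:C * v) = (1 - conjc b * disc_val a)
    - conjc b * v * (1 - ra)%:C + conjc b * v * (1 - t)%:C.
  by rewrite aE !rmorphB /=; ring.
have cb : nsq (conjc b * v) <= 1 by rewrite nsqM nsqJ v1 mulr1 ltW ?disc_nsq.
apply: csmallD; [apply: csmallD|].
- by apply: csmall_weak (csmall_form b a); lra.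
- apply/csmallN/csmall_le1M => //.
  apply: csmall_weak (csmallC (r := - depth a) _ _); first by lra.
    by rewrite subr_ge0 ltW.
  by apply: lle_le (depth_lle a); rewrite -ra2; nra.
- apply: csmall_le1M => //.
  apply: csmall_weak (csmallC (r := - depth b) _ _); first by lra.
    by rewrite subr_ge0 ltW.
  by apply: lle_le (depth_lle b); rewrite -t2; nra.
Qed.

(** Radii whose directions differ at exponent [r] agree in the tree up to depth [- r / 2]: there the
    difference of the directions is no larger than the other terms of the form. *)
Lemma radial_meet q1 q2 (t1 t2 : F) (v1 v2 : F[i]) s r : nsq v1 = 1 -> nsq v2 = 1 ->
  0 <= t1 < 1 -> 0 <= t2 < 1 -> disc_val q1 = t1%:C * v1 -> disc_val q2 = t2%:C * v2 ->
  depth q1 = s -> depth q2 = s -> csmall (v1 - v2) r -> s + s <= - r -> gdist q1 q2 = 0.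
Proof.
move=> u1 u2 h1 h2 E1 E2 d1 d2 hv sr.
have l1 := radius_lle u1 h1 E1; have l2 := radius_lle u2 h2 E2.
move: h1 h2 => /andP[t10 t11] /andP[t20 t21].
apply/eqP; rewrite eq_le gdist_ge0 andbT.
suff : csmall (1 - conjc q1 * q2) (- (s + s)).
  by move/form_csmall; rewrite d1 d2; lra.
have uu : conjc v1 * v1 = 1 by rewrite mulJc u1.
have -> : 1 - conjc q1 * disc_val q2 = (1 - t1)%:C + t1%:C * (1 - t2)%:C
     + (t1%:C * t2%:C * conjc v1) * (v1 - v2).
  by rewrite E1 E2 conjMr !rmorphB /=; ring: uu.
have le1 (t : F) : 0 <= t -> t < 1 -> nsq t%:C <= 1.
  by move=> *; rewrite nsqC expr_le1 // ltW.
have nn (t : F) : t < 1 -> 0 <= 1 - t by move=> /ltW; rewrite subr_ge0.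
apply: csmallD; [apply: csmallD|].
- by apply: csmall_weak (csmallC (nn _ t11) l1); lra.
- by apply: csmall_le1M; [exact: le1|apply: csmall_weak (csmallC (nn _ t21) l2); lra].
- apply: csmall_le1M; last by apply: csmall_weak hv; lra.
  by rewrite !nsqM nsqJ u1 mulr1 mulr_ile1 ?nsq_ge0 ?le1.
Qed.

(** The inequality bounds [nsq (eta - a)] by 4 times [1 - nsq a] over [1 - nsq p]; the constant and
    the denominator have logarithm 0. *)
Lemma horo_close a p eta : nsq eta = 1 -> depth p = 0 -> horo_le a p eta ->
  csmall (eta - disc_val a) (- depth a).
Proof.
move=> e1 p0; rewrite /horo_le /csmall nsq_sub_circle // -ler_pdivlMr ?one_sub_gt0 // => h.
apply: lle_le h _.
have -> : - depth a = (0 + - depth a) + 0 by rewrite add0r addr0.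
apply: lleM.
- by rewrite mulr_ge0 ?nsq_ge0 // ltW ?one_sub_gt0.
- by rewrite invr_ge0 ltW ?one_sub_gt0.
- apply: lleM; [exact: nsq_ge0|exact/ltW/one_sub_gt0| |exact: depth_lle].
  by apply: lle_le (lle_nat 4); apply: form_le4; rewrite ?e1 // ltW ?disc_nsq.
- by right; rewrite logmuV ?one_sub_gt0 // -/(depth p) p0.
Qed.

End LogEstimates.

(** * The hyperbolic plane over the reals *)

Section ComplexLimits.
Variables (R : realType) (T : Type) (FF : set_system T) (HF : ProperFilter FF).
Implicit Types (f g : T -> R[i]) (l m : R[i]).

Definition ccvg f l :=
  ((fun t => complex.Re (f t)) @ FF --> complex.Re l) /\
  ((fun t => complex.Im (f t)) @ FF --> complex.Im l).

Lemma ccvg_cst l : ccvg (fun=> l) l.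
Proof. by split; exact: cvg_cst. Qed.

Lemma ccvgD f g l m : ccvg f l -> ccvg g m -> ccvg (fun t => f t + g t) (l + m).
Proof.
move=> [a b] [c d]; split.
  have -> : (fun t => complex.Re (f t + g t)) = (fun t => complex.Re (f t) + complex.Re (g t)).
    by apply/funext => t; case: (f t) (g t) => ? ? [].
  by case: l m a b c d => ? ? [? ?] a b c d; exact: cvgD.
have -> : (fun t => complex.Im (f t + g t)) = (fun t => complex.Im (f t) + complex.Im (g t)).
  by apply/funext => t; case: (f t) (g t) => ? ? [].
by case: l m a b c d => ? ? [? ?] a b c d; exact: cvgD.
Qed.

Lemma ccvgM f g l m : ccvg f l -> ccvg g m -> ccvg (fun t => f t * g t) (l * m).
Proof.
move=> [a b] [c d]; split.
  have -> : (fun t => complex.Re (f t * g t)) = (fun t =>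
      complex.Re (f t) * complex.Re (g t) - complex.Im (f t) * complex.Im (g t)).
    by apply/funext => t; case: (f t) (g t) => ? ? [].
  by case: l m a b c d => ? ? [? ?] a b c d; apply: cvgB; exact: cvgM.
have -> : (fun t => complex.Im (f t * g t)) = (fun t =>
    complex.Re (f t) * complex.Im (g t) + complex.Im (f t) * complex.Re (g t)).
  by apply/funext => t; case: (f t) (g t) => ? ? [].
by case: l m a b c d => ? ? [? ?] a b c d; apply: cvgD; exact: cvgM.
Qed.

Lemma ccvg_nsq f l : ccvg f l -> (fun t => nsq (f t)) @ FF --> nsq l.
Proof. by move=> [a b]; rewrite /nsq; apply: cvgD; apply: cvgM. Qed.

Lemma ccvgV f l : l != 0 -> ccvg f l -> ccvg (fun t => (f t)^-1) l^-1.
Proof.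
move=> l0 fl; have n0 : nsq l != 0 by rewrite nsq_eq0.
have nV : (fun t => (nsq (f t))^-1) @ FF --> (nsq l)^-1 by exact: cvgV n0 (ccvg_nsq fl).
case: fl => a b.
have E (z : R[i]) : z^-1 = (complex.Re z / nsq z) +i* - (complex.Im z / nsq z).
  by case: z.
split.
  have -> : (fun t => complex.Re (f t)^-1) = (fun t => complex.Re (f t) * (nsq (f t))^-1).
    by apply/funext => t; rewrite E.
  by rewrite [l^-1]E; exact: cvgM.
have -> : (fun t => complex.Im (f t)^-1) = (fun t => - (complex.Im (f t) * (nsq (f t))^-1)).
  by apply/funext => t; rewrite E.
by rewrite [l^-1]E; apply: cvgN; exact: cvgM.
Qed.

End ComplexLimits.

(** * Real hyperbolic distance, geodesic rays and their ends *)

Section HyperbolicDistance.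
Variable R : realType.
Implicit Types (z w P x : disc R).

Lemma hdist_arcosh z w : hdist z w = arcosh (2 * cosh2_half_dist z w - 1).
Proof.
rewrite /hdist cosh2E nsq_form !nsq_normc; congr arcosh.
by field; rewrite !gt_eqF ?subr_gt0 ?disc_nsq.
Qed.

(** The number t + sqrt(t^2 - 1) lies between t, which is at least c, and 2t, which is at most
    4c. *)
Lemma arcosh_bounds (c : R) : 1 <= c -> ln c <= arcosh (2 * c - 1) <= ln (4 * c).
Proof.
move=> c1; rewrite /arcosh; set t := 2 * c - 1; set s := Num.sqrt _.
have t1 : 1 <= t by rewrite /t; lra.
have s0 : 0 <= s by exact: sqrtr_ge0.
have s2 : s ^+ 2 = t ^+ 2 - 1 by rewrite sqr_sqrtr // subr_ge0 expr_ge1 //; lra.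
have st : s <= t.
  rewrite -(@ler_pXn2r _ 2) ?nnegrE //; last by lra.
  by rewrite s2; lra.
have tE : t = 2 * c - 1 by [].
move: s0 st {s2}; move: (s) => s' s0 st; clearbody s t.
by apply/andP; split; rewrite ler_ln ?posrE; lra.
Qed.

Lemma arcosh_lt (t t' : R) : 1 <= t -> t < t' -> arcosh t < arcosh t'.
Proof.
move=> t1 tt; rewrite /arcosh.
have s0 := sqrtr_ge0 (t ^+ 2 - 1).
have : Num.sqrt (t ^+ 2 - 1) <= Num.sqrt (t' ^+ 2 - 1).
  by apply: ler_wsqrtr; rewrite lerD2r; nra.
by move=> h; rewrite ltr_ln ?posrE; lra.
Qed.

Lemma hdist_bounds z w :
  ln (cosh2_half_dist z w) <= hdist z w <= ln (4 * cosh2_half_dist z w).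
Proof. by rewrite hdist_arcosh arcosh_bounds // cosh2_ge1 // disc_nsq. Qed.

Lemma hdist_ge0 z w : 0 <= hdist z w.
Proof.
have /andP[h _] := hdist_bounds z w; apply: le_trans h; apply: ln_ge0.
by apply: cosh2_ge1; exact: disc_nsq.
Qed.

Lemma hdist_le_cosh2 z w z' w' : hdist z w <= hdist z' w' ->
  cosh2_half_dist z w <= cosh2_half_dist z' w'.
Proof.
rewrite !hdist_arcosh; apply: contraTT; rewrite -!ltNge => h.
apply: arcosh_lt; last by lra.
by have := cosh2_ge1 (disc_nsq z') (disc_nsq w'); lra.
Qed.

(** Once denominators are cleared the factor [1 - nsq w] cancels, and the result still makes sense
    when [w] tends to the circle. *)
Lemma cosh2_horo x P w : cosh2_half_dist x w <= cosh2_half_dist P w -> horo_le x P w.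
Proof.
rewrite !cosh2E /horo_le.
have h (y : disc R) : 0 < 1 - nsq y by rewrite subr_gt0 disc_nsq.
have := h x; have := h P; have := h w.
move: (nsq _) (nsq _) (1 - nsq w) (1 - nsq P) (1 - nsq x) => a b c d e c0 d0 e0 {h}.
rewrite ler_pdivrMr ?mulr_gt0 // mulrAC ler_pdivlMr ?mulr_gt0 //.
rewrite [X in X <= _]mulrCA [X in _ <= X]mulrCA.
by rewrite !(mulrA, mulrC _ c) => h; nra.
Qed.

Lemma ray_end_props P x (xi : R[i]) : is_ray_end P x xi -> nsq xi = 1 /\ horo_le x P xi.
Proof.
move=> [c [c0 cd ciso lre lim]].
have cc : ccvg (pinfty_nbhs R) (fun t => disc_val (c t)) xi by split.
have form (y : R[i]) : (fun t => nsq (1 - conjc y * c t)) @ +oo --> nsq (1 - conjc y * xi).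
  apply: ccvg_nsq; apply: ccvgD; first exact: ccvg_cst.
  rewrite -mulNr; have -> : (fun t => - (conjc y * disc_val (c t))) = (fun t => - conjc y * c t).
    by apply/funext => t; rewrite mulNr.
  by apply: ccvgM => //; exact: ccvg_cst.
have d0 := hdist_ge0 P x.
have h0 t : 0 <= t -> hdist P (c t) = t.
  by move=> t0; rewrite -{1}c0 ciso // sub0r normrN ger0_norm.
have n1 : (fun t => 1 - nsq (c t)) @ +oo --> 1 - nsq xi.
  by apply: cvgB; [exact: cvg_cst|exact: ccvg_nsq].
split; last first.
  apply: ler_cvg_to (cvgM (form x) (cvg_cst _)) (cvgM (form P) (cvg_cst _)) _.
  (* Beyond [x] on the ray, the distance to [x] is [t - hdist P x], at most the distance [t] to
     [P]. *)
  near=> t; have td : hdist P x <= t by near: t; apply: nbhs_pinfty_ge; exact: num_real.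
  have t0 := le_trans d0 td.
  apply: cosh2_horo; apply: hdist_le_cosh2; rewrite h0 // -{1}cd ciso //.
  by rewrite distrC ger0_norm ?subr_ge0 // lerBlDr lerDl.
(* The constant 16 is the 4 of [hdist_bounds] times the 4 of [form_le4]. *)
pose K := 16 / (1 - nsq P).
have P0 : 0 < 1 - nsq P by rewrite subr_gt0 disc_nsq.
suff n0 : (fun t => 1 - nsq (c t)) @ +oo --> (0 : R).
  by apply/eqP; rewrite eq_sym -subr_eq0; apply/eqP; exact: (cvg_unique _ n1 n0).
apply: (@squeeze_cvgr _ _ _ _ (fun=> 0) (fun t => K * expR (- t))).
- near=> t; have t0 : 0 <= t by near: t; apply: nbhs_pinfty_ge; exact: num_real.
  have w0 : 0 < 1 - nsq (c t) by rewrite subr_gt0 disc_nsq.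
  rewrite (ltW w0) /=.
  have /andP[_] := hdist_bounds P (c t); rewrite h0 // -ler_expR lnK; last first.
    rewrite posrE mulr_gt0 // (lt_le_trans ltr01) // cosh2_ge1 // disc_nsq //.
  rewrite cosh2E => h.
  have f4 := form_le4 (ltW (disc_nsq P)) (ltW (disc_nsq (c t))).
  rewrite expRN /K -mulrA -invfM ler_pdivlMr ?mulr_gt0 ?expR_gt0 // mulrA mulrC.
  rewrite -ler_pdivlMr ?mulr_gt0 // (le_trans h) //.
  rewrite [_ * (1 - nsq P)]mulrC mulrA ler_pM2r ?invr_gt0 ?mulr_gt0 //.
  by have := f4; lra.
- exact: cvg_cst.
- rewrite -[X in _ --> X](mulr0 K); apply: cvgM; first exact: cvg_cst.
  exact: cvgr_expR.
Unshelve. all: by end_near.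
Qed.

(* [rho t] is tanh (t / 2), the Euclidean radius of the point at distance t. *)
Definition rho (t : R) : R := (expR t - 1) / (expR t + 1).

Lemma rho_den (t : R) : 0 < expR t + 1. Proof. by rewrite addr_gt0 ?expR_gt0. Qed.

Lemma rho_sqr t : 1 - rho t ^+ 2 = 4 * expR t / (expR t + 1) ^+ 2.
Proof. by rewrite /rho; field; rewrite gt_eqF ?rho_den. Qed.

Lemma rho_sqr_lt1 t : rho t ^+ 2 < 1.
Proof.
by rewrite -subr_gt0 rho_sqr divr_gt0 ?mulr_gt0 ?expR_gt0 ?exprn_gt0 ?rho_den.
Qed.

(** With S and T the exponentials of s and t, the argument simplifies to (S^2 + T^2) / (2ST), which
    is cosh(t - s): [rho] has unit speed. *)
Lemma arcosh_ray s t : s <= t ->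
  arcosh (2 * ((1 - rho s * rho t) ^+ 2 / ((1 - rho s ^+ 2) * (1 - rho t ^+ 2))) - 1) = t - s.
Proof.
move=> st; rewrite !rho_sqr.
have S0 := expR_gt0 s; have T0 := expR_gt0 t.
have ST : expR s <= expR t by rewrite ler_expR.
have := rho_den s; have := rho_den t; rewrite /rho.
rewrite -[RHS]expRK expRB; move: (expR s) (expR t) S0 T0 ST => S T S0 T0 ST t0 s0.
rewrite /arcosh.
have -> : 2 * ((1 - (S - 1) / (S + 1) * ((T - 1) / (T + 1))) ^+ 2 /
   (4 * S / (S + 1) ^+ 2 * (4 * T / (T + 1) ^+ 2))) - 1 = (S ^+ 2 + T ^+ 2) / (2 * S * T).
  by field; rewrite !gt_eqF.
have -> : ((S ^+ 2 + T ^+ 2) / (2 * S * T)) ^+ 2 - 1 = ((T ^+ 2 - S ^+ 2) / (2 * S * T)) ^+ 2.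
  by field; rewrite !gt_eqF.
rewrite sqrtr_sqr ger0_norm; last first.
  by rewrite divr_ge0 ?mulr_ge0 ?(ltW S0) ?(ltW T0) // subr_ge0 lerXn2r // nnegrE ltW.
by congr ln; field; rewrite !gt_eqF.
Qed.

Lemma cvg_rho : rho t @[t --> +oo] --> (1 : R).
Proof.
have -> : rho = fun t => 1 - 2 * (expR t + 1)^-1.
  by apply/funext => t; rewrite /rho; field; rewrite gt_eqF ?rho_den.
rewrite -[X in _ --> X]subr0; apply: cvgB; first exact: cvg_cst.
rewrite -[X in _ --> X](mulr0 2); apply: cvgM; first exact: cvg_cst.
apply: (@squeeze_cvgr _ _ _ _ (fun=> 0) (fun t => expR (- t))).
- apply: filterE => t; rewrite invr_ge0 ltW ?rho_den //= expRN.
  by rewrite lef_pV2 ?posrE ?rho_den ?expR_gt0 // lerDl.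
- exact: cvg_cst.
- exact: cvgr_expR.
Qed.

(** The map [f] takes the centre to [P]; the ray is the image of the radius through the preimage [z]
    of [x], parametrised by [rho]. *)
Lemma ray_end_exists P x : P != x -> exists xi, is_ray_end P x xi.
Proof.
move=> Px.
have ab : nsq (P : R[i]) < nsq (1 : R[i]) by rewrite nsq1 disc_nsq.
pose f := mob 1 (disc_val P).
pose z := mob (conjc 1) (- disc_val P) x.
have fz : f z = x by apply: mobK => //; exact/ltW/disc_nsq.
have f0 : f 0 = P by rewrite /f /mob /mobN /mobD !mulr0 !add0r conjc1 divr1.
have z1 : nsq z < 1 by apply: mob_disc (disc_nsq x); rewrite nsqN nsqJ.
have z0 : z != 0.
  by apply/eqP => E; move/eqP: Px; apply; apply: val_inj; rewrite /= -[RHS]fz E f0.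
pose r := Normc.normc z.
have r2 : r ^+ 2 = nsq z by exact: nsq_normc.
have r0 : 0 < r.
  rewrite lt_def; apply/andP; split; last by rewrite /r; case: (z) => ? ?; exact: sqrtr_ge0.
  by rewrite -sqrf_eq0 r2 nsq_eq0.
have r1 : r < 1 by rewrite -r2 in z1; nra.
pose e := z * (r^-1)%:C.
have e1 : nsq e = 1 by rewrite nsqM nsqC exprVn r2 mulfV // nsq_eq0.
have ze : z = r%:C * e by rewrite /e mulrCA -rmorphM /= mulfV ?mulr1 // gt_eqF.
have nsqe t : nsq ((rho t)%:C * e) = rho t ^+ 2 by rewrite nsqM e1 mulr1 nsqC.
have n1 t : nsq ((rho t)%:C * e) < 1 by rewrite nsqe rho_sqr_lt1.
have hc t : in_disc (f ((rho t)%:C * e)) by exact: mob_disc.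
pose c t := Disc (hc t).
have ciso s t : hdist (c s) (c t) = `|s - t|.
  wlog st : s t / s <= t.
    move=> W; case: (leP s t) => [|/ltW] h; first exact: W.
    by rewrite hdist_arcosh cosh2_sym -hdist_arcosh distrC; exact: W.
  have E : 1 - conjc ((rho s)%:C * e) * ((rho t)%:C * e) = (1 - rho s * rho t)%:C.
    have ee : conjc e * e = 1 by rewrite mulJc e1.
    by rewrite conjMr mulrACA ee mulr1 -[1 in LHS]/(1%:C) -rmorphM -rmorphB.
  rewrite hdist_arcosh /c cosh2_mob // cosh2E E nsqC !nsqe.
  by rewrite arcosh_ray // distrC ger0_norm // subr_ge0.
have c0 : c 0 = P by apply: val_inj; rewrite /= /rho expR0 subrr mul0r mul0r f0.
pose t0 := ln ((1 + r) / (1 - r)).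
have q1 : 1 <= (1 + r) / (1 - r) by rewrite ler_pdivlMr; lra.
have rt0 : rho t0 = r.
  rewrite /rho /t0 lnK ?posrE; last by lra.
  by field; rewrite !gt_eqF //; lra.
have ct0 : c t0 = x by apply: val_inj; rewrite /= rt0 -ze fz.
have dPx : hdist P x = t0.
  by rewrite -{1}c0 -ct0 ciso sub0r normrN ger0_norm // ln_ge0.
exists (f e), c; rewrite dPx.
have [l1 l2] : ccvg (pinfty_nbhs R) (fun t => disc_val (c t)) (f e).
  have cr : ccvg (pinfty_nbhs R) (fun t => (rho t)%:C * e) e.
    rewrite -[X in ccvg _ _ X]mul1r; apply: ccvgM; last exact: ccvg_cst.
    by split; [exact: cvg_rho|exact: cvg_cst].
  apply: ccvgM.
    by apply: ccvgD; [apply: ccvgM => //; exact: ccvg_cst|exact: ccvg_cst].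
  apply: ccvgV; first by rewrite mobD_neq0 // e1.
  by apply: ccvgD; [apply: ccvgM => //; exact: ccvg_cst|exact: ccvg_cst].
by split.
Qed.

Lemma ray_endP P x : P != x -> is_ray_end P x (ray_end P x).
Proof.
move=> /ray_end_exists[xi h]; rewrite /ray_end.
by case: xgetP => [y _ //|/(_ xi)]; case.
Qed.

End HyperbolicDistance.

(** * From the cone to the tree *)

Section ComplexRepresentatives.
Variables (R : realType) (u : npultrafilter) (lam : nat -> R) (F : seq_field u lam).
Hypothesis hlam : lam @ \oo --> +oo.
Implicit Types (z w : nat -> R[i]) (h g : F[i]).

Definition repC z h :=
  rep F (fun k => complex.Re (z k)) (complex.Re h) /\
  rep F (fun k => complex.Im (z k)) (complex.Im h).

Lemma repC_ext z w h : (\forall k \near ult_sets u, z k = w k) -> repC z h -> repC w h.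
Proof.
move=> E [a b]; split; [apply: rep_ext a|apply: rep_ext b]; apply: filterS E => k -> //.
Qed.
Lemma repC_fun z h g : repC z h -> repC z g -> h = g.
Proof.
case: h g => h1 h2 [g1 g2] [/= a b] [/= c d].
by rewrite (rep_fun a c) (rep_fun b d).
Qed.
Lemma repCD z w h g : repC z h -> repC w g -> repC (fun k => z k + w k) (h + g).
Proof.
move=> [a b] [c d]; split.
  have -> : (fun k => complex.Re (z k + w k)) = (fun k => complex.Re (z k) + complex.Re (w k)).
    by apply/funext => t; case: (z t) (w t) => ? ? [].
  by case: h g a b c d => ? ? [? ?] a b c d; exact: repD.
have -> : (fun k => complex.Im (z k + w k)) = (fun k => complex.Im (z k) + complex.Im (w k)).
  by apply/funext => t; case: (z t) (w t) => ? ? [].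
by case: h g a b c d => ? ? [? ?] a b c d; exact: repD.
Qed.
Lemma repCM z w h g : repC z h -> repC w g -> repC (fun k => z k * w k) (h * g).
Proof.
move=> [a b] [c d]; split.
  have -> : (fun k => complex.Re (z k * w k)) = (fun k =>
      complex.Re (z k) * complex.Re (w k) - complex.Im (z k) * complex.Im (w k)).
    by apply/funext => t; case: (z t) (w t) => ? ? [].
  by case: h g a b c d => ? ? [? ?] a b c d; apply: repB; exact: repM.
have -> : (fun k => complex.Im (z k * w k)) = (fun k =>
    complex.Re (z k) * complex.Im (w k) + complex.Im (z k) * complex.Re (w k)).
  by apply/funext => t; case: (z t) (w t) => ? ? [].
by case: h g a b c d => ? ? [? ?] a b c d; apply: repD; exact: repM.
Qed.
Lemma repCN z h : repC z h -> repC (fun k => - z k) (- h).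
Proof.
move=> [a b]; split.
  have -> : (fun k => complex.Re (- z k)) = (fun k => - complex.Re (z k)).
    by apply/funext => t; case: (z t).
  by case: h a b => ? ? a b; exact: repN.
have -> : (fun k => complex.Im (- z k)) = (fun k => - complex.Im (z k)).
  by apply/funext => t; case: (z t).
by case: h a b => ? ? a b; exact: repN.
Qed.
Lemma repC_conj z h : repC z h -> repC (fun k => conjc (z k)) (conjc h).
Proof.
move=> [a b]; split.
  have -> : (fun k => complex.Re (conjc (z k))) = (fun k => complex.Re (z k)).
    by apply/funext => t; case: (z t).
  by case: h a b.
have -> : (fun k => complex.Im (conjc (z k))) = (fun k => - complex.Im (z k)).
  by apply/funext => t; case: (z t).
by case: h a b => ? ? a b; exact: repN.
Qed.
Lemma repC1 : repC (fun=> 1) 1.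
Proof. by split; [exact: rep1|exact: rep0]. Qed.
Lemma rep_nsq z h : repC z h -> rep F (fun k => nsq (z k)) (nsq h).
Proof. by move=> [a b]; apply: repD; exact: repX. Qed.
Lemma repCV z h : repC z h -> h != 0 -> repC (fun k => (z k)^-1) h^-1.
Proof.
move=> zh h0; have n0 : nsq h != 0 by rewrite nsq_eq0.
have nV := repV (rep_nsq zh) n0; case: zh => a b.
have E (K : rcfType) (x : K[i]) :
    x^-1 = (complex.Re x / nsq x) +i* - (complex.Im x / nsq x) by case: x.
split.
  have -> : (fun k => complex.Re (z k)^-1) = (fun k => complex.Re (z k) * (nsq (z k))^-1).
    by apply/funext => t; rewrite E.
  by rewrite [h^-1]E; exact: repM.
have -> : (fun k => complex.Im (z k)^-1) = (fun k => - (complex.Im (z k) * (nsq (z k))^-1)).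
  by apply/funext => t; rewrite E.
by rewrite [h^-1]E; apply: repN; exact: repM.
Qed.
Lemma repCB z w h g : repC z h -> repC w g -> repC (fun k => z k - w k) (h - g).
Proof. by move=> a b; apply: repCD => //; exact: repCN. Qed.

Lemma repC_exists h : exists z, repC z h.
Proof.
have [x xh] := rep_exists (complex.Re h); have [y yh] := rep_exists (complex.Im h).
by exists (fun k => x k +i* y k); split.
Qed.

Lemma repC_bounded z : (\forall k \near ult_sets u, nsq (z k) <= 1) ->
  exists2 h, repC z h & nsq h <= 1.
Proof.
move=> z1.
have le1 (x y : R) : x ^+ 2 + y ^+ 2 <= 1 -> `|x| <= 1.
  move=> h; rewrite -(@expr_le1 _ 2) // real_normK ?num_real //.
  by apply: le_trans h; rewrite lerDl sqr_ge0.
have [a ha] : exists a, rep F (fun k => complex.Re (z k)) a.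
  by apply: rep_bounded (rep1 F) _; apply: filterS z1 => k /le1.
have [b hb] : exists b, rep F (fun k => complex.Im (z k)) b.
  by apply: rep_bounded (rep1 F) _; apply: filterS z1 => k; rewrite /nsq addrC => /le1.
have h : repC z (a +i* b) by split.
by exists (a +i* b) => //; apply: rep_le (rep_nsq h) (rep1 F) _.
Qed.

Lemma rep_mob (al be z : nat -> R[i]) (al' be' z' : F[i]) : nsq be' < nsq al' -> nsq z' <= 1 ->
  repC al al' -> repC be be' -> repC z z' ->
  repC (fun k => mob (al k) (be k) (z k)) (mob al' be' z').
Proof.
move=> ab z1 ha hb hz; apply: repCM.
  by apply: repCD => //; exact: repCM.
apply: repCV; last exact: mobD_neq0.
by apply: repCD; [apply: repCM => //|]; exact: repC_conj.
Qed.

Lemma rep_psl_act (A : nat -> PSL2 R) (B : SL2 F) (z : nat -> disc R) (w : disc F) :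
  (forall i j, rep F (fun k => sl2_mx (pslrepr (A k)) i j) (sl2_mx B i j)) ->
  repC (fun k => disc_val (z k)) w ->
  repC (fun k => disc_val (psl_act (A k) (z k))) (psl_act (pslclass B) w).
Proof.
move=> AB zw; have -> : (fun k => disc_val (psl_act (A k) (z k))) =
    (fun k => mob (mal (pslrepr (A k))) (mbe (pslrepr (A k))) (z k)).
  by apply/funext => k; rewrite psl_act_mob.
rewrite psl_actE mobiusE ?disc_nsq //; apply: rep_mob => //.
- exact: mal_gt_mbe.
- exact/ltW/disc_nsq.
- by split; [apply: repD|apply: repB]; exact: AB.
- by split; [apply: repB|apply: repN; apply: repD]; exact: AB.
Qed.

Lemma rep_horo (x P xi : nat -> R[i]) (x' P' xi' : F[i]) :
  repC x x' -> repC P P' -> repC xi xi' ->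
  (\forall k \near ult_sets u, horo_le (x k) (P k) (xi k)) -> horo_le x' P' xi'.
Proof.
move=> hx hP hxi; apply: rep_le; (apply: repM; last by apply: repB (rep1 F) _; exact: rep_nsq).
  by apply: rep_nsq; apply: repCB repC1 _; apply: repCM => //; exact: repC_conj.
by apply: rep_nsq; apply: repCB repC1 _; apply: repCM => //; exact: repC_conj.
Qed.

(** Only strict inequalities descend from the field to almost every index, hence the assumption of a
    nonzero sign. *)
Lemma rep_cyclic_sign (x y z : nat -> R[i]) (x' y' z' : F[i]) :
  repC x x' -> repC y y' -> repC z z' -> cyclic_sign x' y' z' != 0 ->
  \forall k \near ult_sets u, cyclic_sign (x k) (y k) (z k) = cyclic_sign x' y' z'.
Proof.
move=> hx hy hz; rewrite cyclic_signE sgz_eq0 => n0.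
have hc : rep F (fun k => cyc (x k) (y k) (z k)) (cyc x' y' z').
  have [a b] := repCB hy hx; have [c d] := repCB hz hy.
  by apply: repB; apply: repM.
have [c0|c0|c0] := ltgtP (cyc x' y' z') 0; last by rewrite c0 eqxx in n0.
  have := rep_lt hc (rep0 F) c0; apply: filterS => k h.
  by rewrite cyclic_signE !ltr0_sgz.
have := rep_lt (rep0 F) hc c0; apply: filterS => k h.
by rewrite cyclic_signE !gtr0_sgz.
Qed.

End ComplexRepresentatives.
Arguments repC {R u lam} F z h.

(** * Cone distances computed over the field *)

Section ConeIsometry.
Variables (R : realType) (u : npultrafilter) (lam : nat -> R) (F : seq_field u lam).
Hypothesis hlam : lam @ \oo --> +oo.
Local Notation L := (logmu R (sf_mu F)).
Implicit Types (z : cone_seq u lam).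

(** A class of disc points might lie on the circle. A distance to the centre of at most [n * lam k]
    forces [1 - nsq (z k)] above the power [- n] of [mu], which keeps the class inside. *)
Lemma cone_seq_rep z : exists w : disc F, repC F (fun k => disc_val (z k)) w.
Proof.
have [|h zh h1] := @repC_bounded _ _ _ F (fun k => disc_val (z k)).
  by apply: filterE => k; exact/ltW/disc_nsq.
suff hd : in_disc h by exists (Disc hd).
have /asboolP[C hC] := valP z.
pose n := (Num.truncn C).+1.
suff : sf_mu F ^ (- n%:Z) <= 1 - nsq h.
  move=> le; rewrite /in_disc -/(nsq _) -subr_gt0; apply: lt_le_trans le.
  exact/exprz_gt0/mu_gt0.
apply: rep_le (rep_muz F (- n%:Z)) (repB (rep1 F) (rep_nsq zh)) _.
near=> k.
have l0 : 0 < lam k by near: k; exact: near_lam_gt.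
have : `|hdist (z k) (disc0 R) / lam k| <= C by near: k.
have E0 : disc_val (disc0 R) = 0 by [].
have /andP[lo _] := hdist_bounds (z k) (disc0 R).
have w0 : 0 < 1 - nsq (z k) by rewrite subr_gt0 disc_nsq.
move: lo; rewrite cosh2E E0 mulr0 subr0 nsq1 nsq0 subr0 mulr1 div1r lnV // => lo hk.
have : hdist (z k) (disc0 R) / lam k <= n%:R.
  by apply: le_trans (ler_norm _) _; apply: le_trans hk _; apply/ltW/truncnS_gt.
rewrite ler_pdivrMr // => hn.
rewrite mu_seqz -[leRHS]lnK // ler_expR mulrNz mulNr.
by rewrite -[(n%:Z)%:~R]/(n%:R : R); lra.
Unshelve. all: by end_near.
Qed.

Lemma rep_cosh2 (z z' : nat -> disc R) (w w' : disc F) :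
  repC F (fun k => disc_val (z k)) w -> repC F (fun k => disc_val (z' k)) w' ->
  rep F (fun k => cosh2_half_dist (z k) (z' k)) (cosh2_half_dist w w').
Proof.
move=> h h'; have -> : (fun k => cosh2_half_dist (z k) (z' k)) = (fun k =>
    nsq (1 - conjc (z k) * z' k) / ((1 - nsq (z k)) * (1 - nsq (z' k)))).
  by apply/funext => k; rewrite cosh2E.
rewrite cosh2E; apply: repM.
  by apply: rep_nsq; apply: repCB (repC1 F) _; apply: repCM => //; exact: repC_conj.
apply: repV; last by rewrite gt_eqF // mulr_gt0 // subr_gt0 disc_nsq.
by apply: repM; apply: repB (rep1 F) _; exact: rep_nsq.
Qed.

Lemma hdist_cvg (z z' : nat -> disc R) (w w' : disc F) :
  repC F (fun k => disc_val (z k)) w -> repC F (fun k => disc_val (z' k)) w' ->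
  (fun k => hdist (z k) (z' k) / lam k) @ ult_sets u --> gdist w w'.
Proof.
move=> h h'; have hc := rep_cosh2 h h'.
have c0 : 0 < cosh2_half_dist w w'.
  by apply: lt_le_trans ltr01 _; apply: cosh2_ge1; exact: disc_nsq.
have lc := logmu_cvg hlam hc c0.
have uc : (fun k => ln (cosh2_half_dist (z k) (z' k)) / lam k + ln 4 / lam k)
    @ ult_sets u --> L (cosh2_half_dist w w').
  by rewrite -[X in _ --> X]addr0; apply: cvgD lc _; exact: cvg_divlam.
apply: squeeze_cvgr _ _ lc uc.
apply: filterS (near_lam_gt u hlam 0) => k l0.
have /andP[lo up] := hdist_bounds (z k) (z' k).
have d0 : 0 < cosh2_half_dist (z k) (z' k).
  by apply: lt_le_trans ltr01 _; apply: cosh2_ge1; exact: disc_nsq.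
rewrite ler_pM2r ?invr_gt0 // lo -mulrDl ler_pM2r ?invr_gt0 //.
by rewrite addrC -lnM ?posrE.
Qed.

(** Conversely, the rescaled distances to the centre converge, hence are bounded almost surely. *)
Lemma cone_bounded_rep (z : nat -> disc R) (w : disc F) :
  repC F (fun k => disc_val (z k)) w -> cone_bounded u lam z.
Proof.
move=> zw; have z0 : repC F (fun=> disc_val (disc0 R)) (disc0 F).
  by split; exact: rep0.
have /cvgrPdist_lt/(_ 1 ltr01) h := hdist_cvg zw z0.
apply/asboolP; exists (`|gdist w (disc0 F)| + 1); apply: filterS h => k h.
rewrite -[X in `|X|](subrK (gdist w (disc0 F))) addrC.
by apply: le_trans (ler_normD _ _) _; rewrite lerD2l distrC ltW.
Qed.

Lemma cone_distE z z' (w w' : disc F) :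
  repC F (fun k => disc_val (z k)) w -> repC F (fun k => disc_val (z' k)) w' ->
  cone_dist z z' = gdist w w'.
Proof. by move=> h h'; apply: cvg_lim => //; exact: hdist_cvg. Qed.

(** The pseudo-metric axioms in the cone are inherited from [gdist] through representatives. *)
Lemma cone_distxx z : cone_dist z z = 0.
Proof. by have [w h] := cone_seq_rep z; rewrite (cone_distE h h) gdistxx. Qed.
Lemma cone_dist_sym z z' : cone_dist z z' = cone_dist z' z.
Proof.
have [w h] := cone_seq_rep z; have [w' h'] := cone_seq_rep z'.
by rewrite (cone_distE h h') gdist_sym (cone_distE h' h).
Qed.
Lemma cone_dist_triangle z1 z2 z3 : cone_dist z1 z3 <= cone_dist z1 z2 + cone_dist z2 z3.
Proof.
have [w1 h1] := cone_seq_rep z1; have [w2 h2] := cone_seq_rep z2.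
have [w3 h3] := cone_seq_rep z3.
by rewrite (cone_distE h1 h3) (cone_distE h1 h2) (cone_distE h2 h3) gdist_triangle.
Qed.

End ConeIsometry.

(** * The isometry from the cone to the tree, its equivariance and surjectivity *)

Section Tree.
Variables (R : realType) (u : npultrafilter) (lam : nat -> R) (F : seq_field u lam).
Hypothesis hlam : lam @ \oo --> +oo.

(** The quotient [robtree] over the interface; for [rob_field] the two are convertible. *)
Definition tree := mquot (@gdist R u lam F).
Definition tree_class (a : disc F) : tree := mclass (@gdist R u lam F) a.
Definition tree_dist : tree -> tree -> R := Defs.mdist (d := @gdist R u lam F).

Lemma tree_class_eq a b : tree_class a = tree_class b <-> gdist a b = 0.
Proof.
by apply: mclass_eq; [exact: gdistxx|exact: gdist_sym|exact: gdist_triangle].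
Qed.
Lemma tree_distE a b : tree_dist (tree_class a) (tree_class b) = gdist a b.
Proof.
by apply: mdistE; [exact: gdistxx|exact: gdist_sym|exact: gdist_triangle].
Qed.
Lemma tree_surj (A : PSL2 F) (q : tree) : exists a, q = tree_class (psl_act A a).
Proof.
have [a E _] := psl_act_preim A (mrepr q); exists a.
by rewrite E /tree_class mreprK.
Qed.

Lemma cone_class_eq z z' :
  mclass (@cone_dist R u lam) z = mclass (@cone_dist R u lam) z' <-> cone_dist z z' = 0.
Proof.
by apply: mclass_eq; [exact: (cone_distxx F)|exact: (cone_dist_sym F)|exact: (cone_dist_triangle F)].
Qed.
Lemma cone_mdistE z z' :
  cone_mdist (mclass (@cone_dist R u lam) z) (mclass (@cone_dist R u lam) z') = cone_dist z z'.
Proof.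
by apply: mdistE; [exact: (cone_distxx F)|exact: (cone_dist_sym F)|exact: (cone_dist_triangle F)].
Qed.

Definition seq_point (z : cone_seq u lam) : disc F := sval (cid (cone_seq_rep F hlam z)).
Lemma seq_pointP (z : cone_seq u lam) : repC F (fun k => disc_val (z k)) (seq_point z).
Proof. exact: (svalP (cid (cone_seq_rep F hlam z))). Qed.

Definition cone_to_tree (p : cone u lam) : tree := tree_class (seq_point (mrepr p)).

Lemma cone_to_tree_class (z : cone_seq u lam) (w : disc F) : repC F (fun k => disc_val (z k)) w ->
  cone_to_tree (mclass (@cone_dist R u lam) z) = tree_class w.
Proof.
move=> zw; apply/tree_class_eq; rewrite -(cone_distE hlam (seq_pointP _) zw).
by apply/cone_class_eq; rewrite mreprK.
Qed.

Lemma cone_to_tree_isom : distance_preserving (@cone_mdist R u lam) tree_dist cone_to_tree.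
Proof.
move=> p q; rewrite -[p]mreprK -[q]mreprK cone_mdistE.
rewrite !(cone_to_tree_class (seq_pointP _)) tree_distE.
by rewrite -(cone_distE hlam (seq_pointP _) (seq_pointP _)).
Qed.

Lemma cone_to_tree_act (Gam : groupType) (phi : nat -> {multiplicative Gam -> PSL2 R})
    (g : Gam) (B : SL2 F) p :
  (forall i j, rep F (fun k => sl2_mx (pslrepr (phi k g)) i j) (sl2_mx B i j)) ->
  cone_to_tree (cone_act phi g p) = tree_class (psl_act (pslclass B) (mrepr (cone_to_tree p))).
Proof.
move=> hB; have hz := rep_psl_act hB (seq_pointP (mrepr p)).
rewrite /cone_act (cone_to_tree_class (w := psl_act (pslclass B) (seq_point (mrepr p)))).
  apply/tree_class_eq; rewrite gdist_psl; apply/tree_class_eq.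
  by rewrite /tree_class mreprK.
(* By [hz] the displaced sequence is bounded, so [insubd] does not fall back on its default. *)
apply: (repC_ext _ hz); apply: filterE => k; rewrite -[cseq _]/(val _) insubdK //.
exact: cone_bounded_rep hz.
Qed.

Lemma cone_to_tree_surj q : exists p, cone_to_tree p = q.
Proof.
have [z0 h0] := repC_exists (disc_val (mrepr q)).
(* Almost every term lies in the disc already; the others are replaced by the centre. *)
pose z k : disc R := insubd (disc0 R) (z0 k).
have h : repC F (fun k => disc_val (z k)) (mrepr q).
  apply: (repC_ext _ h0); apply: filterS (rep_lt (rep_nsq h0) (rep1 F) (disc_nsq _)) => k k1.
  by rewrite /z -[disc_val _]/(val _) insubdK.
exists (mclass (@cone_dist R u lam) (ConeSeq (cone_bounded_rep hlam h))).
by rewrite (cone_to_tree_class (w := mrepr q)) // /tree_class mreprK.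
Qed.

End Tree.

(** * Germs and orientations *)

Section ResidueCircle.
Variables (K : rcfType) (V : convex_subring K).
Implicit Types z w : K[i].

Definition reduceC z : (residue V)[i] :=
  reduce V (complex.Re z) +i* reduce V (complex.Im z).

(** The coordinates are bounded by 1, so convexity puts them in the ring and [reduce] takes no
    default value. *)
Lemma red_unit z : nsq z = 1 ->
  red (complex.Re z) (complex.Re (reduceC z)) /\ red (complex.Im z) (complex.Im (reduceC z)).
Proof.
move=> z1; have le1 (x : K) : x ^+ 2 <= 1 -> cs_ring V x.
  move=> h; apply: cs_convex (cs1 V).
  by rewrite normr1 -(@expr_le1 _ 2) // real_normK ?num_real.
split; apply: red_ring; apply: le1; rewrite -z1 /nsq.
  by rewrite lerDl sqr_ge0.
by rewrite lerDr sqr_ge0.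
Qed.

Lemma nsq_reduceC z : nsq z = 1 -> nsq (reduceC z) = 1.
Proof.
move=> z1; have [a b] := red_unit z1.
have /red_reduce <- : red (nsq z) (nsq (reduceC z)) by apply: redD; exact: redX.
by rewrite z1; apply: red_reduce; exact: red1.
Qed.

Lemma reduceC_eq z w : nsq z = 1 -> nsq w = 1 -> reduceC z = reduceC w <->
  cs_ideal V (complex.Re (z - w)) /\ cs_ideal V (complex.Im (z - w)).
Proof.
move=> z1 w1; have [a b] := red_unit z1; have [c d] := red_unit w1.
have -> : complex.Re (z - w) = complex.Re z - complex.Re w by case: (z) (w) => ? ? [].
have -> : complex.Im (z - w) = complex.Im z - complex.Im w by case: (z) (w) => ? ? [].
split=> [E|[/(redJ a c) /= e1 /(redJ b d) /= e2]]; last by rewrite /reduceC e1 e2.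
by split; [apply/(redJ a c)|apply/(redJ b d)]; rewrite E.
Qed.

(** Strict inequalities lift from the residue field, whereas a nonzero element may have residue
    0. *)
Lemma cyclic_sign_reduceC z1 z2 z3 : nsq z1 = 1 -> nsq z2 = 1 -> nsq z3 = 1 ->
  cyclic_sign (reduceC z1) (reduceC z2) (reduceC z3) != 0 ->
  cyclic_sign z1 z2 z3 = cyclic_sign (reduceC z1) (reduceC z2) (reduceC z3).
Proof.
move=> /red_unit[a1 b1] /red_unit[a2 b2] /red_unit[a3 b3].
have hc : red (cyc z1 z2 z3) (cyc (reduceC z1) (reduceC z2) (reduceC z3)).
  move: a1 b1 a2 b2 a3 b3; rewrite /cyc.
  case: (z1) (z2) (z3) (reduceC z1) (reduceC z2) (reduceC z3) => [x1 y1] [x2 y2] [x3 y3].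
  move=> [r1 s1] [r2 s2] [r3 s3] /= a1 b1 a2 b2 a3 b3.
  by apply: redD; [apply: redM|apply/redN/redM]; apply: redD => //; exact: redN.
rewrite !cyclic_signE sgz_eq0 => n0.
have [c0|c0|c0] := ltgtP (cyc (reduceC z1) (reduceC z2) (reduceC z3)) 0.
- by have h := red_lt hc (red0 V) c0; rewrite !ltr0_sgz.
- by have h := red_lt (red0 V) hc c0; rewrite !gtr0_sgz.
- by rewrite c0 eqxx in n0.
Qed.

End ResidueCircle.

(** * Germs in the tree as directions in a frame *)

Section TreeGerms.
Variables (R : realType) (u : npultrafilter) (lam : nat -> R) (F : seq_field u lam).
Hypothesis hlam : lam @ \oo --> +oo.
Local Notation tree := (tree F).
Local Notation tree_dist := (@tree_dist R u lam F).
Local Notation cdist := (@cone_mdist R u lam).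
Local Notation psi := (cone_to_tree F hlam).
Local Notation psi_isom := (cone_to_tree_isom F hlam).

Definition radial (A : PSL2 F) (v : F[i]) (p : tree) (c : segment tree_dist p) :=
  forall s, 0 <= s <= seg_len c -> exists (t : F) (z : disc F),
    [/\ 0 <= t < 1, disc_val z = t%:C * v & c s = tree_class (psl_act A z)].

Definition radial_germ (A : PSL2 F) (v : F[i]) (p : tree) (g : germ tree_dist p) :=
  exists2 c : segment tree_dist p, germ_of c = g & radial A v c.

Lemma tree_distxx (p : tree) : tree_dist p p = 0.
Proof. by have [a ->] := tree_surj 1%g p; rewrite (tree_distE hlam) gdistxx. Qed.

Lemma psi_inj p q : psi p = psi q -> p = q.
Proof.
move=> E; have := psi_isom p q; rewrite E tree_distxx => /esym.
rewrite -[p]mreprK -[q]mreprK (cone_mdistE F hlam) => h.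
exact/(cone_class_eq F hlam).
Qed.

Lemma germ_map_psi_inj (P : cone u lam) (g1 g2 : germ cdist P) :
  germ_map psi_isom g1 = germ_map psi_isom g2 -> g1 = g2.
Proof.
rewrite -[g1]germ_reprK -[g2]germ_reprK !germ_mapE => /germ_of_eq[e e0 h].
by apply/germ_of_eq; exists e => // t /h /psi_inj.
Qed.

Section Frame.
Variables (A : PSL2 F) (p : tree).
Hypothesis Ap : tree_class (psl_act A (disc0 F)) = p.
Implicit Types (c : segment tree_dist p) (a b : disc F).

Lemma seg_gdist c s t a b : 0 <= s <= seg_len c -> 0 <= t <= seg_len c ->
  c s = tree_class (psl_act A a) -> c t = tree_class (psl_act A b) -> gdist a b = `|s - t|.
Proof.
move=> hs ht ca cb; rewrite -(seg_isom hs ht) ca cb (tree_distE hlam).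
by rewrite gdist_psl.
Qed.

Lemma seg_depth c s a : 0 <= s <= seg_len c -> c s = tree_class (psl_act A a) -> depth a = s.
Proof.
move=> hs ca; have l0 := ltW (seg_len_gt0 c).
rewrite -(gdist0 hlam) (@seg_gdist c 0 s) ?lexx //.
  by move: hs => /andP[s0 _]; rewrite sub0r normrN ger0_norm.
by rewrite seg_start.
Qed.

(** The direction is that of a lift [a] of the endpoint; [radial_exists] moves each point of the
    segment onto its radius. *)
Lemma radial_seg_exists c : exists v : F[i], nsq v = 1 /\ radial A v c.
Proof.
have l0 := seg_len_gt0 c.
have hl : 0 <= seg_len c <= seg_len c by rewrite lexx ltW.
have [a ca] := tree_surj A (c (seg_len c)).
have da := seg_depth hl ca.
exists (disc_val a * ((Normc.normc a)^-1)%:C); split.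
  have := @radial_exists _ _ _ F hlam a a; rewrite da subrr gdistxx //.
  by case.
move=> s hs; have [b cb] := tree_surj A (c s).
have db := seg_depth hs cb; have dba := seg_gdist hs hl cb ca.
have sl : s <= seg_len c by case/andP: hs.
have [|||_ [t [q [t01 qE dq]]]] := @radial_exists _ _ _ F hlam a b.
- by rewrite da.
- by rewrite da db.
- by rewrite dba da db distrC ger0_norm ?subr_ge0.
exists t, q; split=> //; rewrite cb; apply/(tree_class_eq hlam).
by rewrite gdist_psl.
Qed.

Lemma radial_germ_exists (g : germ tree_dist p) :
  exists v : F[i], nsq v = 1 /\ radial_germ A v g.
Proof.
have [v [v1 r]] := radial_seg_exists (germ_repr g).
by exists v; split=> //; exists (germ_repr g) => //; exact: germ_reprK.
Qed.

(** At a small time [s] the two segments agree, so a point of the radius lies on the segment to [a];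
    [radial_close] then gives the exponent [- (s + s)]. *)
Lemma radial_end_close c c' (v : F[i]) a : nsq v = 1 -> radial A v c' ->
  germ_of c' = germ_of c -> c (seg_len c) = tree_class (psl_act A a) ->
  exists2 r, r < 0 & csmall (disc_val a - v) r.
Proof.
move=> v1 rc /germ_of_eq[e e0 cc] ca.
have l0 := seg_len_gt0 c; have l0' := seg_len_gt0 c'.
pose s := Num.min e (Num.min (seg_len c) (seg_len c')) / 2.
have m0 : 0 < Num.min e (Num.min (seg_len c) (seg_len c')) by rewrite !lt_min e0 l0.
have s0 : 0 < s by rewrite divr_gt0.
have : s < Num.min e (Num.min (seg_len c) (seg_len c')).
  by rewrite ltr_pdivrMr // ltr_pMr // ltr1n.
rewrite !lt_min => /and3P[se sl sl'].
have hs : 0 <= s <= seg_len c by rewrite !ltW.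
have hs' : 0 <= s <= seg_len c' by rewrite !ltW.
have hl : 0 <= seg_len c <= seg_len c by rewrite lexx ltW.
have [t [q [t01 qE cq]]] := rc s hs'.
have cs : c s = tree_class (psl_act A q) by rewrite -cq cc // ltW.
exists (- (s + s)); first by rewrite oppr_lt0 addr_gt0.
apply: (radial_close hlam v1 t01 qE); rewrite !(gdist0 hlam).
  exact: seg_depth hs cs.
rewrite (seg_depth hl ca) (seg_gdist hs hl cs ca) distrC ger0_norm // subr_ge0.
exact: ltW.
Qed.

(** By [radial_meet] the segments agree up to time [- r / 2], as time is depth in the frame. *)
Lemma radial_germ_eq c1 c2 (v1 v2 : F[i]) r : nsq v1 = 1 -> nsq v2 = 1 ->
  radial A v1 c1 -> radial A v2 c2 -> r < 0 -> csmall (v1 - v2) r ->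
  germ_of c1 = germ_of c2.
Proof.
move=> u1 u2 r1 r2 r0 hr; apply/germ_of_eq.
exists (Num.min (- r / 2) (Num.min (seg_len c1) (seg_len c2))).
  by rewrite !lt_min !seg_len_gt0 divr_gt0 // oppr_gt0.
move=> t /andP[t0]; rewrite !lt_min => /and3P[tr tl1 tl2].
have h1 : 0 <= t <= seg_len c1 by rewrite t0 ltW.
have h2 : 0 <= t <= seg_len c2 by rewrite t0 ltW.
have [a1 [q1 [a01 E1 cq1]]] := r1 t h1; have [a2 [q2 [a02 E2 cq2]]] := r2 t h2.
rewrite cq1 cq2; apply/(tree_class_eq hlam); rewrite gdist_psl.
apply: (radial_meet hlam u1 u2 a01 a02 E1 E2 (seg_depth h1 cq1) (seg_depth h2 cq2) hr).
by move: tr; rewrite ltr_pdivlMr // mulr_natr mulr2n => /ltW.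
Qed.

End Frame.

Section RayEnds.
Variables (A : PSL2 F) (P : cone u lam).
Hypothesis AP : tree_class (psl_act A (disc0 F)) = psi P.
Local Notation al := (mal (pslrepr A)).
Local Notation be := (mbe (pslrepr A)).

(* The sequence representing the endpoint of a segment of the germ, as chosen in
   the definition of the ultralimit orientation. *)
Local Notation endp g := (mrepr (seg_end (germ_repr g))).

(** The end [eta], transported to the frame, is close to the endpoint [x] by the horoball
    inequality, and [x] is close to [v] because the segments share a germ. *)
Lemma germ_ray_end (g : germ cdist P) (c : segment tree_dist (psi P)) (v : F[i]) :
  nsq v = 1 -> germ_of c = germ_map psi_isom g -> radial A v c ->
  exists eta : F[i], [/\ nsq eta = 1,
    repC F (fun k => ray_end (mrepr P k) (endp g k)) (mob al be eta) &
    exists2 r, r < 0 & csmall (eta - v) r].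
Proof.
move=> v1 cg rc.
pose s := germ_repr g; pose X := endp g.
have l0 := seg_len_gt0 s.
have hl : 0 <= seg_len s <= seg_len s by rewrite lexx ltW.
have h0 : 0 <= (0 : R) <= seg_len s by rewrite lexx ltW.
have psiX : psi (seg_end s) = tree_class (seq_point F hlam X) by [].
have psiP : psi P = tree_class (seq_point F hlam (mrepr P)) by [].
have [x Ax xE] := psl_act_preim A (seq_point F hlam X).
have [q Aq qE] := psl_act_preim A (seq_point F hlam (mrepr P)).
have hX := seq_pointP F hlam X; have hP := seq_pointP F hlam (mrepr P).
have dXP : gdist (seq_point F hlam (mrepr P)) (seq_point F hlam X) = seg_len s.
  rewrite -(tree_distE hlam) -psiP -psiX psi_isom /seg_end -{1}(seg_start s).
  by rewrite (seg_isom h0 hl) sub0r normrN gtr0_norm.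
(* Equality almost surely would make the distance 0, but it is the positive length of the segment;
   so the ray ends are genuine. *)
have ne : \forall k \near ult_sets u, mrepr P k != X k.
  have : \forall k \near ult_sets u, mrepr P k = X k \/ mrepr P k != X k.
    by apply: filterE => k; case: eqVneq; [left|right].
  case/npultra_or => // E; exfalso.
  have EX : repC F (fun k => disc_val (X k)) (seq_point F hlam (mrepr P)).
    by apply: (repC_ext _ hP); apply: filterS E => k ->.
  have E' : seq_point F hlam (mrepr P) = seq_point F hlam X.
    by apply: val_inj; exact: repC_fun EX hX.
  by move: dXP; rewrite E' gdistxx // => E2; move: l0; rewrite -E2 ltxx.
have props : \forall k \near ult_sets u,
    nsq (ray_end (mrepr P k) (X k)) = 1 /\
    horo_le (X k) (mrepr P k) (ray_end (mrepr P k) (X k)).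
  by apply: filterS ne => k /ray_endP/ray_end_props.
have [xi hxi xi_le] : exists2 xi, repC F (fun k => ray_end (mrepr P k) (X k)) xi & nsq xi <= 1.
  by apply: repC_bounded; apply: filterS props => k [-> _].
have xi1 : nsq xi = 1.
  apply: rep_fun (rep_nsq hxi) _; apply: (rep_ext _ (rep1 F)).
  by apply: filterS props => k [-> _].
have ho : horo_le (seq_point F hlam X) (seq_point F hlam (mrepr P)) xi.
  by apply: rep_horo hX hP hxi _; apply: filterS props => k [].
have ab := mal_gt_mbe (pslrepr A).
have ab' : nsq (- be) < nsq (conjc al) by rewrite nsqN nsqJ.
pose eta := mob (conjc al) (- be) xi.
have eta1 : nsq eta = 1 by exact: mob_unit.
have etaE : mob al be eta = xi by apply: mobK; rewrite ?xi1.
(* The lift [q] need not be the centre, but it has the same image in the tree. *)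
have dq : depth q = 0.
  rewrite -(gdist0 hlam) -(gdist_psl A) Aq; apply/(tree_class_eq hlam).
  by rewrite AP psiP.
have dx : depth x = seg_len s.
  rewrite -(gdist0 hlam) -(gdist_psl A) Ax -(tree_distE hlam) AP psiP.
  by rewrite (tree_distE hlam).
exists eta; split=> //; first by rewrite etaE.
have close : csmall (eta - disc_val x) (- depth x).
  apply: (horo_close hlam eta1 dq).
  apply: (@horo_le_mob _ al be); rewrite ?eta1 ?(ltW (disc_nsq _)) //.
  by rewrite etaE -!psl_act_mob Ax Aq.
have [r r0 hr] : exists2 r, r < 0 & csmall (disc_val x - v) r.
  apply: (radial_end_close AP v1 rc (c := seg_map psi_isom s)).
    by rewrite cg -germ_mapE germ_reprK.
  by rewrite Ax.
exists (Num.max r (- depth x)); first by rewrite gt_max r0 dx oppr_lt0.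
have -> : eta - v = (eta - disc_val x) + (disc_val x - v) by rewrite addrA subrK.
by apply: csmallD => //; [apply: csmall_weak close|apply: csmall_weak hr];
  rewrite le_max lexx ?orbT.
Qed.

Variable V : convex_subring F.
Hypothesis V_ideal : forall h : F, cs_ideal V h = (h == 0) || (logmu R (sf_mu F) `|h| < 0).

Lemma csmall_reduceC (z w : F[i]) r : nsq z = 1 -> nsq w = 1 -> r < 0 -> csmall (z - w) r ->
  reduceC V z = reduceC V w.
Proof.
move=> z1 w1 r0 /(csmall_lt0 hlam r0)[a b]; apply/reduceC_eq => //.
by rewrite !V_ideal.
Qed.

(** Equal residues mean directions close at a negative exponent, hence equal germs in the tree;
    [psi] is injective on germs. *)
Lemma radial_germ_inj v1 v2 (g1 g2 : germ cdist P) : nsq v1 = 1 -> nsq v2 = 1 ->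
  radial_germ A v1 (germ_map psi_isom g1) -> radial_germ A v2 (germ_map psi_isom g2) ->
  reduceC V v1 = reduceC V v2 -> g1 = g2.
Proof.
move=> u1 u2 [c1 e1 r1] [c2 e2 r2] /(reduceC_eq _ u1 u2); rewrite !V_ideal => -[a b].
have [r r0 hr] := lt0_csmall hlam a b.
by apply: germ_map_psi_inj; rewrite -e1 -e2; exact: (radial_germ_eq AP u1 u2 r1 r2 r0 hr).
Qed.

Lemma ultralimit_cyclic_sign (g1 g2 g3 : germ cdist P) (v1 v2 v3 : F[i]) :
  nsq v1 = 1 -> nsq v2 = 1 -> nsq v3 = 1 ->
  radial_germ A v1 (germ_map psi_isom g1) -> radial_germ A v2 (germ_map psi_isom g2) ->
  radial_germ A v3 (germ_map psi_isom g3) ->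
  or_ultralimit g1 g2 g3 = cyclic_sign (reduceC V v1) (reduceC V v2) (reduceC V v3).
Proof.
move=> u1 u2 u3 h1 h2 h3; rewrite /or_ultralimit.
(* Two directions of one germ have the same residue, both being close to the class of the same
   sequence of ray ends. *)
have eqv a b (g : germ cdist P) (ua : nsq a = 1) (ub : nsq b = 1) (ha : radial_germ A a (germ_map psi_isom g))
    (hb : radial_germ A b (germ_map psi_isom g)) : reduceC V a = reduceC V b.
  have [c ec rc] := ha; have [c' ec' rc'] := hb.
  have [eta [e1 re [r r0 hr]]] := germ_ray_end ua ec rc.
  have [eta' [e1' re' [r' r0' hr']]] := germ_ray_end ub ec' rc'.
  rewrite -(csmall_reduceC e1 ua r0 hr) -(csmall_reduceC e1' ub r0' hr').
  have E := repC_fun re re'.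
  have ab := mal_gt_mbe (pslrepr A).
  by rewrite -(mobVK ab (z := eta)) ?e1 // E mobVK ?e1'.
case: ifP => [/or3P[/eqP E|/eqP E|/eqP E]|].
- rewrite -E in h2; rewrite (eqv _ _ _ u1 u2 h1 h2) cyclic_signE /cyc !subrr /=.
  by rewrite !mul0r subrr sgz0.
- rewrite -E in h3; rewrite (eqv _ _ _ u2 u3 h2 h3) cyclic_signE /cyc !subrr /=.
  by rewrite !mulr0 subrr sgz0.
- rewrite -E in h3; rewrite (eqv _ _ _ u1 u3 h1 h3) cyclic_signE /cyc.
  move: (reduceC V v2) (reduceC V v3) => [x y] [x' y'] /=.
  have -> : (x - x') * (y' - y) - (y - y') * (x' - x) = 0 by ring.
  by rewrite sgz0.
move=> /negbT/norP[n12 /norP[n23 n13]].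
(* Distinct germs have distinct residues, and distinct points of the circle are never aligned; the
   nonzero sign can then be lifted to the field and to almost every index. *)
have cs0 : cyclic_sign (reduceC V v1) (reduceC V v2) (reduceC V v3) != 0.
  rewrite cyclic_signE sgz_eq0; apply/eqP => E.
  have /or3P[/eqP|/eqP|/eqP] := cyc_unit_eq0 (nsq_reduceC V u1) (nsq_reduceC V u2) (nsq_reduceC V u3) E.
  - by move=> /(radial_germ_inj u1 u2 h1 h2)/eqP; rewrite (negPf n12).
  - by move=> /(radial_germ_inj u2 u3 h2 h3)/eqP; rewrite (negPf n23).
  - by move=> /(radial_germ_inj u1 u3 h1 h3)/eqP; rewrite (negPf n13).
have [c1 ec1 rc1] := h1; have [c2 ec2 rc2] := h2; have [c3 ec3 rc3] := h3.
have [e1 [w1 re1 [r1 r10 hr1]]] := germ_ray_end u1 ec1 rc1.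
have [e2 [w2 re2 [r2 r20 hr2]]] := germ_ray_end u2 ec2 rc2.
have [e3 [w3 re3 [r3 r30 hr3]]] := germ_ray_end u3 ec3 rc3.
have E : cyclic_sign (mob al be e1) (mob al be e2) (mob al be e3) =
    cyclic_sign (reduceC V v1) (reduceC V v2) (reduceC V v3).
  rewrite cyclic_sign_mob ?mal_gt_mbe //.
  have := cs0; rewrite -(csmall_reduceC w1 u1 r10 hr1) -(csmall_reduceC w2 u2 r20 hr2).
  by rewrite -(csmall_reduceC w3 u3 r30 hr3) => /(cyclic_sign_reduceC w1 w2 w3).
have near_or : \forall k \near ult_sets u, or_disc (mrepr P k) (endp g1 k) (endp g2 k) (endp g3 k)
    = cyclic_sign (reduceC V v1) (reduceC V v2) (reduceC V v3).
  by rewrite -E; apply: rep_cyclic_sign re1 re2 re3 _; rewrite E.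
(* The limit is unique: two almost sure values agree at a common index. *)
rewrite /ulim_int; case: xgetP => [n _ hn|/(_ _ near_or) []].
by have [k [/= <- <-]] := filter_ex (filterI hn near_or).
Qed.

End RayEnds.
End TreeGerms.

(** * The action of the group *)

Section MatrixBounds.
Variable R : realType.
Implicit Types (M N : 'M[R]_2) (A B : SL2 R) (b c : R).

Definition mx_bounded M b := forall i j, `|M i j| <= b.

Lemma mx_boundedM M N b c : mx_bounded M b -> mx_bounded N c -> mx_bounded (M *m N) (2 * (b * c)).
Proof.
move=> hM hN i j; rewrite mxE !big_ord_recl big_ord0 addr0 mulr_natl mulr2n.
by apply: le_trans (ler_normD _ _) _; rewrite lerD // normrM ler_pM.
Qed.

(** The inverse is the adjugate, whose entries are those of [A] up to sign and position. *)
Lemma sl2_invE A i j : exists i' j', `|(sl2_mx A^-1%g) i j| = `|sl2_mx A i' j'|.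
Proof.
pose N : 'M[R]_2 := \matrix_(i, j)
  (if i == 0 then if j == 0 then sl2_mx A 1 1 else - sl2_mx A 0 1
   else if j == 0 then - sl2_mx A 1 0 else sl2_mx A 0 0).
have d := sl2_det A; rewrite det_mx22 in d.
have AN : sl2_mx A *m N = 1%:M.
  apply/matrixP => k l; rewrite !mxE !big_ord_recl big_ord0 addr0 !mxE /=.
  have -> : lift ord0 ord0 = 1 :> 'I_2 by apply: val_inj.
  have ord2 (m : 'I_2) : m = 0 \/ m = 1.
    by case: m => -[|[|//]] hm; [left|right]; apply: val_inj.
  case: (ord2 k) => ->; case: (ord2 l) => -> /=.
  - by rewrite -[RHS]d; ring.
  - by rewrite -[RHS]/(0 : R); ring.
  - by rewrite -[RHS]/(0 : R); ring.
  - by rewrite -[RHS]d; ring.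
have -> : sl2_mx A^-1%g = N.
  by rewrite /= -[LHS]mulmx1 -AN mulmxA mulVmx ?mul1mx // sl2_unit.
rewrite mxE; case: (i == 0); case: (j == 0).
- by exists 1, 1.
- by exists 0, 1; rewrite normrN.
- by exists 1, 0; rewrite normrN.
- by exists 0, 0.
Qed.

Lemma pslrepr_norm A i j : `|sl2_mx (pslrepr (pslclass A)) i j| = `|sl2_mx A i j|.
Proof.
have /pslclass_eq/psl_eqP[b ->] := pslreprK (pslclass A).
by rewrite mxE normrM normrX normrN1 expr1n mul1r.
Qed.

Lemma psl_normsqE (p : PSL2 R) : psl_normsq p = \sum_i \sum_j sl2_mx (pslrepr p) i j ^+ 2.
Proof.
apply: eq_bigr => i _; rewrite mxE; apply: eq_bigr => j _.
by rewrite mxE expr2.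
Qed.

Lemma psl_normsq_ge0 (p : PSL2 R) : 0 <= psl_normsq p.
Proof. by rewrite psl_normsqE; do 2![apply: sumr_ge0 => ? _]; exact: sqr_ge0. Qed.

Lemma psl_normsq_bound (p : PSL2 R) b : psl_normsq p <= b ^+ 2 -> 0 <= b ->
  mx_bounded (pslrepr p) b.
Proof.
move=> h b0 i j; rewrite -(@ler_pXn2r _ 2) ?nnegrE // real_normK ?num_real //.
apply: le_trans h; rewrite psl_normsqE (bigD1 i) //= (bigD1 j) //= -addrA lerDl.
apply: addr_ge0; first by apply: sumr_ge0 => ? _; exact: sqr_ge0.
by do 2![apply: sumr_ge0 => ? _]; exact: sqr_ge0.
Qed.

End MatrixBounds.

(** * Growth of the representations under the adaptedness condition *)

Section Adapted.
Variables (R : realType) (Gam : groupType) (S : {fset Gam}) (u : npultrafilter).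
Variables (lam : nat -> R) (phi : nat -> {multiplicative Gam -> PSL2 R}).
Hypothesis S_gen : generating S.
Hypothesis hlam : lam @ \oo --> +oo.
Hypothesis phi_adapted : adapted u S (mu_seq lam) phi.

Lemma near_mu_gt (C : R) : \forall k \near ult_sets u, C < mu_seq lam k.
Proof.
apply: filterS (near_lam_gt u hlam C) => k h.
by rewrite /mu_seq; apply: lt_le_trans (expR_ge1Dx _); lra.
Qed.

Lemma multiplicative1 (G H : groupType) (f : {multiplicative G -> H}) : f 1%g = 1%g.
Proof. by apply: (mulgI (f 1%g)); rewrite -gmulfM !mulg1. Qed.

Lemma multiplicativeV (G H : groupType) (f : {multiplicative G -> H}) x :
  f x^-1%g = (f x)^-1%g.
Proof. by apply: (mulgI (f x)); rewrite -gmulfM !mulgV multiplicative1. Qed.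

(** Elements with polynomial bounds in [mu] form a subgroup: the 2 from a matrix product is absorbed
    by one more factor [mu]. Adaptedness puts the generators in it, as [c * mu] is almost surely
    below [mu ^+ 2]. *)
Lemma adapted_bounded (g : Gam) : exists n : nat,
  \forall k \near ult_sets u, mx_bounded (pslrepr (phi k g)) (mu_seq lam k ^+ n).
Proof.
move: g; apply: (S_gen (H := fun g => exists n : nat,
  \forall k \near ult_sets u, mx_bounded (pslrepr (phi k g)) (mu_seq lam k ^+ n))).
- exists 0%N; apply: filterE => k i j; rewrite multiplicative1 -[1%g]/(pslclass 1%g) pslrepr_norm.
  by rewrite mxE expr0; case: (i == j); rewrite ?normr1 ?normr0.
- move=> x y [n hn] [m hm]; exists (n + m).+1.
  apply: filterS3 hn hm (near_mu_gt 2) => k bn bm m2 i j.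
  rewrite gmulfM -[(_ * _)%g]/(pslclass (pslrepr (phi k x) * pslrepr (phi k y))%g) pslrepr_norm.
  apply: le_trans (mx_boundedM bn bm i j) _.
  by rewrite exprS exprD ler_wpM2r ?ltW // mulr_gt0 ?exprn_gt0 ?expR_gt0.
- move=> x [n hn]; exists n; apply: filterS hn => k bn i j.
  rewrite multiplicativeV -[(_^-1)%g]/(pslclass (pslrepr (phi k x))^-1%g) pslrepr_norm.
  by have [i' [j' ->]] := sl2_invE (pslrepr (phi k x)) i j.
- move=> s sS; case: phi_adapted => c c0 hc; exists 1%N.
  apply: filterS2 hc (near_mu_gt c) => k h ck.
  have m0 : 0 < mu_seq lam k by exact: expR_gt0.
  rewrite expr1; apply: psl_normsq_bound (ltW m0).
  apply: le_trans (_ : c * mu_seq lam k <= _); last by rewrite expr2 ler_wpM2r // ltW.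
  apply: le_trans h; rewrite (big_rem s) //= lerDl; apply: sumr_ge0 => t _.
  exact: psl_normsq_ge0.
Qed.

Variable F : seq_field u lam.

(** The polynomial bounds provide classes for the entries, and the determinant identity passes to
    them. *)
Lemma adapted_rep (g : Gam) : exists B : SL2 F, forall i j,
  rep F (fun k => sl2_mx (pslrepr (phi k g)) i j) (sl2_mx B i j).
Proof.
have [n hn] := adapted_bounded g.
have ex i j : exists h, rep F (fun k => sl2_mx (pslrepr (phi k g)) i j) h.
  by apply: rep_bounded (repX n (rep_mu F)) _; apply: filterS hn => k.
pose M : 'M[F]_2 := \matrix_(i, j) sval (cid (ex i j)).
have MP i j : rep F (fun k => sl2_mx (pslrepr (phi k g)) i j) (M i j).
  by rewrite mxE; exact: (svalP (cid (ex i j))).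
have dM : \det M == 1.
  rewrite det_mx22; apply/eqP; apply: rep_fun _ (rep1 F).
  apply: rep_ext (repB (repM (MP 0 0) (MP 1 1)) (repM (MP 0 1) (MP 1 0))).
  by apply: filterE => k; rewrite -det_mx22 sl2_det.
by exists (MkSL2 dM).
Qed.

End Adapted.

(** * Specialisation to the Robinson field *)

Section RobinsonTree.
Variables (R : realType) (u : npultrafilter) (lam : nat -> R).
Hypothesis hlam : lam @ \oo --> +oo.
Local Notation F := (rob_field u hlam).
Local Notation Psi := (cone_to_tree F hlam : cone u lam -> robtree u hlam).

Lemma cone_to_tree_induced : induced_by_classes Psi.
Proof.
move=> z; exists (seq_point F hlam z); last first.
  exact: (cone_to_tree_class hlam (seq_pointP F hlam z)).
have := seq_pointP F hlam z; case: (seq_point F hlam z) => -[a b] hw [].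
by move=> h1 h2; rewrite /rob_class_C (rob_rep_class h1) (rob_rep_class h2).
Qed.

Lemma rob_repE (Gam : groupType) (phi : nat -> {multiplicative Gam -> PSL2 R}) (g : Gam)
    (B : SL2 F) :
  (forall i j, rep F (fun k => sl2_mx (pslrepr (phi k g)) i j) (sl2_mx B i j)) ->
  rob_rep u hlam phi g = pslclass B.
Proof.
move=> hB; rewrite /rob_rep; congr pslclass.
set M := \matrix_(i, j) _; suff -> : M = sl2_mx B by exact: valKd.
by apply/matrixP => i j; rewrite mxE; exact: (rob_rep_class (hB i j)).
Qed.

Lemma normc_eq1 (K : rcfType) (z : K[i]) : Normc.normc z = 1 <-> nsq z = 1.
Proof.
have -> : Normc.normc z = Num.sqrt (nsq z) by case: z.
split=> [h|->]; last exact: sqrtr1.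
by rewrite -[LHS]sqr_sqrtr ?nsq_ge0 // h expr1n.
Qed.

(** Existence of a radial direction excludes the default of [xget]; whatever choice it makes is the
    residue of such a direction. *)
Lemma germ_coordP (A : PSL2 F) (p : robtree u hlam) (g : germ (@robtree_mdist R u lam hlam) p) :
  tree_class (psl_act A (disc0 F)) = p ->
  exists v : F[i], [/\ nsq v = 1, radial_germ A v g &
    germ_coord A g = reduceC (RobF_val u hlam) v].
Proof.
move=> hA; rewrite /germ_coord; case: xgetP => [zeta _ [v [v1 rv ->]]|].
  by exists v; split; [exact/normc_eq1|exact: rv|].
have [v [v1 rv]] := radial_germ_exists hlam hA g.
by move/(_ (reduceC (RobF_val u hlam) v)); case; exists v; split=> //; exact/normc_eq1.
Qed.

Lemma cone_to_tree_orientation :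
  orientation_preserving
    (cone_to_tree_isom F hlam :
       distance_preserving (@cone_mdist R u lam) (@robtree_mdist R u lam hlam) Psi)
    (@or_ultralimit R u lam) (@or_residue R u lam hlam).
Proof.
move=> P g1 g2 g3; rewrite /or_residue; set A := xget _ _.
have hA : @tree_class R u lam F (psl_act A (disc0 F)) = cone_to_tree F hlam P.
  (* By transitivity some element takes the centre to the point, so the default is not taken. *)
  rewrite /A; case: xgetP => [A' _ //|].
  have [A' hA'] := psl_act_trans (seq_point F hlam (mrepr P)).
  by move=> /(_ A') h; exfalso; apply: h; exact: (congr1 (@tree_class R u lam F) hA').
have [v1 [n1 r1 ->]] := germ_coordP (germ_map (cone_to_tree_isom F hlam) g1) hA.
have [v2 [n2 r2 ->]] := germ_coordP (germ_map (cone_to_tree_isom F hlam) g2) hA.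
have [v3 [n3 r3 ->]] := germ_coordP (germ_map (cone_to_tree_isom F hlam) g3) hA.
symmetry; apply: (ultralimit_cyclic_sign hA _ n1 n2 n3 r1 r2 r3).
(* The ideal of [RobF_val] is by definition [log_negligible]. *)
by move=> h.
Qed.

End RobinsonTree.

Theorem theorem4p33 (R : realType) (Gam : groupType)
  (S : {fset Gam}) (S_gen : generating S)
  (u : npultrafilter)
  (lam : nat -> R) (lam_infty : lam @ \oo --> +oo)
  (phi : nat -> {multiplicative Gam -> PSL2 R})
  (phi_M : forall k, in_MGamma S (phi k))
  (phi_adapted : adapted u S (mu_seq lam) phi) :
  exists Psi : cone u lam -> robtree u lam_infty,
    [/\ induced_by_classes Psi,
        forall (g : Gam) (p : cone u lam),
          Psi (cone_act phi g p) = robtree_act (rob_rep u lam_infty phi g) (Psi p),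
        forall q : robtree u lam_infty, exists p : cone u lam, Psi p = q &
        exists Psi_dist : distance_preserving (@cone_mdist R u lam)
                            (@robtree_mdist R u lam lam_infty) Psi,
          orientation_preserving Psi_dist (@or_ultralimit R u lam)
            (@or_residue R u lam lam_infty)].
Proof.
exists (cone_to_tree (rob_field u lam_infty) lam_infty); split.
- exact: cone_to_tree_induced.
- move=> g p.
  have [B hB] := adapted_rep S_gen lam_infty phi_adapted (rob_field u lam_infty) g.
  by rewrite (rob_repE hB); exact: (cone_to_tree_act lam_infty p hB).
- by move=> q; exact: (@cone_to_tree_surj _ _ _ (rob_field u lam_infty) lam_infty q).
- exists (cone_to_tree_isom (rob_field u lam_infty) lam_infty).
  exact: cone_to_tree_orientation.
Qed.
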